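(* Let $n$ and $R$ be positive integers. As $n \to \infty$, $$p(n) = \frac{\exp\left( \pi \sqrt{2n/3} \right)}{4 \sqrt{3}\, n}\left( 1+\sum_{r=1}^{R-1} \frac{\omega_r}{n^{r/2}} + O\left( \frac{1}{n^{R/2}}\right)\right),$$ with an implied constant depending only on $R$, where $$\omega_r = \frac{1}{(-4\sqrt{6})^r} \sum_{0\leqslant k\leqslant (r+1)/2} \binom{r+1}{k} \frac{r+1-k}{(r+1-2k)!} \left( \frac{\pi}6\right)^{r-2k},$$ the sum being over integers $k$.
   Context: $p(n)$ is the usual partition function: the number of partitions of $n$ into positive integers. *)

(* Defs.v *)
From Stdlib Require Import Reals ZArith.
From Coquelicot Require Import Coquelicot.
From mathcomp Require Import all_boot.

Set Implicit Arguments.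
Unset Strict Implicit.
Unset Printing Implicit Defensive.

Local Open Scope nat_scope.

Definition is_partition (n : nat) (s : seq nat) : bool :=
  [&& sorted geq s, all (fun i => 0 < i) s & sumn s == n].

(* A partition of [n] has at most [n] parts, each at most [n], so it is no
   restriction to count among the sequences of length at most [n] with entries
   in [0, n]; see [partition_bseq]. *)
Definition partition_number (n : nat) : nat :=
  #|[set t : n.-bseq 'I_n.+1 | is_partition n (map val t)]|.

Lemma partition_bseq (n : nat) (s : seq nat) :
  is_partition n s -> exists t : n.-bseq 'I_n.+1, map val t = s.
Proof.
move=> /and3P[_ pos_s /eqP sum_s].
have size_s : size s <= n.
  rewrite -{}sum_s; elim: s pos_s => //= i s IHs /andP[i_gt0 /IHs le_s].
  by rewrite -add1n leq_add.
have le_s : all (fun i => i < n.+1) s.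
  apply/allP => i si; rewrite ltnS -sum_s.
  elim: s si {pos_s size_s sum_s} => //= j s IHs.
  rewrite inE => /predU1P[->|/IHs le_i]; first exact: leq_addr.
  exact: leq_trans le_i (leq_addl _ _).
have val_t : map val (pmap insub s : seq 'I_n.+1) = s.
  rewrite pmap_filter; last exact: insubK.
  by apply/all_filterP; apply: sub_all le_s => i lt_i; rewrite insubT.
have size_t : size (pmap insub s : seq 'I_n.+1) <= n.
  by rewrite -(size_map val) val_t.
by exists (Bseq size_t).
Qed.

Local Open Scope R_scope.

(* The last exponent of [PI / 6] is -1 when [r] is odd, hence [powerRZ]. *)
Definition omega (r : nat) : R :=
  1 / (- (4 * sqrt 6)) ^ r *
  sum_n_m (fun k : nat =>
      INR 'C(r.+1, k) * (INR (r.+1 - k) / INR (r.+1 - 2 * k)`!) *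
      powerRZ (PI / 6) (Z.of_nat r - 2 * Z.of_nat k))
    0 (r.+1)./2.

(* Main.v *)
Require Import Defs.
From Stdlib Require Import Reals ZArith Lra Lia Psatz.
From Coquelicot Require Import Coquelicot.
From mathcomp Require Import all_boot.
From mathcomp Require Import zify_ssreflect.

(** The circle method, with a contour adapted to [P(q) = sum p(k) q^k], [q = exp (- tau)].
Cauchy's formula is applied termwise along the arc [|tau| = t], [|arg tau| <= PI / 6],
continued vertically to [Im tau = PI], where [t] is the saddle point [PI / sqrt (6 y)] for
[y = n - 1 / 24].  On the arc, Euler's pentagonal theorem and the inversion of the theta function
give [P] up to an exponentially small relative error; the main term times [exp (n tau)] becomes
[exp (2 lam cos phi)] up to a phase, and [v = sin (phi / 2)] turns its integral into an elementary
Gaussian one, with value [exp X / (4 sqrt 3 y) * (1 - 1 / X)] for [X = PI sqrt (2 y / 3)].  On the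
vertical part, [|1 - z| / (1 - |z|) >= exp ((|z| - Re z) / 4)] makes [P] exponentially smaller.
The theta inversion for complex parameters is Poisson summation: the Fejer kernel reduces it to the
Fourier transforms of complex Gaussians, computed with a complex error function.
Finally, expanding [exp X / (4 sqrt 3 y) * (1 - 1 / X)] in [n^(-1/2)] uses the generating functions
[sum_k C(m + 2 k, k) w^k] and [sum_k (m + k) C(m + 2 k, k) w^k], which satisfy three-term recurrences
in [m] and are powers of the Catalan series over powers of [sqrt (1 - 4 w)]. *)

(** * Counting partitions *)

Local Open Scope nat_scope.

(** An expansion to every order in [n^(-1/2)] is out of reach of a saddle point estimate with one
    fixed power saving. So every error is made smaller than the main term by a factor
    [exp (- c sqrt n)], and the expansion is that of one closed form. This dictates the contour: on
    [|tau| = t] the exponent [y tau + PI^2 / (6 tau)] is exactly real, and nothing in the main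
    integral is approximated. The angle [PI / 6] is a compromise. On the vertical part the bound by
    absolute values has exponent [lam (cos al + 1 / cos al)], which at [al = PI / 6] is
    [2.0207 lam], barely above [2 lam]; but [Im tau >= t / 2] there, far enough from the real axis
    for a gain proportional to [lam] that brings it below [2 lam]. Hence the tiny saving [1 / 2000].
    The generating function occurs only through partial sums: the truncation order [M] is free,
    costs a geometric power [s ^ M], and goes to infinity once the contour estimate is complete. The
    theta inversion, too, is needed only up to the geometric size of the dropped frequencies, so
    finitely many Fourier integrals suffice at each stage. *)

Fixpoint parts (f m n : nat) : seq (seq nat) :=
  match f, m with
  | f'.+1, m'.+1 => parts f' m' n ++ (if m <= n then map (cons m) (parts f' m (n - m)) else [::])
  | _, _ => if n == 0 then [:: [::]] else [::]
  end.

Definition bounded_partition (m n : nat) (s : seq nat) : bool :=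
  is_partition n s && all (fun i => i <= m) s.

Lemma bounded_partition0 n s : bounded_partition 0 n s = (n == 0) && (s == [::]).
Proof.
case: s => [|i s]; first by rewrite /bounded_partition /is_partition /= !andbT [0 == n]eq_sym.
rewrite /bounded_partition /is_partition /= andbF.
by apply/negP => /and3P[/and3P[_ /andP[i0 _] _] i1 _]; move: i0; rewrite ltnNge i1.
Qed.

Lemma bounded_partition_cons m n s :
  bounded_partition m n (m :: s) = [&& 0 < m, m <= n & bounded_partition m (n - m) s].
Proof.
rewrite /bounded_partition /is_partition /= leqnn /=.
rewrite path_sortedE; last by move=> ? ? ? h1 h2; exact: leq_trans h2 h1.
case: (posnP m) => [->|m0] /=; first by rewrite andbF.
case: (leqP m n) => mn /=; last first.
  by apply/negP => /andP[/and3P[_ _ /eqP e] _]; lia.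
have -> : (m + sumn s == n) = (sumn s == n - m) by apply/eqP/eqP; lia.
rewrite (eq_all (a1 := geq m) (a2 := fun i => i <= m)) //.
by case: (all (fun i => i <= m) s); rewrite /= ?andbT ?andbF.
Qed.

Lemma bounded_partitionS m n s :
  bounded_partition m.+1 n s =
  bounded_partition m n s || (bounded_partition m.+1 n s && (head 0 s == m.+1)).
Proof.
case: s => [|i s]; first by rewrite /= andbF orbF.
rewrite /= eq_sym; case: eqP => [e|ne].
  rewrite andbT -e; case: (bounded_partition _ _ (m.+1 :: s)); rewrite ?orbT ?orbF //.
  by rewrite /bounded_partition /= ltnn /= andbF.
rewrite andbF orbF /bounded_partition.
apply/andP/andP => -[h a]; split => //.
  move: h a; rewrite /is_partition /= => /and3P[].
  rewrite path_sortedE; last by move=> ? ? ? h1 h2; exact: leq_trans h2 h1.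
  move=> /andP[g _] _ _ /andP[i1 _]; have im : i <= m by lia.
  by rewrite im /=; apply: sub_all g => j /= h; exact: leq_trans h im.
by apply: sub_all a => j h0; exact: leqW.
Qed.

(** Either no part equals [m], or the largest part is [m] and removing it leaves a partition of
    [n - m]. Both branches lower [m + n], which is why fuel [m + n] is enough. *)
Lemma mem_parts f m n s : m + n <= f -> (s \in parts f m n) = bounded_partition m n s.
Proof.
elim: f m n s => [|f IHf] [|m] n s h.
- by rewrite bounded_partition0 /=; case: eqP; rewrite ?inE.
- by [].
- by rewrite bounded_partition0 /=; case: eqP; rewrite ?inE.
rewrite [parts _ _ _]/= mem_cat IHf; last lia.
rewrite [RHS]bounded_partitionS; congr (_ || _).
case: s => [|i s].
  rewrite andbF; case: (m < n) => //.
  by apply/mapP => -[].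
rewrite [head _ _]/=; case: (eqVneq i m.+1) => [->|ne].
  rewrite andbT bounded_partition_cons /=; case: (ltnP m n) => mn //.
  rewrite mem_map; last by move=> ? ? [].
  by rewrite IHf //; lia.
rewrite andbF; case: (m < n) => //.
by apply/mapP => -[s' _ [e _]]; rewrite e eqxx in ne.
Qed.

Lemma uniq_parts f m n : m + n <= f -> uniq (parts f m n).
Proof.
elim: f m n => [|f IHf] [|m] n h /=; try by case: eqP.
rewrite cat_uniq IHf /=; last lia.
case: (ltnP m n) => mn //; rewrite map_inj_uniq; last by move=> ? ? [].
rewrite IHf ?andbT; last lia.
apply/hasPn => s /mapP[s' _ ->]; rewrite mem_parts; last lia.
by rewrite /bounded_partition /= ltnn /= andbF.
Qed.

Definition cnt (m n : nat) : nat := size (parts (m + n) m n).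

Lemma size_parts f m n : m + n <= f -> size (parts f m n) = cnt m n.
Proof.
move=> h; apply: perm_size; apply: uniq_perm; try exact: uniq_parts.
by move=> s; rewrite !mem_parts.
Qed.

Lemma cnt0 n : cnt 0 n = (n == 0).
Proof. by rewrite /cnt; case: n. Qed.

(** The Euler product, one factor at a time: with [P_m] the generating function of [cnt m], these
    are the coefficients of [(1 - q^(m+1)) P_(m+1) = P_m]. *)
Lemma cntS m n : cnt m.+1 n = cnt m n + (if m.+1 <= n then cnt m.+1 (n - m.+1) else 0).
Proof.
rewrite /cnt [m.+1 + n]addSn [LHS]/= size_cat -/(cnt m n); congr (_ + _).
by case: ifP => // h; rewrite size_map size_parts //; lia.
Qed.

Lemma cnt_partition_number m n : n <= m -> cnt m n = partition_number n.
Proof.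
move=> nm; rewrite /partition_number cardE -(size_map (fun t : n.-bseq 'I_n.+1 => map val t)).
apply: perm_size; apply: uniq_perm.
- exact: uniq_parts.
- rewrite map_inj_uniq ?enum_uniq // => t1 t2 /(inj_map val_inj) e.
  exact: val_inj.
move=> s; rewrite mem_parts //.
apply/idP/mapP => [/andP[h _]|[t]].
  have [t e] := partition_bseq h.
  by exists t; rewrite // mem_enum inE e.
rewrite mem_enum inE => h ->; rewrite /bounded_partition h /=.
by apply/allP => i /mapP[j _ ->]; rewrite (leq_trans _ nm) // -ltnS ltn_ord.
Qed.

Delimit Scope R_scope with R.
Local Open Scope R_scope.

(** * Complex exponential and complex-valued functions of a real variable *)

Definition cexp (z : C) : C := (exp (Re z) * cos (Im z), exp (Re z) * sin (Im z)).

Lemma C_ext (a b : C) : Re a = Re b -> Im a = Im b -> a = b.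
Proof. by case: a b => [a1 a2] [b1 b2] /= -> ->. Qed.

Ltac C_ring :=
  rewrite /minus /plus /opp /scal /=; apply: C_ext;
  rewrite /= /minus /plus /opp /scal /= /mult /=;
  match goal with |- @eq _ ?a ?b => change (@eq R a b) end; ring.

Lemma cexp_add (a b : C) : cexp (a + b) = (cexp a * cexp b)%C.
Proof.
rewrite /cexp re_plus im_plus exp_plus cos_plus sin_plus /Cmult /=.
by apply: C_ext => /=; ring.
Qed.

Lemma cexp_RtoC (x : R) : cexp x = exp x.
Proof.
rewrite /cexp /= cos_0 sin_0; apply: C_ext => /=; ring.
Qed.

Lemma cexp_0 : cexp 0 = 1.
Proof. by rewrite cexp_RtoC exp_0. Qed.

Lemma Cmod_cexp (z : C) : Cmod (cexp z) = exp (Re z).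
Proof.
rewrite /Cmod /cexp /=.
have -> : exp (Re z) * cos (Im z) * (exp (Re z) * cos (Im z) * 1) +
   exp (Re z) * sin (Im z) * (exp (Re z) * sin (Im z) * 1) =
   Rsqr (exp (Re z)) * (Rsqr (sin (Im z)) + Rsqr (cos (Im z))) by rewrite /Rsqr; ring.
rewrite sin2_cos2 Rmult_1_r sqrt_Rsqr //.
by left; apply: exp_pos.
Qed.

Lemma cexp_neq0 (z : C) : cexp z <> 0.
Proof. by apply/Cmod_gt_0; rewrite Cmod_cexp; apply: exp_pos. Qed.

Lemma cexp_opp (z : C) : cexp (- z) = (/ cexp z)%C.
Proof.
have E : (cexp z * cexp (- z))%C = 1 by rewrite -cexp_add Cplus_opp_r cexp_0.
have := cexp_neq0 z => nz; rewrite -[LHS]Cmult_1_l -(Cinv_l _ nz) -Cmult_assoc E.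
by rewrite Cmult_1_r.
Qed.

Lemma cexp_pow (z : C) (n : nat) : cexp (INR n * z)%C = (cexp z ^ n)%C.
Proof.
elim: n => [|n IHn]; first by rewrite /= Cmult_0_l cexp_0.
by rewrite S_INR RtoC_plus Cmult_plus_distr_r Cmult_1_l cexp_add IHn Cpow_S Cmult_comm.
Qed.

Notation CR := C_R_CompleteNormedModule.

Lemma norm_CR (z : C) : norm (z : CR) = Cmod z.
Proof.
rewrite /norm /= /prod_norm /Cmod -[norm z.1]/(Rabs z.1) -[norm z.2]/(Rabs z.2).
by rewrite !pow2_abs.
Qed.

Lemma Cmod_le_Re_Im (z : C) : Cmod z <= Rabs (Re z) + Rabs (Im z).
Proof.
have -> : z = (RtoC (Re z) + Ci * RtoC (Im z))%C.
  by apply: C_ext => /=; ring.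
apply: Rle_trans (Cmod_triangle _ _) _.
rewrite Cmod_mult Cmod_Ci !Cmod_R /=; apply: Req_le.
by congr (Rabs _ + _); [ring | rewrite Rmult_1_l; congr Rabs; ring].
Qed.

Lemma is_derive_C (f : R -> C) (x : R) (l : C) :
  is_derive (fun t => Re (f t)) x (Re l) ->
  is_derive (fun t => Im (f t)) x (Im l) ->
  is_derive (V := CR) f x l.
Proof.
move=> [_ H1] [_ H2].
split; first exact: is_linear_scal_l.
move=> y Hy eps.
have e2 : 0 < eps / 2 by have := cond_pos eps; lra.
apply: filter_imp (filter_and _ _ (H1 y Hy (mkposreal _ e2)) (H2 y Hy (mkposreal _ e2))).
move=> u [/= h1 h2].
rewrite norm_CR; apply: Rle_trans (Cmod_le_Re_Im _) _.
set b := norm (minus u y) in h1 h2 *.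
have -> : pos eps * b = eps / 2 * b + eps / 2 * b by field.
exact: Rplus_le_compat h1 h2.
Qed.

(** Serves to differentiate integrals with respect to a parameter: the quadratic bound on the
    remainder is obtained by integrating a pointwise one, with no interchange of limits. *)
Lemma is_derive_quad (V : NormedModule R_AbsRing) (f : R -> V) (x d K : R) (l : V) :
  0 < d ->
  (forall h, Rabs h < d ->
     norm (minus (minus (f (x + h)) (f x)) (scal h l)) <= K * h ^ 2) ->
  is_derive f x l.
Proof.
move=> d_gt0 Hf; split; first exact: is_linear_scal_l.
move=> y Hy eps.
have -> : y = x by symmetry; apply: is_filter_lim_locally_unique Hy.
have K1 : 0 < Rabs K + 1 by have := Rabs_pos K; lra.
have m_gt0 : 0 < Rmin d (eps / (Rabs K + 1)).
  by apply: Rmin_pos => //; apply: Rdiv_lt_0_compat => //; apply: cond_pos.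
exists (mkposreal _ m_gt0) => u /= Hu.
have {}Hu : Rabs (u - x) < Rmin d (eps / (Rabs K + 1)) by [].
have hd : Rabs (u - x) < d by apply: Rlt_le_trans Hu (Rmin_l _ _).
have he : Rabs (u - x) < eps / (Rabs K + 1) by apply: Rlt_le_trans Hu (Rmin_r _ _).
have := Hf _ hd; rewrite (_ : x + (u - x) = u); last by ring.
move/Rle_trans; apply.
rewrite -[norm (minus u x)]/(Rabs (u - x)) -Rsqr_pow2 Rsqr_abs /Rsqr -Rmult_assoc.
apply: Rmult_le_compat_r; first exact: Rabs_pos.
apply: Rle_trans (_ : (Rabs K + 1) * Rabs (u - x) <= _).
  by apply: Rmult_le_compat_r; [exact: Rabs_pos | have := Rle_abs K; lra].
apply: Rle_trans (_ : (Rabs K + 1) * (eps / (Rabs K + 1)) <= _); last by right; field; lra.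
by apply: Rmult_le_compat_l; lra.
Qed.
Lemma is_derive_cexp (g : R -> C) (x : R) (l : C) :
  is_derive (fun t => Re (g t)) x (Re l) ->
  is_derive (fun t => Im (g t)) x (Im l) ->
  is_derive (V := CR) (fun t => cexp (g t)) x (l * cexp (g x))%C.
Proof.
move=> Hr Hi; apply: is_derive_C.
- rewrite re_mult /=.
  apply: (is_derive_ext (fun t => exp (Re (g t)) * cos (Im (g t)))) => //.
  have E1 := is_derive_comp exp _ x _ _ (is_derive_exp _) Hr.
  have E2 := is_derive_comp cos _ x _ _ (is_derive_cos _) Hi.
  have := is_derive_mult _ _ _ _ _ E1 E2 Rmult_comm.
  congr is_derive; rewrite /plus /mult /scal /= /mult /= /Re /Im; ring.
- rewrite im_mult /=.
  apply: (is_derive_ext (fun t => exp (Re (g t)) * sin (Im (g t)))) => //.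
  have E1 := is_derive_comp exp _ x _ _ (is_derive_exp _) Hr.
  have E2 := is_derive_comp sin _ x _ _ (is_derive_sin _) Hi.
  have := is_derive_mult _ _ _ _ _ E1 E2 Rmult_comm.
  congr is_derive; rewrite /plus /mult /scal /= /mult /= /Re /Im; ring.
Qed.

Lemma is_derive_cexp_line (w b : C) (x : R) :
  is_derive (V := CR) (fun t : R => cexp (w * t + b)) x (w * cexp (w * x + b))%C.
Proof.
apply: is_derive_cexp => /=; rewrite /Re /Im /=.
  by auto_derive => //=; ring.
by auto_derive => //=; ring.
Qed.

Lemma continuous_C (f : R -> C) (x : R) :
  continuous (fun t => Re (f t)) x -> continuous (fun t => Im (f t)) x ->
  continuous (U := CR) f x.
Proof.
move=> H1 H2; apply: (continuous_ext (fun t => (Re (f t), Im (f t)))).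
  by move=> t; case: (f t).
move=> P [e He].
have h1 : locally x (fun t => ball (Re (f x)) e (Re (f t))) := H1 _ (locally_ball _ e).
have h2 : locally x (fun t => ball (Im (f x)) e (Im (f t))) := H2 _ (locally_ball _ e).
rewrite /filtermap; apply: (filter_imp _ _ _ (filter_and _ _ h1 h2)).
by move=> t [{}h1 {}h2]; apply: He; split.
Qed.

Lemma ex_derive_continuous_CR (f : R -> C) (x : R) (l : C) :
  is_derive (V := CR) f x l -> continuous (U := CR) f x.
Proof. by move=> H; apply: ex_derive_continuous; exists l. Qed.

Lemma continuous_Cmult (f g : R -> C) (x : R) :
  continuous (U := CR) f x -> continuous (U := CR) g x ->
  continuous (U := CR) (fun t => f t * g t)%C x.
Proof.
have aux (h : R -> C) : continuous (U := CR) h x ->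
  continuous (fun t => Re (h t)) x /\ continuous (fun t => Im (h t)) x.
  move=> H; split.
    by apply: (continuous_comp h (fst : R * R -> R)) H _; case: (h x) => a b; exact: continuous_fst.
  by apply: (continuous_comp h (snd : R * R -> R)) H _; case: (h x) => a b; exact: continuous_snd.
move=> /aux[f1 f2] /aux[g1 g2]; apply: continuous_C => /=.
- apply: (continuous_ext (fun t => minus (mult (Re (f t)) (Re (g t))) (mult (Im (f t)) (Im (g t))))) => //.
  by apply: continuous_minus; apply: continuous_mult.
- apply: (continuous_ext (fun t => plus (mult (Re (f t)) (Im (g t))) (mult (Im (f t)) (Re (g t))))) => //.
  by apply: continuous_plus; apply: continuous_mult.
Qed.

Lemma is_RInt_C_bound (f : R -> C) (a b M : R) (l : C) :
  a <= b -> is_RInt (V := CR) f a b l ->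
  (forall x, a <= x <= b -> Cmod (f x) <= M) -> Cmod l <= (b - a) * M.
Proof.
move=> ab H Hf; rewrite -norm_CR.
apply: (norm_RInt_le (V := CR) f (fun => M) a b l _ ab _ H (is_RInt_const a b M)).
by move=> x /Hf; rewrite norm_CR.
Qed.

Lemma exp_le_compat (a b : R) : a <= b -> exp a <= exp b.
Proof. by case=> [/exp_increasing|->]; [left | right]. Qed.

Lemma is_RInt_cexp_line (w : C) :
  is_RInt (V := CR) (fun s : R => w * cexp (w * s))%C 0 1 (cexp w - 1)%C.
Proof.
have H : is_RInt (V := CR) (fun s : R => w * cexp (w * s + 0))%C 0 1
   (minus (cexp (w * 1 + 0)%C : CR) (cexp (w * 0 + 0)%C : CR)).
  apply: (is_RInt_derive (V := CR) (fun s : R => cexp (w * s + 0))) => x _.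
    exact: is_derive_cexp_line.
  apply: continuous_Cmult; first exact: continuous_const.
  exact: ex_derive_continuous_CR (is_derive_cexp_line _ _ _).
move: H; rewrite Cmult_1_r Cmult_0_r !Cplus_0_r cexp_0.
by apply: is_RInt_ext => x _; rewrite Cplus_0_r.
Qed.

Lemma Re_mult_unit_le (w : C) (x : R) : 0 <= x <= 1 -> Re (w * x) <= Cmod w.
Proof.
move=> Hx; apply: Rle_trans (Rle_abs _) _; apply: Rle_trans (re_le_Cmod _) _.
rewrite Cmod_mult Cmod_R Rabs_pos_eq; last lra.
by have := Cmod_ge_0 w; nra.
Qed.

Lemma cexp_diff1 (w : C) : Cmod (cexp w - 1)%C <= Cmod w * exp (Cmod w).
Proof.
have := is_RInt_C_bound _ 0 1 (Cmod w * exp (Cmod w)) _ Rle_0_1 (is_RInt_cexp_line w).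
rewrite Rminus_0_r Rmult_1_l; apply => x Hx.
rewrite Cmod_mult Cmod_cexp; apply: Rmult_le_compat_l; first exact: Cmod_ge_0.
exact/exp_le_compat/Re_mult_unit_le.
Qed.

Lemma cexp_diff2 (w : C) :
  Cmod (cexp w - 1 - w)%C <= Cmod w ^ 2 * exp (Cmod w).
Proof.
have H : is_RInt (V := CR) (fun s : R => w * (cexp (w * s) - 1))%C 0 1 (cexp w - 1 - w)%C.
  have h := is_RInt_minus (V := CR) _ _ _ _ _ _ (is_RInt_cexp_line w) (is_RInt_const 0 1 (w : CR)).
  have E : minus (cexp w - 1 : CR)%C (scal (1 - 0) (w : CR)) = (cexp w - 1 - w)%C.
    by C_ring.
  rewrite -E; apply: is_RInt_ext h => x _.
  by C_ring.
have := is_RInt_C_bound _ 0 1 (Cmod w ^ 2 * exp (Cmod w)) _ Rle_0_1 H.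
rewrite Rminus_0_r Rmult_1_l; apply => x Hx.
rewrite Cmod_mult; have w0 := Cmod_ge_0 w.
have := cexp_diff1 (w * x)%C; rewrite Cmod_mult Cmod_R Rabs_pos_eq; last lra.
have : exp (Cmod w * x) <= exp (Cmod w) by apply: exp_le_compat; nra.
have := exp_pos (Cmod w * x) => e0 e1 e2.
have : Cmod w * x * exp (Cmod w * x) <= Cmod w * exp (Cmod w).
  by apply: Rmult_le_compat => //; nra.
by nra.
Qed.

Lemma is_derive_Re (f : R -> C) (x : R) (l : C) :
  is_derive (V := CR) f x l -> is_derive (fun t => Re (f t)) x (Re l).
Proof.
move=> H.
have := filterdiff_comp' f (fst : R * R -> R) x _ _ H (filterdiff_linear _ is_linear_fst).
exact.
Qed.

Lemma is_derive_Im (f : R -> C) (x : R) (l : C) :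
  is_derive (V := CR) f x l -> is_derive (fun t => Im (f t)) x (Im l).
Proof.
move=> H.
have := filterdiff_comp' f (snd : R * R -> R) x _ _ H (filterdiff_linear _ is_linear_snd).
exact.
Qed.

Lemma is_derive_Cmult (f g : R -> C) (x : R) (l m : C) :
  is_derive (V := CR) f x l -> is_derive (V := CR) g x m ->
  is_derive (V := CR) (fun t => f t * g t)%C x (l * g x + f x * m)%C.
Proof.
move=> Hf Hg.
have [f1 f2] := (is_derive_Re _ _ _ Hf, is_derive_Im _ _ _ Hf).
have [g1 g2] := (is_derive_Re _ _ _ Hg, is_derive_Im _ _ _ Hg).
apply: is_derive_C.
- have := is_derive_minus _ _ _ _ _ (is_derive_mult _ _ _ _ _ f1 g1 Rmult_comm)
    (is_derive_mult _ _ _ _ _ f2 g2 Rmult_comm).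
  by congr is_derive; rewrite /minus /plus /opp /mult /= /Re /Im; ring.
- have := is_derive_plus _ _ _ _ _ (is_derive_mult _ _ _ _ _ f1 g2 Rmult_comm)
    (is_derive_mult _ _ _ _ _ f2 g1 Rmult_comm).
  by congr is_derive; rewrite /minus /plus /opp /mult /= /Re /Im; ring.
Qed.

Lemma is_derive_Cconst (c : C) (x : R) : is_derive (V := CR) (fun => c) x (RtoC 0).
Proof. exact: (is_derive_const (V := CR) c x). Qed.

Lemma is_derive_RtoC (f : R -> R) (x l : R) :
  is_derive f x l -> is_derive (V := CR) (fun t => RtoC (f t)) x (RtoC l).
Proof. by move=> H; apply: is_derive_C => //=; exact: is_derive_const. Qed.

Ltac Cring := match goal with |- @eq _ ?a ?b => refine (_ : @eq C a b) end; ring.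

Lemma is_RInt_Cmult_l (f : R -> C) (a b : R) (c l : C) :
  is_RInt (V := CR) f a b l -> is_RInt (V := CR) (fun x => c * f x)%C a b (c * l)%C.
Proof.
move=> H.
have H1 : is_RInt (fun x => Re (f x)) a b (Re l).
  exact: (is_RInt_fct_extend_fst (U := R_NormedModule) (V := R_NormedModule) f a b l H).
have H2 : is_RInt (fun x => Im (f x)) a b (Im l).
  exact: (is_RInt_fct_extend_snd (U := R_NormedModule) (V := R_NormedModule) f a b l H).
apply: (is_RInt_fct_extend_pair (U := R_NormedModule) (V := R_NormedModule)).
- have := is_RInt_minus _ _ _ _ _ _ (is_RInt_scal _ _ _ (Re c) _ H1) (is_RInt_scal _ _ _ (Im c) _ H2).
  exact.
- have := is_RInt_plus _ _ _ _ _ _ (is_RInt_scal _ _ _ (Re c) _ H2) (is_RInt_scal _ _ _ (Im c) _ H1).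
  exact.
Qed.

Ltac Rring := match goal with |- @eq _ ?a ?b => refine (_ : @eq R a b) end; ring.

Lemma is_RInt_bound (f : R -> R) (a b M l : R) :
  a <= b -> is_RInt f a b l ->
  (forall x, a <= x <= b -> Rabs (f x) <= M) -> Rabs l <= (b - a) * M.
Proof.
move=> ab H Hf.
exact: (norm_RInt_le (V := R_NormedModule) f (fun => M) a b l _ ab Hf H (is_RInt_const a b M)).
Qed.
Ltac nz := apply: Rgt_not_eq; lra.
Ltac Rfield := match goal with |- @eq _ ?a ?b => refine (_ : @eq R a b) end; field.

(** * The complex error function *)

Lemma Cmod_triangle3 (a b c : C) : Cmod (a + b + c) <= Cmod a + Cmod b + Cmod c.
Proof. by have := Cmod_triangle (a + b) c; have := Cmod_triangle a b; lra. Qed.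

(** The integral of [exp (- u^2)] along the segment from [0] to [z], scaled to [[0, 1]] so that the
    domain does not depend on [z]. *)
Definition cerf (z : C) : C :=
  RInt (V := CR) (fun s : R => z * cexp (- (z * z) * (s * s)%R))%C 0 1.

Lemma is_RInt_cerf (z : C) :
  is_RInt (V := CR) (fun s : R => z * cexp (- (z * z) * (s * s)%R))%C 0 1 (cerf z).
Proof.
apply: RInt_correct; apply: ex_RInt_continuous => s _.
apply: continuous_Cmult; first exact: continuous_const.
apply: ex_derive_continuous_CR; apply: (is_derive_cexp _ _ (- (z * z) * (2 * s)%R)%C).
  by rewrite /Re /=; auto_derive => //=; ring.
by rewrite /Im /=; auto_derive => //=; ring.
Qed.

(** The integrand is both the [z]-derivative of the integrand of [cerf] and the [s]-derivative of
    [s exp (- z^2 s^2)]; this is why [cerf] has derivative [exp (- z^2)]. *)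
Lemma is_RInt_cexp_sqr (z : C) :
  is_RInt (V := CR)
    (fun s : R => (1 - 2 * (z * z) * (s * s)%R) * cexp (- (z * z) * (s * s)%R))%C 0 1
    (cexp (- (z * z))).
Proof.
have D (s : R) : is_derive (V := CR) (fun s : R => cexp (- (z * z) * (s * s)%R)) s
    (- (z * z) * (2 * s)%R * cexp (- (z * z) * (s * s)%R))%C.
  have := is_derive_cexp (fun s : R => - (z * z) * (s * s)%R)%C s (- (z * z) * (2 * s)%R)%C.
  apply.
    by rewrite /Re /=; auto_derive => //=; ring.
  by rewrite /Im /=; auto_derive => //=; ring.
have H : is_RInt (V := CR)
    (fun s : R => (1 - 2 * (z * z) * (s * s)%R) * cexp (- (z * z) * (s * s)%R))%C 0 1
    (minus (1%R * cexp (- (z * z) * (1 * 1)%R) : CR)%C (0%R * cexp (- (z * z) * (0 * 0)%R) : CR)%C).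
  apply: (is_RInt_derive (V := CR) (fun s : R => s * cexp (- (z * z) * (s * s)%R))%C) => s _.
    have := is_derive_Cmult _ _ _ _ _ (is_derive_RtoC _ _ _ (is_derive_id s)) (D s).
    congr (is_derive (V := CR)); rewrite -[RtoC Hierarchy.one]/(RtoC 1) !RtoC_mult; Cring.
  apply: continuous_Cmult; last exact: ex_derive_continuous_CR (D s).
  apply: (ex_derive_continuous_CR _ _ (- 2 * (z * z) * (2 * s)%R)%C).
  apply: is_derive_C => /=; rewrite /Re /Im /=; auto_derive => //=; ring.
have -> : cexp (- (z * z)) = (minus (1%R * cexp (- (z * z) * (1 * 1)%R) : CR)%C (0%R * cexp (- (z * z) * (0 * 0)%R) : CR)%C).
  rewrite !Rmult_1_l !Rmult_0_l Cmult_1_r. C_ring.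
exact: H.
Qed.

Lemma Cmod_mult_RtoC_pos (z : C) (x : R) : 0 <= x -> Cmod (z * x) = Cmod z * x.
Proof. by move=> x0; rewrite Cmod_mult Cmod_R Rabs_pos_eq. Qed.

Lemma cerf_quad (z h : C) : Cmod h <= 1 ->
  Cmod (cerf (z + h) - cerf z - h * cexp (- (z * z)))%C <=
  exp (Cmod z ^ 2) * ((Cmod z + 1) * (2 * Cmod z + 1) ^ 2 * exp (2 * Cmod z + 1)
    + (3 * Cmod z + 1)) * Cmod h ^ 2.
Proof.
move=> h1; have [z0 h0] := (Cmod_ge_0 z, Cmod_ge_0 h).
have H : is_RInt (V := CR) (fun s : R =>
    ((z + h) * cexp (- ((z + h) * (z + h)) * (s * s)%R)
     - z * cexp (- (z * z) * (s * s)%R)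
     - h * ((1 - 2 * (z * z) * (s * s)%R) * cexp (- (z * z) * (s * s)%R)))%C) 0 1
    (cerf (z + h) - cerf z - h * cexp (- (z * z)))%C.
  have H1 := is_RInt_minus (V := CR) _ _ _ _ _ _ (is_RInt_cerf (z + h)) (is_RInt_cerf z).
  have H2 : is_RInt (V := CR) (fun s : R =>
     h * ((1 - 2 * (z * z) * (s * s)%R) * cexp (- (z * z) * (s * s)%R)))%C 0 1
     (h * cexp (- (z * z)))%C.
    exact: is_RInt_Cmult_l (is_RInt_cexp_sqr z).
  exact: (is_RInt_minus (V := CR) _ _ _ _ _ _ H1 H2).
have := is_RInt_C_bound _ 0 1 _ _ Rle_0_1 H.
rewrite Rminus_0_r.
set K := _ * Cmod h ^ 2.
move/(_ K); rewrite Rmult_1_l; apply => s Hs.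
have s2 : 0 <= s * s <= 1 by nra.
set d := (- (2 * z * h + h * h) * (s * s)%R)%C.
have -> : cexp (- ((z + h) * (z + h)) * (s * s)%R) = (cexp (- (z * z) * (s * s)%R) * cexp d)%C.
  by rewrite -cexp_add; congr cexp; rewrite /d; ring.
set E := cexp (- (z * z) * (s * s)%R).
have -> : ((z + h) * (E * cexp d) - z * E -
     h * ((1 - 2 * (z * z) * (s * s)%R) * E) =
     E * ((z + h) * (cexp d - 1 - d) + - (h * h * (3 * z + h) * (s * s)%R)))%C.
  by rewrite /d; ring.
have hd : Cmod d <= Cmod h * (2 * Cmod z + 1).
  rewrite /d Cmod_mult_RtoC_pos; last lra.
  rewrite Cmod_opp; have := Cmod_triangle (2 * z * h) (h * h).
  rewrite !Cmod_mult Cmod_R Rabs_pos_eq; last lra.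
  have := Cmod_ge_0 (2 * z * h + h * h); nra.
have hd' : Cmod d <= 2 * Cmod z + 1 by nra.
have hE : Cmod E <= exp (Cmod z ^ 2).
  rewrite Cmod_cexp; apply: exp_le_compat.
  apply: Rle_trans (Rle_abs _) _; apply: Rle_trans (re_le_Cmod _) _.
  rewrite Cmod_mult_RtoC_pos; last lra.
  by rewrite Cmod_opp Cmod_mult; nra.
have d0 := Cmod_ge_0 d.
have h2 : Cmod (cexp d - 1 - d) <= Cmod h ^ 2 * ((2 * Cmod z + 1) ^ 2 * exp (2 * Cmod z + 1)).
  apply: Rle_trans (cexp_diff2 d) _.
  rewrite -Rmult_assoc -Rpow_mult_distr.
  apply: Rmult_le_compat; [exact: pow_le | by left; exact: exp_pos | | exact: exp_le_compat].
  by apply: pow_incr.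
have h3 : Cmod (- (h * h * (3 * z + h) * (s * s)%R)) <= Cmod h ^ 2 * (3 * Cmod z + 1).
  rewrite Cmod_opp Cmod_mult_RtoC_pos; last lra.
  rewrite !Cmod_mult; have := Cmod_triangle (3 * z) h.
  rewrite !Cmod_mult Cmod_R Rabs_pos_eq; last lra.
  move=> h3; have h4 := Cmod_ge_0 (3 * z + h).
  apply: Rle_trans (_ : Cmod h * Cmod h * Cmod (3 * z + h) <= _).
    have : 0 <= Cmod h * Cmod h * Cmod (3 * z + h) by apply: Rmult_le_pos => //; nra.
    nra.
  by have : 0 <= Cmod h * Cmod h; nra.
have zh : Cmod (z + h) <= Cmod z + 1 by have := Cmod_triangle z h; lra.
rewrite Cmod_mult /K.
rewrite Rmult_assoc; apply: Rmult_le_compat => //; try exact: Cmod_ge_0.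
apply: Rle_trans (Cmod_triangle _ _) _.
rewrite Rmult_plus_distr_r [(3 * _ + 1) * _]Rmult_comm; apply: Rplus_le_compat => //.
rewrite Cmod_mult.
have -> : (Cmod z + 1) * (2 * Cmod z + 1) ^ 2 * exp (2 * Cmod z + 1) * Cmod h ^ 2 =
  (Cmod z + 1) * (Cmod h ^ 2 * ((2 * Cmod z + 1) ^ 2 * exp (2 * Cmod z + 1))) by ring.
by apply: Rmult_le_compat => //; exact: Cmod_ge_0.
Qed.

Lemma is_derive_cerf_line (a b : C) (x : R) :
  is_derive (V := CR) (fun t : R => cerf (a * t + b)) x
    (a * cexp (- ((a * x + b) * (a * x + b))))%C.
Proof.
set z := (a * x + b)%C.
have a0 := Cmod_ge_0 a.
have d0 : 0 < / (Cmod a + 1) by apply: Rinv_0_lt_compat; lra.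
set K := exp (Cmod z ^ 2) * ((Cmod z + 1) * (2 * Cmod z + 1) ^ 2 * exp (2 * Cmod z + 1)
    + (3 * Cmod z + 1)) * Cmod a ^ 2.
apply: (is_derive_quad CR _ _ _ K _ d0) => h Hh.
have ah : Cmod (a * h) <= 1.
  rewrite Cmod_mult Cmod_R.
  have : Cmod a * Rabs h <= (Cmod a + 1) * / (Cmod a + 1).
    by apply: Rmult_le_compat; [| exact: Rabs_pos | lra | lra].
  by rewrite Rinv_r; lra.
have := cerf_quad z (a * h)%C ah.
rewrite norm_CR Cmod_mult Cmod_R Rpow_mult_distr pow2_abs -Rmult_assoc -/K.
have -> : (a * (x + h)%R + b = z + a * h)%C by rewrite /z RtoC_plus; ring.
rewrite scal_R_Cmult.
have -> // : minus (minus (cerf (z + a * h) : CR) (cerf z))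
   ((h * (a * cexp (- (z * z))))%C) = (cerf (z + a * h) - cerf z - a * h * cexp (- (z * z)))%C.
rewrite -[LHS]/(cerf (z + a * h) - cerf z - h * (a * cexp (- (z * z))))%C; Cring.
Qed.

Lemma is_RInt_cerf_line (a b : C) (u v : R) :
  is_RInt (V := CR) (fun x : R => a * cexp (- ((a * x + b) * (a * x + b))))%C u v
    (cerf (a * v + b) - cerf (a * u + b))%C.
Proof.
apply: (is_RInt_derive (V := CR) (fun x : R => cerf (a * x + b))) => x _.
  exact: is_derive_cerf_line.
apply: continuous_Cmult; first exact: continuous_const.
have := is_derive_cexp (fun t : R => - ((a * t + b) * (a * t + b)))%C x (- (2 * a * (a * x + b)))%C.
move=> H; apply: ex_derive_continuous_CR; apply: H.
  by rewrite /Re /=; auto_derive => //=; ring.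
by rewrite /Im /=; auto_derive => //=; ring.
Qed.

Lemma cerf_opp (z : C) : cerf (- z) = (- cerf z)%C.
Proof.
have H := is_RInt_opp (V := CR) _ _ _ _ (is_RInt_cerf z).
apply: (is_RInt_unique (V := CR)); apply: is_RInt_ext H => x _.
have -> : (- z * - z = z * z)%C by ring.
rewrite -[LHS]/(- (z * cexp (- (z * z) * (x * x)%R)))%C; Cring.
Qed.

Lemma cerf_0 : cerf 0 = 0.
Proof.
have H := is_RInt_const (V := CR) 0 1 (RtoC 0).
have E : scal (1 - 0) (RtoC 0 : CR) = RtoC 0 by rewrite scal_R_Cmult Cmult_0_r.
apply: (is_RInt_unique (V := CR)); rewrite E in H; apply: is_RInt_ext H => x _.
exact: (esym (Cmult_0_l _)).
Qed.

(** * The Gaussian integral on the real axis *)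

Definition gauss (x : R) : R := Re (cerf x).

Lemma is_RInt_gauss (x : R) :
  is_RInt (fun s => x * exp (- (x * x) * (s * s))) 0 1 (gauss x) /\ Im (cerf x) = 0.
Proof.
have E s : (x * cexp (- (x * x) * (s * s)%R))%C = x * exp (- (x * x) * (s * s)).
  by rewrite -!RtoC_mult -RtoC_opp -RtoC_mult cexp_RtoC RtoC_mult.
have H := is_RInt_cerf x; split.
  have H1 := is_RInt_fct_extend_fst (U := R_NormedModule) (V := R_NormedModule) _ _ _ _ H.
  by apply: is_RInt_ext H1 => s _; rewrite E.
have H2 := is_RInt_fct_extend_snd (U := R_NormedModule) (V := R_NormedModule) _ _ _ _ H.
have <- : RInt (fun=> 0) 0 1 = Im (cerf x).
  apply: is_RInt_unique; rewrite /Im; apply: is_RInt_ext H2 => s _.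
  by rewrite E.
by rewrite RInt_const /scal /= /mult /=; ring.
Qed.

Lemma cerf_RtoC (x : R) : cerf x = gauss x.
Proof. by apply: C_ext => //; rewrite im_RtoC (proj2 (is_RInt_gauss x)). Qed.

Lemma is_derive_gauss (x : R) : is_derive gauss x (exp (- (x * x))).
Proof.
have := is_derive_Re _ _ _ (is_derive_cerf_line 1 0 x).
rewrite Cmult_1_l !Cplus_0_r !Cmult_1_l -RtoC_mult -RtoC_opp cexp_RtoC re_RtoC.
by apply: is_derive_ext => t; rewrite Cplus_0_r Cmult_1_l.
Qed.

Lemma gauss_0 : gauss 0 = 0.
Proof. by rewrite /gauss cerf_0. Qed.

Lemma exp_diff2 (w : R) : Rabs (exp w - 1 - w) <= w ^ 2 * exp (Rabs w).
Proof.
by have := cexp_diff2 w; rewrite cexp_RtoC -!RtoC_minus !Cmod_R pow2_abs.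
Qed.

(** Companion of [gauss ^ 2] in the classical evaluation of the Gaussian integral: their sum has
    derivative zero and equals [PI / 4] at [0]. *)
Definition gauss_tail (x : R) : R :=
  RInt (fun s => exp (- (x * x) * (1 + s * s)) / (1 + s * s)) 0 1.

Lemma is_RInt_gauss_tail (x : R) :
  is_RInt (fun s => exp (- (x * x) * (1 + s * s)) / (1 + s * s)) 0 1 (gauss_tail x).
Proof.
apply: RInt_correct; apply: ex_RInt_continuous => s _.
by apply: ex_derive_continuous; auto_derive; nra.
Qed.

Lemma is_derive_gauss_tail (x : R) :
  is_derive gauss_tail x (- 2 * exp (- (x * x)) * gauss x).
Proof.
set K := 9 * (2 * Rabs x + 1) ^ 2 * exp (2 * (2 * Rabs x + 1)) + 2.
apply: (is_derive_quad R_NormedModule _ _ 1 K _ Rlt_0_1) => h Hh.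
have H3 : is_RInt (fun s => h * (- 2 * exp (- (x * x) * (1 + s * s)) * x)) 0 1
   (h * (- 2 * exp (- (x * x)) * gauss x)).
  have := is_RInt_scal _ _ _ (h * - 2 * exp (- (x * x))) _ (proj1 (is_RInt_gauss x)).
  rewrite /scal /= /mult /= !Rmult_assoc; apply: is_RInt_ext => s _.
  rewrite Rmult_plus_distr_l Rmult_1_r exp_plus; Rring.
have H := is_RInt_minus _ _ _ _ _ _ (is_RInt_minus _ _ _ _ _ _
  (is_RInt_gauss_tail (x + h)) (is_RInt_gauss_tail x)) H3.
have := is_RInt_bound _ 0 1 (K * h ^ 2) _ Rle_0_1 H.
rewrite Rminus_0_r Rmult_1_l; apply => s Hs.
rewrite /minus /plus /opp /=.
set c := 1 + s * s; have c1 : 1 <= c <= 2 by rewrite /c; nra.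
set d := - (2 * x * h + h * h) * c.
have -> : - ((x + h) * (x + h)) * c = - (x * x) * c + d by rewrite /d; ring.
rewrite exp_plus; set E := exp (- (x * x) * c).
have E1 : 0 < E <= 1.
  split; first exact: exp_pos.
  by rewrite -exp_0; apply: exp_le_compat; nra.
have -> : E * exp d / c + - (E / c) + - (h * (- 2 * E * x)) = E / c * (exp d - 1 - d - h * h * c).
  by rewrite /d; field; lra.
have [x0 h0] := (Rabs_pos x, Rabs_pos h).
have hh : h * h = Rabs h * Rabs h by rewrite -Rabs_mult Rabs_pos_eq //; nra.
have hd : Rabs d <= Rabs h * (2 * (2 * Rabs x + 1)).
  rewrite /d Rabs_mult Rabs_Ropp (Rabs_pos_eq c); last lra.
  have := Rabs_triang (2 * x * h) (h * h).
  rewrite !Rabs_mult (Rabs_pos_eq 2); last lra.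
  by have := Rabs_pos (2 * x * h + h * h); nra.
have hd2 : Rabs d <= 2 * (2 * Rabs x + 1) by nra.
have X := exp_diff2 d.
have Y : exp (Rabs d) <= exp (2 * (2 * Rabs x + 1)) by apply: exp_le_compat.
have Z : d ^ 2 <= h ^ 2 * (2 * (2 * Rabs x + 1)) ^ 2.
  rewrite -(pow2_abs d) -(pow2_abs h) -Rpow_mult_distr.
  by apply: pow_incr; split => //; exact: Rabs_pos.
have W : Rabs (exp d - 1 - d - h * h * c) <= K * h ^ 2.
  have := Rabs_triang (exp d - 1 - d) (- (h * h * c)).
  rewrite Rabs_Ropp (Rabs_pos_eq (h * h * c)); last by nra.
  have : d ^ 2 * exp (Rabs d) <= h ^ 2 * (2 * (2 * Rabs x + 1)) ^ 2 * exp (2 * (2 * Rabs x + 1)).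
    by apply: Rmult_le_compat => //; [nra | left; exact: exp_pos].
  move: X; rewrite /Rminus /K; set e := exp (2 * _); have e0 : 0 < e by exact: exp_pos.
  have : 0 <= h ^ 2 * (2 * Rabs x + 1) ^ 2 * e.
    apply: Rmult_le_pos; last lra; apply: Rmult_le_pos; exact: pow2_ge_0.
  have : 0 <= h * h by nra.
  set a := h ^ 2 * _ ^ 2 * _ => X hh0 A0 X1 X2.
  have -> : (9 * (2 * Rabs x + 1) ^ 2 * e + 2) * h ^ 2 = 9 * a + 2 * (h * h) by rewrite /a; ring.
  have X1' : d ^ 2 * exp (Rabs d) <= 4 * a.
    by apply: Rle_trans X1 _; right; rewrite /a; ring.
  have : h * h * c <= h * h * 2 by apply: Rmult_le_compat_l; lra.
  lra.
rewrite Rabs_mult.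
have Ec : 0 <= E / c <= 1.
  split; first by apply: Rdiv_le_0_compat; lra.
  by apply: (Rmult_le_reg_r c); [lra | rewrite /Rdiv Rmult_assoc Rinv_l; lra].
rewrite (Rabs_pos_eq (E / c)); last lra.
by have := Rabs_pos (exp d - 1 - d - h * h * c); nra.
Qed.

Lemma gauss_tail_0 : gauss_tail 0 = PI / 4.
Proof.
have H : is_RInt (fun s => / (1 + s ^ 2)) 0 1 (minus (atan 1) (atan 0)).
  apply: is_RInt_derive => x _; first by rewrite -Rsqr_pow2; exact: is_derive_atan.
  by apply: ex_derive_continuous; auto_derive; nra.
rewrite atan_1 atan_0 in H.
rewrite -[RHS]Rminus_0_r; apply: is_RInt_unique; apply: is_RInt_ext H => s _.
have -> : - (0 * 0) * (1 + s * s) = 0 by ring.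
by rewrite exp_0 /= Rmult_1_r /Rdiv Rmult_1_l.
Qed.

Lemma gauss_sqr (x : R) : gauss x ^ 2 = PI / 4 - gauss_tail x.
Proof.
pose f x := gauss x ^ 2 + gauss_tail x.
have D t : is_derive f t 0.
  have := is_derive_plus _ _ _ _ _ (is_derive_pow gauss 2 _ _ (is_derive_gauss t)) (is_derive_gauss_tail t).
  by congr is_derive; rewrite /plus /=; ring.
have : f x = f 0.
  have H : is_RInt (fun=> 0) 0 x (minus (f x) (f 0)).
    by apply: is_RInt_derive => t _ //; exact: continuous_const.
  have := is_RInt_unique _ _ _ _ H; rewrite RInt_const.
  by rewrite /minus /plus /opp /scal /= /mult /=; lra.
rewrite /f gauss_0 gauss_tail_0; lra.
Qed.

(** By [gauss_sqr], the product of [sqrt PI / 2 - gauss x] and [sqrt PI / 2 + gauss x] is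
    [gauss_tail x <= exp (- x^2)], and the second factor is at least [1 / 2]. *)
Lemma gauss_bound (x : R) : 0 <= x -> 0 <= sqrt PI / 2 - gauss x <= 2 * exp (- (x * x)).
Proof.
move=> x0; have P := PI2_1; have P4 := PI_4.
have g0 : 0 <= gauss x.
  apply: (is_RInt_ge_0 _ 0 1 _ Rle_0_1 (proj1 (is_RInt_gauss x))) => s _.
  by apply: Rmult_le_pos => //; left; exact: exp_pos.
have T0 : 0 <= gauss_tail x.
  apply: (is_RInt_ge_0 _ 0 1 _ Rle_0_1 (is_RInt_gauss_tail x)) => s _.
  by apply: Rdiv_le_0_compat; [left; exact: exp_pos | nra].
have T1 : gauss_tail x <= exp (- (x * x)).
  have := is_RInt_le _ _ 0 1 _ _ Rle_0_1 (is_RInt_gauss_tail x) (is_RInt_const _ _ (exp (- (x * x)))).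
  rewrite /scal /= /mult /= Rminus_0_r Rmult_1_l; apply => s Hs.
  apply: (Rmult_le_reg_r (1 + s * s)); first nra.
  rewrite /Rdiv Rmult_assoc Rinv_l; last nra.
  rewrite Rmult_1_r; apply: Rle_trans (_ : exp (- (x * x)) <= _).
    by apply: exp_le_compat; nra.
  by have := exp_pos (- (x * x)); nra.
have S := gauss_sqr x.
have sP : sqrt PI * sqrt PI = PI by apply: sqrt_sqrt; lra.
have s0 := sqrt_pos PI.
have s1 : 1 <= sqrt PI by nra.
by split; nra.
Qed.

Lemma exp_ge_1x (u : R) : 1 + u <= exp u.
Proof.
case: (Req_dec u 0) => [->|u0]; first by rewrite exp_0; lra.
by have := exp_ineq1 u u0; lra.
Qed.

Lemma exp_opp_le_inv (u : R) : 0 < u -> exp (- u) <= / u.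
Proof.
move=> u0; rewrite exp_Ropp; apply: Rinv_le_contravar => //.
by have := exp_ge_1x u; lra.
Qed.

(** In the sector [|arg| < PI / 4] the function [cerf] has the same limit as on the positive axis.
    The values at [zeta L + beta] and at [L] differ by the integral of [exp (- z^2)] over the
    segment between them, on which [Re z + Im z] and [Re z - Im z] both exceed a multiple of [L];
    their product is [Re (z^2)]. *)
Lemma cerf_near_gauss (zeta beta : C) : Rabs (Im zeta) < Re zeta ->
  exists A L0 : R, forall L, L0 <= L -> 0 < L /\ Cmod (cerf (zeta * L + beta) - sqrt PI / 2)%C <= A / L.
Proof.
move=> Hz.
pose mu := Rmin 1 (Re zeta - Rabs (Im zeta)).
have mu0 : 0 < mu by apply: Rmin_pos; lra.
have mu1 : mu <= 1 by exact: Rmin_l.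
have mu2 : mu <= Re zeta - Rabs (Im zeta) by exact: Rmin_r.
pose B := 2 * Cmod beta; have B0 : 0 <= B by have := Cmod_ge_0 beta; rewrite /B; lra.
pose a := Cmod (zeta - 1) + Cmod beta.
have a0 : 0 <= a by have := Cmod_ge_0 beta; have := Cmod_ge_0 (zeta - 1); rewrite /a; lra.
(* From [2 * B / mu] on, the shift by [beta] costs at most half of the margin [L * mu]. *)
exists (a * (4 / mu ^ 2) + 2), (Rmax 1 (2 * B / mu)) => L HL.
have L1 : 1 <= L by apply: Rle_trans HL; exact: Rmax_l.
have L2 : 2 * B <= L * mu.
  have : 2 * B / mu <= L by apply: Rle_trans HL; exact: Rmax_r.
  move=> h; have := Rmult_le_compat_r mu _ _ (Rlt_le _ _ mu0) h.
  by rewrite /Rdiv Rmult_assoc Rinv_l; lra.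
split; first lra.
pose d := ((zeta - 1) * L + beta)%C.
have hd : Cmod d <= a * L.
  apply: Rle_trans (Cmod_triangle _ _) _; rewrite Cmod_mult_RtoC_pos; last lra.
  by have := Cmod_ge_0 beta; rewrite /a; nra.
have H1 : Cmod (cerf (zeta * L + beta) - cerf L) <= a * (4 / mu ^ 2) / L.
  have := is_RInt_C_bound _ 0 1 (a * L * (4 / (mu ^ 2 * L ^ 2))) _ Rle_0_1 (is_RInt_cerf_line d L 0 1).
  have -> : (d * 1 + L = zeta * L + beta)%C by rewrite /d; ring.
  have -> : (d * 0 + L = L)%C by ring.
  have -> : (1 - 0) * (a * L * (4 / (mu ^ 2 * L ^ 2))) = a * (4 / mu ^ 2) / L by field; lra.
  apply => s Hs; rewrite Cmod_mult.
  apply: Rmult_le_compat; [exact: Cmod_ge_0 | exact: Cmod_ge_0 | exact: hd |].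
  rewrite Cmod_cexp.
  have -> : Re (- ((d * s + L) * (d * s + L))) =
    - ((Re (d * s + L) - Im (d * s + L)) * (Re (d * s + L) + Im (d * s + L))).
    by rewrite re_opp re_mult; ring.
  have Ere : Re (d * s + L) = L * (1 - s + s * Re zeta) + s * Re beta.
    by rewrite /d /Re /=; ring.
  have Eim : Im (d * s + L) = L * (s * Im zeta) + s * Im beta.
    by rewrite /d /Im /=; ring.
  have [r1 r2] : - Cmod beta <= Re beta /\ Rabs (Im beta) <= Cmod beta.
    have := Rmax_Cmod beta; have := Rmax_l (Rabs beta.1) (Rabs beta.2).
    have := Rmax_r (Rabs beta.1) (Rabs beta.2); rewrite /Re /Im.
    by have := Rle_abs (- beta.1); rewrite Rabs_Ropp; lra.
  have hm (e : R) : Rabs e = 1 -> L * mu / 2 <= Re (d * s + L) + e * Im (d * s + L).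
    move=> he; rewrite Ere Eim.
    have q1 : - Rabs (Im zeta) <= e * Im zeta.
      by have := Rle_abs (- (e * Im zeta)); rewrite Rabs_Ropp Rabs_mult he; lra.
    have q2 : - Rabs (Im beta) <= e * Im beta.
      by have := Rle_abs (- (e * Im beta)); rewrite Rabs_Ropp Rabs_mult he; lra.
    have q3 : mu <= 1 - s + s * (Re zeta + e * Im zeta).
      have : s * mu <= s * (Re zeta + e * Im zeta) by apply: Rmult_le_compat_l; lra.
      nra.
    have q4 : - B <= s * (Re beta + e * Im beta).
      rewrite /B in B0 L2 *; nra.
    have q5 : L * mu <= L * (1 - s + s * (Re zeta + e * Im zeta)) by apply: Rmult_le_compat_l; lra.
    nra.
  have h1 := hm 1 Rabs_R1; have h2 := hm (-1) (eq_trans (Rabs_Ropp 1) Rabs_R1).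
  have h3 : (L * mu / 2) * (L * mu / 2) <= (Re (d * s + L) - Im (d * s + L)) * (Re (d * s + L) + Im (d * s + L)).
    by apply: Rmult_le_compat; nra.
  have Lm : 0 < L * mu / 2 by have := Rmult_lt_0_compat _ _ (Rlt_le_trans _ _ _ Rlt_0_1 L1) mu0; lra.
  have h4 : 0 < (L * mu / 2) * (L * mu / 2) by exact: Rmult_lt_0_compat.
  apply: Rle_trans (_ : exp (- ((L * mu / 2) * (L * mu / 2))) <= _); first by apply: exp_le_compat; lra.
  apply: Rle_trans (exp_opp_le_inv _ h4) _; right; field; lra.
have H2 : Cmod (cerf L - sqrt PI / 2)%C <= 2 / L.
  rewrite cerf_RtoC -RtoC_div; last by discrR.
  rewrite -RtoC_minus Cmod_R Rabs_minus_sym.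
  have L0 : 0 <= L by lra.
  have [g1 g2] := gauss_bound L L0; rewrite Rabs_pos_eq //.
  apply: Rle_trans g2 _; apply: Rmult_le_compat_l; first lra.
  apply: Rle_trans (_ : exp (- L) <= _); first by apply: exp_le_compat; nra.
  by apply: exp_opp_le_inv; lra.
have -> : (cerf (zeta * L + beta) - sqrt PI / 2 = (cerf (zeta * L + beta) - cerf L) + (cerf L - sqrt PI / 2))%C by ring.
apply: Rle_trans (Cmod_triangle _ _) _.
by rewrite /Rdiv Rmult_plus_distr_r; apply: Rplus_le_compat.
Qed.

(** * Theta function near the real axis *)

(** The shift [1 / 6] completes the square in [k (3 k - 1) / 2]: at integers [k] and with [nu = 1]
    this is, up to a constant factor, [(-1)^k q^(k (3 k - 1) / 2)] for [q = nome zeta]. The odd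
    values of [nu] are the frequencies of the dual sum. *)
Definition gpol (zeta : C) (nu x : R) : C :=
  cexp (- ((zeta * (x - 1 / 6)%R) * (zeta * (x - 1 / 6)%R)) + Ci * (PI * nu * x)%R)%C.

(** The integral of [gpol zeta nu] over the whole real line. *)
Definition gft (zeta : C) (nu : R) : C :=
  (sqrt PI / zeta * cexp (Ci * (PI * nu / 6)%R - (PI ^ 2 * nu ^ 2 / 4)%R / (zeta * zeta)))%C.

Lemma is_RInt_gpol (zeta : C) (nu u v : R) : zeta <> 0 ->
  let b := (- zeta * (1 / 6)%R - Ci * (PI * nu / 2)%R / zeta)%C in
  is_RInt (V := CR) (gpol zeta nu) u v
   (cexp (Ci * (PI * nu / 6)%R - (PI ^ 2 * nu ^ 2 / 4)%R / (zeta * zeta)) / zeta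
    * (cerf (zeta * v + b) - cerf (zeta * u + b)))%C.
Proof.
move=> z0 b.
have := is_RInt_Cmult_l _ _ _ (cexp (Ci * (PI * nu / 6)%R - (PI ^ 2 * nu ^ 2 / 4)%R / (zeta * zeta)) / zeta)%C _ (is_RInt_cerf_line zeta b u v).
apply: is_RInt_ext => x _.
rewrite /gpol.
set k := (Ci * (PI * nu / 6)%R - (PI ^ 2 * nu ^ 2 / 4)%R / (zeta * zeta))%C.
have -> : (cexp k / zeta * (zeta * cexp (- ((zeta * x + b) * (zeta * x + b)))) =
   cexp k * cexp (- ((zeta * x + b) * (zeta * x + b))))%C by field.
rewrite -cexp_add; congr cexp; rewrite /k /b.
have Ci2 : (Ci * Ci = - 1)%C by apply: C_ext => /=; ring.
have two : RtoC 2 <> 0 by move=> /RtoC_inj; lra.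
have E1 : RtoC (PI * nu / 2)%R = (RtoC PI * RtoC nu / 2)%C.
  by rewrite RtoC_div; [rewrite (RtoC_mult PI nu) | nz].
have E2 : RtoC (PI * nu / 6)%R = (RtoC PI * RtoC nu / 6)%C.
  by rewrite RtoC_div; [rewrite (RtoC_mult PI nu) | nz].
have E3 : RtoC (PI ^ 2 * nu ^ 2 / 4)%R = (RtoC PI * RtoC PI * (RtoC nu * RtoC nu) / 4)%C.
  rewrite RtoC_div; last nz.
  by rewrite (RtoC_mult (PI ^ 2)) /= !Rmult_1_r (RtoC_mult PI PI) (RtoC_mult nu nu).
have E4 : RtoC (1 / 6)%R = (1 / 6)%C by rewrite RtoC_div //; nz.
have n6 : RtoC 6 <> 0 by move=> /RtoC_inj; lra.
have n4 : RtoC 4 <> 0 by move=> /RtoC_inj; lra.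
rewrite E1 E2 E3 RtoC_minus !E4 (RtoC_mult (PI * nu)) (RtoC_mult PI nu).
have -> : (Ci * (PI * nu / 6) - PI * PI * (nu * nu) / 4 / (zeta * zeta) =
  Ci * (PI * nu / 6) + Ci * Ci * (PI * PI * (nu * nu) / 4 / (zeta * zeta)))%C.
  by rewrite Ci2; ring.
by field.
Qed.

Lemma is_RInt_gpol_lim (zeta : C) (nu : R) : Rabs (Im zeta) < Re zeta ->
  exists A K0 : R, forall K I, K0 <= K ->
    is_RInt (V := CR) (gpol zeta nu) (- K - 1 / 2) (K + 1 / 2) I ->
    0 < K /\ Cmod (I - gft zeta nu)%C <= A / K.
Proof.
move=> Hz.
have z0 : zeta <> 0.
  by move=> E; move: Hz; rewrite E /= Rabs_R0; lra.
have zp : 0 < Cmod zeta by apply/Cmod_gt_0.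
set b := (- zeta * (1 / 6)%R - Ci * (PI * nu / 2)%R / zeta)%C.
set k := (Ci * (PI * nu / 6)%R - (PI ^ 2 * nu ^ 2 / 4)%R / (zeta * zeta))%C.
have [A1 [L1 H1]] := cerf_near_gauss zeta b Hz.
have [A2 [L2 H2]] := cerf_near_gauss zeta (- b) Hz.
exists (Cmod (cexp k / zeta) * (A1 + A2)), (Rmax 1 (Rmax L1 L2)) => K I HK HI.
have K1 : 1 <= K by apply: Rle_trans HK; exact: Rmax_l.
have K2 : L1 <= K by apply: Rle_trans HK; apply: Rle_trans (Rmax_r _ _); exact: Rmax_l.
have K3 : L2 <= K by apply: Rle_trans HK; apply: Rle_trans (Rmax_r _ _); exact: Rmax_r.
split; first lra.
have h1 : L1 <= K + 1 / 2 by lra.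
have h2 : L2 <= K + 1 / 2 by lra.
have [_ G1] := H1 _ h1; have [_ G2] := H2 _ h2.
have -> : I = (cexp k / zeta * (cerf (zeta * (K + 1 / 2)%R + b) - cerf (zeta * (- K - 1 / 2)%R + b)))%C.
  rewrite -(is_RInt_unique (V := CR) _ _ _ _ HI).
  by apply: (is_RInt_unique (V := CR)); exact: is_RInt_gpol.
(* Oddness of [cerf] moves the lower end point into the sector of [cerf_near_gauss], with [- b] in
   place of [b]. *)
have -> : (zeta * (- K - 1 / 2)%R + b = - (zeta * (K + 1 / 2)%R + - b))%C.
  have -> : - K - 1 / 2 = - (K + 1 / 2) by ring.
  by rewrite RtoC_opp; ring.
rewrite cerf_opp.
have two : RtoC 2 <> 0 by move=> /RtoC_inj; lra.
have -> : (cexp k / zeta * (cerf (zeta * (K + 1 / 2)%R + b) - - cerf (zeta * (K + 1 / 2)%R + - b))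
  - gft zeta nu = cexp k / zeta * ((cerf (zeta * (K + 1 / 2)%R + b) - sqrt PI / 2) +
      (cerf (zeta * (K + 1 / 2)%R + - b) - sqrt PI / 2)))%C.
  by rewrite /gft -/k; field.
rewrite Cmod_mult /Rdiv Rmult_assoc; apply: Rmult_le_compat_l; first exact: Cmod_ge_0.
apply: Rle_trans (Cmod_triangle _ _) _.
have q A (A0 : 0 <= A / (K + 1 / 2)) : A / (K + 1 / 2) <= A / K.
  have A0' : 0 <= A.
    have := Rmult_le_pos _ (K + 1 / 2) A0; rewrite /Rdiv Rmult_assoc Rinv_l; lra.
  by apply: Rmult_le_compat_l => //; apply: Rinv_le_contravar; lra.
rewrite Rmult_plus_distr_r; apply: Rplus_le_compat.
  by apply: (Rle_trans _ _ _ G1 (q _ _)); apply: (Rle_trans _ _ _ _ G1); exact: Cmod_ge_0.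
by apply: (Rle_trans _ _ _ G2 (q _ _)); apply: (Rle_trans _ _ _ _ G2); exact: Cmod_ge_0.
Qed.

(** * Finite complex sums and the Fejer kernel *)

Fixpoint csum (n : nat) (f : nat -> C) : C :=
  match n with O => RtoC 0 | S k => (csum k f + f k)%C end.

Lemma csum_ext n f g : (forall i, (i < n)%N -> f i = g i) -> csum n f = csum n g.
Proof.
elim: n => //= n IHn H; rewrite H // IHn // => i Hi; apply: H; lia.
Qed.

Lemma csum_mult_l c n f : csum n (fun i => c * f i)%C = (c * csum n f)%C.
Proof. by elim: n => [|n /= ->] /=; ring. Qed.

Lemma csum_mult_r c n f : csum n (fun i => f i * c)%C = (csum n f * c)%C.
Proof. by elim: n => [|n /= ->] /=; ring. Qed.

Lemma csum_plus n f g : csum n (fun i => f i + g i)%C = (csum n f + csum n g)%C.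
Proof. by elim: n => [|n /= ->] /=; ring. Qed.

Lemma csum_conj n f : Cconj (csum n f) = csum n (fun i => Cconj (f i)).
Proof.
elim: n => [|n /= <-] /=; last exact: Cplus_conj.
by apply: C_ext => /=; ring.
Qed.

Lemma csum_cat n m f : csum (n + m) f = (csum n f + csum m (fun i => f (n + i)%N))%C.
Proof.
elim: m => [|m IHm]; first by rewrite addn0 Cplus_0_r.
by rewrite addnS /= IHm; ring.
Qed.

Lemma csum_recl n f : csum n.+1 f = (f O + csum n (fun i => f i.+1))%C.
Proof. by rewrite -add1n csum_cat /= Cplus_0_l; congr (_ + _)%C; apply: csum_ext => i _; rewrite add1n. Qed.

Lemma Cmod_csum n f (b : R) : (forall i, (i < n)%N -> Cmod (f i) <= b) -> Cmod (csum n f) <= INR n * b.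
Proof.
elim: n => [|n IHn] H; first by rewrite /= Cmod_0; lra.
rewrite S_INR /=; apply: Rle_trans (Cmod_triangle _ _) _.
have := H n (ltnSn n); have := IHn (fun i Hi => H i (ltnW Hi)); lra.
Qed.

Lemma is_RInt_csum n (f : nat -> R -> C) (l : nat -> C) a b :
  (forall i, (i < n)%N -> is_RInt (V := CR) (f i) a b (l i)) ->
  is_RInt (V := CR) (fun x => csum n (fun i => f i x)) a b (csum n l).
Proof.
elim: n => [|n IHn] H /=.
  have := is_RInt_const (V := CR) a b (RtoC 0).
  by rewrite scal_R_Cmult Cmult_0_r.
have H1 := IHn (fun i Hi => H i (ltnW Hi)).
exact: (is_RInt_plus (V := CR) _ _ _ _ _ _ H1 (H n (ltnSn n))).
Qed.

Definition fexp (d x : R) : C := cexp (Ci * (2 * PI * d * x)%R).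

Lemma fexp_add d1 d2 x : (fexp d1 x * fexp d2 x)%C = fexp (d1 + d2) x.
Proof.
by rewrite /fexp -cexp_add -Cmult_plus_distr_l -RtoC_plus; congr (cexp (_ * RtoC _)); ring.
Qed.

Lemma fexp_addx d x1 x2 : (fexp d x1 * fexp d x2)%C = fexp d (x1 + x2).
Proof.
by rewrite /fexp -cexp_add -Cmult_plus_distr_l -RtoC_plus; congr (cexp (_ * RtoC _)); ring.
Qed.

Lemma Cmod_fexp d x : Cmod (fexp d x) = 1.
Proof. by rewrite Cmod_cexp -exp_0; congr exp; rewrite /Re /=; ring. Qed.

Lemma fexp_0 x : fexp 0 x = 1.
Proof. by rewrite /fexp Rmult_0_r Rmult_0_l Cmult_0_r cexp_0. Qed.

Lemma fexp_conj d x : Cconj (fexp d x) = fexp (- d) x.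
Proof.
rewrite /fexp /cexp.
have -> : Re (Ci * (2 * PI * d * x)%R) = 0 by rewrite /Re /=; ring.
have -> : Re (Ci * (2 * PI * - d * x)%R) = 0 by rewrite /Re /=; ring.
have -> : Im (Ci * (2 * PI * - d * x)%R) = - (2 * PI * d * x) by rewrite /Im /=; ring.
have -> : Im (Ci * (2 * PI * d * x)%R) = 2 * PI * d * x by rewrite /Im /=; ring.
by rewrite cos_neg sin_neg; apply: C_ext => /=; ring.
Qed.

Lemma cexp_2PI : cexp (Ci * (2 * PI)%R) = 1.
Proof.
rewrite /cexp.
have -> : Re (Ci * (2 * PI)%R) = 0 by rewrite /Re /=; ring.
have -> : Im (Ci * (2 * PI)%R) = 2 * PI by rewrite /Im /=; ring.
by rewrite exp_0 cos_2PI sin_2PI; apply: C_ext => /=; ring.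
Qed.

Definition is_int (d : R) := exists n : nat, d = INR n \/ d = - INR n.

Lemma fexp_int d k : is_int d -> is_int k -> fexp d k = 1.
Proof.
have pos n m : fexp (INR n) (INR m) = 1.
  rewrite /fexp.
  have -> : (Ci * (2 * PI * INR n * INR m)%R = INR (n * m)%N * (Ci * (2 * PI)%R))%C.
    by rewrite mult_INR !RtoC_mult; ring.
  by rewrite cexp_pow cexp_2PI Cpow_1_l.
have neg n m : fexp (- INR n) (INR m) = 1.
  by rewrite -fexp_conj pos; apply: C_ext => /=; ring.
have sw a b : fexp a (- b) = fexp (- a) b by rewrite /fexp; congr (cexp (_ * RtoC _)); ring.
by move=> [n [->|->]] [m [->|->]]; rewrite ?sw ?Ropp_involutive.
Qed.

Lemma is_int_sub n m : is_int (INR n - INR m).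
Proof.
case: (leqP m n) => h.
  by exists (n - m)%N; left; rewrite minus_INR //; apply/leP.
exists (m - n)%N; right; rewrite minus_INR; [ring | apply/leP; lia].
Qed.

Lemma is_RInt_fexp d : is_int d -> d <> 0 -> is_RInt (V := CR) (fexp d) (- (1 / 2)) (1 / 2) (RtoC 0).
Proof.
move=> dint d0.
pose c := (Ci * (2 * PI * d)%R)%C.
have c0 : c <> 0.
  have P := PI_RGT_0.
  move=> /(f_equal Im); rewrite /c /Im /= => E.
  have : 2 * PI * d <> 0 by apply: Rmult_integral_contrapositive_currified => //; nz.
  by apply; lra.
have H : is_RInt (V := CR) (fun x : R => c * fexp d x)%C (- (1 / 2)) (1 / 2) (RtoC 0).
  have -> : RtoC 0 = minus (fexp d (1 / 2) : CR) (fexp d (- (1 / 2)) : CR).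
    have -> : fexp d (1 / 2) = fexp d (- (1 / 2)).
      have E : - (1 / 2) + 1 = 1 / 2 by field.
      by rewrite -{1}E -fexp_addx (fexp_int d 1) ?Cmult_1_r //; exists 1%N; left.
    by rewrite minus_eq_zero.
  have E (x : R) : cexp (c * x + 0)%C = fexp d x.
    rewrite /fexp Cplus_0_r /c; congr cexp; rewrite [in RHS]RtoC_mult; ring.
  apply: (is_RInt_derive (V := CR)) => x _.
    rewrite -E; apply: (is_derive_ext (V := CR)); last exact: is_derive_cexp_line.
    by move=> t /=; rewrite E.
  apply: continuous_Cmult; first exact: continuous_const.
  apply: (continuous_ext (U := CR) (fun x : R => cexp (c * x + 0)%C)) => //.
  exact: (ex_derive_continuous_CR _ _ _ (is_derive_cexp_line c 0 x)).
have := is_RInt_Cmult_l _ _ _ (/ c)%C _ H; rewrite Cmult_0_r.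
by apply: is_RInt_ext => x _; rewrite Cmult_assoc Cinv_l // Cmult_1_l.
Qed.

Definition fejer (J : nat) (x : R) : R :=
  Cmod (csum J (fun j => fexp (INR j) x)) ^ 2 / INR J.

Lemma fejer_ge0 J x : 0 <= fejer J x.
Proof.
case: J => [|J]; first by rewrite /fejer /= Cmod_0; lra.
by apply: Rdiv_le_0_compat; [exact: pow2_ge_0 | apply: lt_0_INR; lia].
Qed.

Lemma fejer_expand J x : (0 < J)%N ->
  RtoC (fejer J x) = (/ INR J * csum J (fun j => csum J (fun i => fexp (INR j - INR i) x)))%C.
Proof.
move=> J0; have J0' : INR J <> 0 by apply: not_0_INR; lia.
rewrite /fejer RtoC_div // Cmod2_conj csum_conj /Cdiv Cmult_comm; congr (_ * _)%C.
rewrite -csum_mult_r; apply: csum_ext => j _; rewrite -csum_mult_l; apply: csum_ext => i _.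
by rewrite fexp_conj fexp_add.
Qed.

Lemma csum_delta J j : (j < J)%N ->
  csum J (fun i => if i == j then RtoC 1 else RtoC 0) = 1.
Proof.
have Z n : (n <= j)%N -> csum n (fun i => if i == j then RtoC 1 else RtoC 0) = 0.
  elim: n => //= n IHn h; rewrite IHn; last lia.
  by rewrite (_ : n == j = false); [rewrite Cplus_0_r | lia].
elim: J => // J IHJ h /=.
case: (ltnP j J) => h'.
  rewrite IHJ // (_ : J == j = false); [by rewrite Cplus_0_r | lia].
rewrite Z // (_ : J == j); [by rewrite Cplus_0_l | lia].
Qed.

Lemma csum_const n (c : C) : csum n (fun => c) = (INR n * c)%C.
Proof.
elim: n => [|n IHn]; first by rewrite /= Cmult_0_l.
by rewrite S_INR /= IHn RtoC_plus; ring.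
Qed.

Lemma is_RInt_fejer J : (0 < J)%N -> is_RInt (fejer J) (- (1 / 2)) (1 / 2) 1.
Proof.
move=> J0; have J0' : INR J <> 0 by apply: not_0_INR; lia.
have H : is_RInt (V := CR) (fun x => / INR J * csum J (fun j => csum J (fun i => fexp (INR j - INR i) x)))%C
  (- (1 / 2)) (1 / 2) (/ INR J * csum J (fun j => csum J (fun i => if i == j then RtoC 1 else RtoC 0)))%C.
  apply: is_RInt_Cmult_l; apply: is_RInt_csum => j Hj; apply: is_RInt_csum => i Hi.
  case: eqP => [->|ij].
    rewrite Rminus_diag.
    have := is_RInt_const (V := CR) (- (1 / 2)) (1 / 2) (RtoC 1).
    have E : scal (1 / 2 - - (1 / 2)) (RtoC 1 : CR) = RtoC 1.
      by rewrite scal_R_Cmult Cmult_1_r; congr RtoC; field.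
    rewrite E; apply: is_RInt_ext => x _; by rewrite fexp_0.
  apply: is_RInt_fexp; first exact: is_int_sub.
  move=> E; apply: ij; apply: INR_eq; lra.
have E : (/ INR J * csum J (fun j => csum J (fun i => if i == j then RtoC 1 else RtoC 0)))%C = RtoC 1.
  rewrite (csum_ext _ _ (fun => RtoC 1)); last by move=> j; exact: csum_delta.
  by rewrite csum_const Cmult_1_r Cinv_l // => /RtoC_inj.
rewrite E in H.
have := is_RInt_fct_extend_fst (U := R_NormedModule) (V := R_NormedModule) _ _ _ _ H.
by apply: is_RInt_ext => x _; rewrite -fejer_expand.
Qed.

(** The Taylor polynomial of degree 7 is a lower bound. The range has to include [PI / 2], the
    largest value of [PI |x|] on half a period. *)
Lemma sin_ge_third a : 0 <= a -> a <= 2 -> a <= PI -> a / 3 <= sin a.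
Proof.
move=> a0 a2 aP; have [H _] := SIN a a0 aP.
apply: Rle_trans H.
rewrite /sin_lb /sin_approx /sin_term /=.
have a4 : a * a <= 4 by nra.
have a5 : 0 <= a * a * a * a * a by repeat apply: Rmult_le_pos => //.
have h : (a * a * a * a * a) * (a * a) <= (a * a * a * a * a) * 4 by apply: Rmult_le_compat_l.
have h3 : a * (a * a) <= a * 4 by apply: Rmult_le_compat_l.
field_simplify.
have -> : a ^ 7 = a * a * a * a * a * (a * a) by ring.
have -> : a ^ 5 = a * a * a * a * a by ring.
have -> : a ^ 3 = a * (a * a) by ring.
lra.
Qed.

Lemma Cmod_1_fexp_ge x : Rabs x <= 1 / 2 -> 2 * Rabs x <= Cmod (1 - fexp 1 x).
Proof.
move=> Hx.
have P3 := PI2_3_2; have P4 := PI_4; have Px := Rabs_pos x.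
have E : Cmod (1 - fexp 1 x) ^ 2 = (2 * sin (PI * Rabs x)) ^ 2.
  rewrite Cmod2_alt /fexp /cexp.
  have -> : Re (Ci * (2 * PI * 1 * x)%R) = 0 by rewrite /Re /=; ring.
  have -> : Im (Ci * (2 * PI * 1 * x)%R) = 2 * (PI * x) by rewrite /Im /=; ring.
  rewrite exp_0 /Re /Im /=.
  have S2 : sin (PI * Rabs x) * sin (PI * Rabs x) = sin (PI * x) * sin (PI * x).
    rewrite /Rabs; case: Rcase_abs => _ //.
    by rewrite -Ropp_mult_distr_r sin_neg; ring.
  have -> : 2 * sin (PI * Rabs x) * (2 * sin (PI * Rabs x) * 1) = 4 * (sin (PI * x) * sin (PI * x)).
    by rewrite -S2; ring.
  rewrite cos_2a sin_2a; have := sin2_cos2 (PI * x); rewrite /Rsqr.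
  set s := sin _; set c := cos _ => E.
  have Ec : c * c = 1 - s * s by lra.
  ring_simplify; rewrite !(_ : forall u, u ^ 2 = u * u) ?Ec; try (move=> u; ring).
  have -> : c ^ 4 = (c * c) * (c * c) by ring.
  have -> : s ^ 4 = (s * s) * (s * s) by ring.
  by rewrite Ec; ring.
have S : PI * Rabs x / 3 <= sin (PI * Rabs x) by apply: sin_ge_third; nra.
apply: Rsqr_incr_0_var; last exact: Cmod_ge_0.
rewrite !Rsqr_pow2 E; apply: pow_incr; nra.
Qed.

(** Multiplied by [1 - fexp 1 x], the geometric sum telescopes to a difference of two numbers of
    modulus [1], so its own modulus is at most [1 / |x|]. *)
Lemma fejer_sqr_bound J x : (0 < J)%N -> Rabs x <= 1 / 2 -> x ^ 2 * fejer J x <= 1 / INR J.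
Proof.
move=> J0 Hx; have J0' : 0 < INR J by apply: lt_0_INR; lia.
have H := Cmod_1_fexp_ge x Hx.
have T : (csum J (fun j => fexp (INR j) x) * (1 - fexp 1 x) = 1 - fexp (INR J) x)%C.
  elim: J {J0 J0'} => [|J IH]; first by rewrite /= fexp_0; ring.
  rewrite S_INR -fexp_add /= Cmult_plus_distr_r IH; ring.
have B : Cmod (csum J (fun j => fexp (INR j) x)) * (2 * Rabs x) <= 2.
  apply: Rle_trans (_ : Cmod (csum J (fun j => fexp (INR j) x)) * Cmod (1 - fexp 1 x) <= _).
    by apply: Rmult_le_compat_l => //; exact: Cmod_ge_0.
  rewrite -Cmod_mult T; apply: Rle_trans (Cmod_triangle _ _) _.
  by rewrite Cmod_opp Cmod_fexp Cmod_1; lra.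
rewrite /fejer; set D := Cmod _ in B *; have D0 : 0 <= D by exact: Cmod_ge_0.
rewrite /Rdiv -Rmult_assoc; apply: Rmult_le_compat_r; first by left; apply: Rinv_0_lt_compat.
rewrite -(pow2_abs x) -Rpow_mult_distr -(pow1 2); have x0 := Rabs_pos x.
by apply: pow_incr; split; [exact: Rmult_le_pos | lra].
Qed.

(** With [J = m^2] the kernel [F] satisfies [|x| F <= F / m + 1 / m] pointwise: the first term
    suffices when [|x| <= 1 / m], and beyond that [x^2 F <= 1 / m^2] gives the second. Over a period
    this integrates to [2 / m]. *)
Lemma fejer_lip (m : nat) (f : R -> C) (L : R) (I : C) : (0 < m)%N -> 0 <= L ->
  (forall x, Rabs x <= 1 / 2 -> Cmod (f x) <= L * Rabs x) ->
  is_RInt (V := CR) (fun x => f x * fejer (m * m) x)%C (- (1 / 2)) (1 / 2) I ->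
  Cmod I <= L * (2 / INR m).
Proof.
move=> m0 L0 Hf HI.
have m0' : 0 < INR m by apply: lt_0_INR; lia.
have mm : (0 < m * m)%N by rewrite muln_gt0 m0.
have H := is_RInt_scal _ _ _ L _ (is_RInt_plus _ _ _ _ _ _
   (is_RInt_scal _ _ _ (1 / INR m) _ (is_RInt_fejer (m * m) mm))
   (is_RInt_const (- (1 / 2)) (1 / 2) (1 / INR m))).
have ab : - (1 / 2) <= 1 / 2 by lra.
have := norm_RInt_le (V := CR) _ _ _ _ _ _ ab _ HI H.
have -> : scal L (plus (scal (1 / INR m) 1) (scal (1 / 2 - - (1 / 2)) (1 / INR m))) = L * (2 / INR m).
  by rewrite /scal /plus /= /mult /=; Rfield; nz.
rewrite norm_CR; apply => x Hx.
have {}Hx : Rabs x <= 1 / 2 by apply: Rabs_le; lra.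
rewrite norm_CR Cmod_mult Cmod_R Rabs_pos_eq; last exact: fejer_ge0.
have -> : scal L (plus (scal (1 / INR m) (fejer (m * m) x)) (1 / INR m)) =
   L * (1 / INR m * fejer (m * m) x + 1 / INR m) by [].
have F0 := fejer_ge0 (m * m) x.
apply: Rle_trans (_ : L * Rabs x * fejer (m * m) x <= _).
  by apply: Rmult_le_compat_r => //; exact: Hf.
rewrite Rmult_assoc; apply: Rmult_le_compat_l => //.
have im : 0 < 1 / INR m by apply: Rdiv_lt_0_compat; lra.
case: (Rle_dec (Rabs x) (1 / INR m)) => h.
  by have := Rmult_le_compat_r _ _ _ F0 h; lra.
have {}h : 1 / INR m < Rabs x by lra.
have B := fejer_sqr_bound _ x mm Hx; rewrite mult_INR in B.
have B' : Rabs x * fejer (m * m) x <= 1 / INR m.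
  rewrite -(pow2_abs x) in B.
  have h2 : 1 < Rabs x * INR m.
    by have := Rmult_lt_compat_r _ _ _ m0' h; rewrite /Rdiv Rmult_assoc Rinv_l; lra.
  have B2 : Rabs x ^ 2 * fejer (m * m) x * (INR m * INR m) <= 1.
    have := Rmult_le_compat_r (INR m * INR m) _ _ ltac:(nra) B.
    by rewrite /Rdiv Rmult_1_l Rinv_l; [ | nra].
  apply: (Rmult_le_reg_r (INR m)) => //.
  rewrite /Rdiv Rmult_1_l Rinv_l; last lra.
  have := Rabs_pos x => x0.
  have : 0 <= Rabs x * fejer (m * m) x * INR m by repeat apply: Rmult_le_pos => //; lra.
  nra.
have : 0 <= 1 / INR m * fejer (m * m) x by apply: Rmult_le_pos; lra.
by move: B' im; set u := 1 / INR m * _; set v := 1 / INR m; set w := Rabs x * _; lra.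
Qed.

(** * Poisson summation for complex Gaussians *)

Fixpoint zsum (f : R -> C) (K : nat) : C :=
  match K with O => f 0 | S k => (zsum f k + (f (INR (S k)) + f (- INR (S k))%R))%C end.

Lemma zsum_minus f g K : zsum (fun k => f k - g k)%C K = (zsum f K - zsum g K)%C.
Proof. by elim: K => [|K IHK] //; rewrite [LHS]/= IHK [RHS]/=; ring. Qed.

Lemma zsum_mult_l c f K : zsum (fun k => c * f k)%C K = (c * zsum f K)%C.
Proof. by elim: K => [|K IHK] //; rewrite [LHS]/= IHK [RHS]/=; ring. Qed.

Lemma zsum_csum n (f : nat -> R -> C) K :
  zsum (fun k => csum n (fun i => f i k)) K = csum n (fun i => zsum (f i) K).
Proof.
elim: n => [|n IHn] /=.
  by elim: K => //= K ->; ring.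
rewrite -IHn; elim: K {IHn} => //= K ->; ring.
Qed.

Lemma zsum_telescope (W : R -> C) K :
  zsum (fun k => W (k + 1 / 2)%R - W (k - 1 / 2)%R)%C K = (W (INR K + 1 / 2)%R - W (- INR K - 1 / 2)%R)%C.
Proof.
elim: K => [|K IHK]; first by rewrite /= Ropp_0.
rewrite [LHS]/= IHK -/(INR K.+1) S_INR.
have -> : INR K + 1 - 1 / 2 = INR K + 1 / 2 by field.
have -> : - (INR K + 1) + 1 / 2 = - INR K - 1 / 2 by field.
ring.
Qed.

Lemma Cmod_zsum f K A r : 0 <= A -> 0 <= r < 1 ->
  (forall n : nat, Cmod (f (INR n)) <= A * r ^ n /\ Cmod (f (- INR n)) <= A * r ^ n) ->
  Cmod (zsum f K) <= 2 * A / (1 - r).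
Proof.
move=> A0 r01 H.
have r0 n : 0 <= r ^ n by apply: pow_le; lra.
apply: Rle_trans (_ : 2 * A * (1 - r ^ K.+1) / (1 - r) <= _); last first.
  apply: Rmult_le_compat_r; first by left; apply: Rinv_0_lt_compat; lra.
  by have := r0 K.+1; nra.
elim: K => [|K IHK].
  have [h _] := H O; move: h; rewrite /= !Rmult_1_r => h; apply: Rle_trans h _.
  by rewrite /Rdiv Rmult_assoc Rinv_r; lra.
have [h1 h2] := H K.+1.
rewrite [zsum _ _]/=.
apply: Rle_trans (Cmod_triangle _ _) _.
apply: Rle_trans (_ : 2 * A * (1 - r ^ K.+1) / (1 - r) + 2 * A * r ^ K.+1 <= _).
  apply: Rplus_le_compat => //; apply: Rle_trans (Cmod_triangle _ _) _.
  by move: h1 h2; rewrite /=; lra.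
right; rewrite /=; field; lra.
Qed.

Definition gprim (zeta : C) (nu x : R) : C :=
  (cexp (Ci * (PI * nu / 6)%R - (PI ^ 2 * nu ^ 2 / 4)%R / (zeta * zeta)) / zeta
   * cerf (zeta * x + (- zeta * (1 / 6)%R - Ci * (PI * nu / 2)%R / zeta)))%C.

Lemma is_RInt_gprim (zeta : C) nu u v : zeta <> 0 ->
  is_RInt (V := CR) (gpol zeta nu) u v (gprim zeta nu v - gprim zeta nu u)%C.
Proof.
move=> z0; have := is_RInt_gpol zeta nu u v z0; rewrite /= /gprim.
set a := (_ / zeta)%C; set b := (_ - _ / zeta)%C.
by rewrite (_ : a * (_ - _) = a * cerf (zeta * v + b) - a * cerf (zeta * u + b))%C //; ring.
Qed.

Lemma is_RInt_gprim_shift (zeta : C) nu k : zeta <> 0 ->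
  is_RInt (V := CR) (fun x => gpol zeta nu (k + x)) (- (1 / 2)) (1 / 2)
    (gprim zeta nu (k + 1 / 2)%R - gprim zeta nu (k - 1 / 2)%R)%C.
Proof.
move=> z0; have := is_RInt_gprim zeta nu (k - 1 / 2) (k + 1 / 2) z0 => H.
have H' : is_RInt (V := CR) (gpol zeta nu) (1 * - (1 / 2) + k) (1 * (1 / 2) + k)
  (gprim zeta nu (k + 1 / 2)%R - gprim zeta nu (k - 1 / 2)%R)%C.
  have -> : 1 * - (1 / 2) + k = k - 1 / 2 by field.
  by have -> : 1 * (1 / 2) + k = k + 1 / 2 by field.
have := is_RInt_comp_lin (V := CR) _ _ _ _ _ _ H'.
apply: is_RInt_ext => x _.
rewrite scal_one; congr gpol; ring.
Qed.

Lemma gpol_fexp (zeta : C) nu d x : (gpol zeta nu x * fexp d x)%C = gpol zeta (nu + 2 * d) x.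
Proof.
rewrite /gpol /fexp -cexp_add; congr cexp.
have -> : PI * (nu + 2 * d) * x = PI * nu * x + 2 * PI * d * x by ring.
by rewrite RtoC_plus; ring.
Qed.

(** The integral of [gpol zeta 1 (k + x)] against the Fejer kernel over one period, written through
    boundary values so that its sum over [k] telescopes. *)
Definition gavg (zeta : C) (J : nat) (k : R) : C :=
  (/ INR J * csum J (fun j => csum J (fun i =>
     gprim zeta (1 + 2 * (INR j - INR i))%R (k + 1 / 2)%R -
     gprim zeta (1 + 2 * (INR j - INR i))%R (k - 1 / 2)%R)))%C.

(** The exponentials of the kernel have integer frequencies and do not see the shift by the integer
    [k], so each of them merely moves [nu = 1] to another odd frequency. *)
Lemma is_RInt_gavg (zeta : C) J k : zeta <> 0 -> (0 < J)%N -> is_int k ->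
  is_RInt (V := CR) (fun x => (gpol zeta 1 (k + x)%R - gpol zeta 1 k) * fejer J x)%C
   (- (1 / 2)) (1 / 2) (gavg zeta J k - gpol zeta 1 k)%C.
Proof.
move=> z0 J0 kint.
have H1 : is_RInt (V := CR) (fun x => / INR J * csum J (fun j => csum J (fun i =>
     gpol zeta (1 + 2 * (INR j - INR i))%R (k + x)%R)))%C (- (1 / 2)) (1 / 2) (gavg zeta J k).
  apply: is_RInt_Cmult_l; apply: is_RInt_csum => j _; apply: is_RInt_csum => i _.
  exact: is_RInt_gprim_shift.
have H2 : is_RInt (V := CR) (fun x => gpol zeta 1 k * fejer J x)%C (- (1 / 2)) (1 / 2) (gpol zeta 1 k * 1)%C.
  apply: is_RInt_Cmult_l.
  apply: (is_RInt_fct_extend_pair (U := R_NormedModule) (V := R_NormedModule)); first exact: is_RInt_fejer.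
  have := is_RInt_const (- (1 / 2)) (1 / 2) 0.
  by rewrite /scal /= /mult /= Rmult_0_r.
have := is_RInt_minus (V := CR) _ _ _ _ _ _ H1 H2.
rewrite Cmult_1_r.
apply: is_RInt_ext => x _.
rewrite /minus /plus /opp /=.
set S := csum _ _.
have -> : (/ INR J * S)%C = (gpol zeta 1 (k + x)%R * fejer J x)%C.
  rewrite fejer_expand // Cmult_assoc [(_ * / _)%C]Cmult_comm -Cmult_assoc; congr (_ * _)%C.
  rewrite -csum_mult_l; apply: csum_ext => j _; rewrite -csum_mult_l; apply: csum_ext => i _.
  have -> : fexp (INR j - INR i) x = fexp (INR j - INR i) (k + x).
    by rewrite -fexp_addx (fexp_int _ k (is_int_sub _ _) kint) Cmult_1_l.
  by rewrite gpol_fexp.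
rewrite -[LHS]/(gpol zeta 1 (k + x)%R * fejer J x - gpol zeta 1 k * fejer J x)%C; ring.
Qed.

Lemma Cmod_gpol (zeta : C) nu x :
  Cmod (gpol zeta nu x) = exp (- (Re (zeta * zeta) * (x - 1 / 6) ^ 2)).
Proof. by rewrite Cmod_cexp; congr exp; rewrite /Re /=; field. Qed.

Lemma is_derive_gpol (zeta : C) nu x :
  is_derive (V := CR) (gpol zeta nu) x
   ((- (2 * (zeta * zeta) * (x - 1 / 6)%R) + Ci * (PI * nu)%R) * gpol zeta nu x)%C.
Proof.
have := is_derive_cexp (fun x : R => - ((zeta * (x - 1 / 6)%R) * (zeta * (x - 1 / 6)%R)) + Ci * (PI * nu * x)%R)%C x
  (- (2 * (zeta * zeta) * (x - 1 / 6)%R) + Ci * (PI * nu)%R)%C.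
apply.
  by rewrite /Re /=; auto_derive => //=; ring.
by rewrite /Im /=; auto_derive => //=; ring.
Qed.

(** The derivative is a linear factor in [u = y - 1 / 6] times a Gaussian. Half of the Gaussian
    exponent absorbs the linear factor, and [u^2 >= n - 1] turns the other half into a geometric
    sequence. Summability over [k] makes the Fejer error uniform in the cutoff of the sum. *)
Lemma gpol_lip (zeta : C) : Rabs (Im zeta) < Re zeta ->
  exists A r : R, 0 <= A /\ 0 <= r < 1 /\
   forall (n : nat) (k x : R), (k = INR n \/ k = - INR n) -> Rabs x <= 1 / 2 ->
     Cmod (gpol zeta 1 (k + x) - gpol zeta 1 k) <= A * r ^ n * Rabs x.
Proof.
move=> Hz.
pose b := Re (zeta * zeta).
have b0 : 0 < b.
  rewrite /b re_mult; have i0 := Rabs_pos (Im zeta).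
  have -> : Im zeta * Im zeta = Rabs (Im zeta) * Rabs (Im zeta) by rewrite -Rabs_mult Rabs_pos_eq //; nra.
  by nra.
have P0 := PI_RGT_0; have z0 := Cmod_ge_0 zeta.
have ib : 0 < 2 / b by apply: Rdiv_lt_0_compat; lra.
pose c0 := 2 * Cmod zeta ^ 2 * (1 + 2 / b) + PI.
have c00 : 0 <= c0.
  have : 0 <= 2 * Cmod zeta ^ 2 * (1 + 2 / b).
    by apply: Rmult_le_pos; [have := pow2_ge_0 (Cmod zeta); lra | lra].
  by rewrite /c0; lra.
exists (c0 * exp (b / 2)), (exp (- (b / 2))).
have eb := exp_pos (b / 2).
split; first by apply: Rmult_le_pos; lra.
split.
  split; first by left; exact: exp_pos.
  by rewrite -exp_0; apply: exp_increasing; lra.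
move=> n k x Hk Hx.
pose dg y := ((- (2 * (zeta * zeta) * (y - 1 / 6)%R) + Ci * (PI * 1)%R) * gpol zeta 1 y)%C.
have bound y : Rabs (y - k) <= 1 / 2 -> Cmod (dg y) <= c0 * exp (b / 2) * exp (- (b / 2)) ^ n.
  move=> Hy; rewrite /dg Cmod_mult Cmod_gpol -/b.
  set u := y - 1 / 6.
  have Hu : INR n - 1 <= u ^ 2.
    have n0 := pos_INR n.
    have : INR n - 2 / 3 <= Rabs u.
      have := Rabs_triang_inv k (k - u).
      have -> : k - (k - u) = u by ring.
      have -> : Rabs k = INR n by case: Hk => ->; rewrite ?Rabs_Ropp Rabs_pos_eq.
      have : Rabs (k - u) <= 2 / 3.
        have -> : k - u = - (y - k) + 1 / 6 by rewrite /u; ring.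
        have := Rabs_triang (- (y - k)) (1 / 6).
        by rewrite Rabs_Ropp (Rabs_pos_eq (1 / 6)); lra.
      lra.
    by have := pow2_abs u => <-; have := pow2_ge_0 (Rabs u - 1 / 2); lra.
  have h1 : Cmod (- (2 * (zeta * zeta) * u) + Ci * (PI * 1)%R) <= c0 * (1 + b / 2 * u ^ 2).
    apply: Rle_trans (Cmod_triangle _ _) _.
    rewrite Cmod_opp !Cmod_mult Cmod_Ci !Cmod_R (Rabs_pos_eq 2); last lra.
    rewrite (Rabs_pos_eq (PI * 1)); last lra.
    have hu : Rabs u <= (1 + 2 / b) * (1 + b / 2 * u ^ 2).
      have -> : (1 + 2 / b) * (1 + b / 2 * u ^ 2) = 1 + u ^ 2 + (2 / b + b / 2 * u ^ 2) by field; lra.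
      have : 0 <= b / 2 * u ^ 2 by apply: Rmult_le_pos; [lra | exact: pow2_ge_0].
      by have := pow2_abs u => <-; have := pow2_ge_0 (Rabs u - 1 / 2); lra.
    have hq : 0 <= b / 2 * u ^ 2 by apply: Rmult_le_pos; [lra | exact: pow2_ge_0].
    have : 2 * Cmod zeta ^ 2 * Rabs u <= 2 * Cmod zeta ^ 2 * ((1 + 2 / b) * (1 + b / 2 * u ^ 2)).
      by apply: Rmult_le_compat_l => //; have := pow2_ge_0 (Cmod zeta); lra.
    have : PI * 1 <= PI * (1 + b / 2 * u ^ 2) by apply: Rmult_le_compat_l; lra.
    rewrite /c0 => ? ?.
    have -> : (2 * Cmod zeta ^ 2 * (1 + 2 / b) + PI) * (1 + b / 2 * u ^ 2) =
      2 * Cmod zeta ^ 2 * ((1 + 2 / b) * (1 + b / 2 * u ^ 2)) + PI * (1 + b / 2 * u ^ 2) by ring.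
    have -> : 2 * (Cmod zeta * Cmod zeta) * Rabs u = 2 * Cmod zeta ^ 2 * Rabs u by ring.
    lra.
  have h2 : (1 + b / 2 * u ^ 2) * exp (- (b * u ^ 2)) <= exp (- (b / 2 * u ^ 2)).
    have -> : - (b * u ^ 2) = - (b / 2 * u ^ 2) + - (b / 2 * u ^ 2) by field.
    rewrite exp_plus -Rmult_assoc -{3}[exp _]Rmult_1_l.
    apply: Rmult_le_compat_r; first by left; exact: exp_pos.
    have := exp_ge_1x (b / 2 * u ^ 2) => h.
    have := Rmult_le_compat_r (exp (- (b / 2 * u ^ 2))) _ _ (Rlt_le _ _ (exp_pos _)) h.
    by rewrite -exp_plus Rplus_opp_r exp_0.
  have h3 : exp (- (b / 2 * u ^ 2)) <= exp (b / 2) * exp (- (b / 2)) ^ n.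
    have -> : exp (- (b / 2)) ^ n = exp (INR n * - (b / 2)).
      elim: {Hu Hk} n => [|n IHn]; first by rewrite /= Rmult_0_l exp_0.
      by rewrite S_INR /= IHn -exp_plus; congr exp; ring.
    by rewrite -exp_plus; apply: exp_le_compat; nra.
  apply: Rle_trans (_ : c0 * (1 + b / 2 * u ^ 2) * exp (- (b * u ^ 2)) <= _).
    by apply: Rmult_le_compat_r => //; left; exact: exp_pos.
  rewrite !Rmult_assoc; apply: Rmult_le_compat_l => //; lra.
have D s : is_derive (V := CR) (fun s : R => gpol zeta 1 (k + s * x)) s (x * dg (k + s * x)%R)%C.
  have h : is_derive (fun s : R => k + s * x) s x by auto_derive => //; ring.
  have := is_derive_comp (V := CR) (gpol zeta 1) (fun s : R => k + s * x) s _ _ (is_derive_gpol zeta 1 _) h.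
  by rewrite scal_R_Cmult.
have HI : is_RInt (V := CR) (fun s => x * dg (k + s * x)%R)%C 0 1 (gpol zeta 1 (k + x)%R - gpol zeta 1 k)%C.
  have := is_RInt_derive (V := CR) (fun s : R => gpol zeta 1 (k + s * x)) (fun s => x * dg (k + s * x)%R)%C 0 1
    (fun s _ => D s).
  rewrite Rmult_0_l Rplus_0_r Rmult_1_l; apply => s _.
  apply: continuous_Cmult; first exact: continuous_const.
  apply: continuous_Cmult; last exact: (ex_derive_continuous_CR _ _ _ (D s)).
  apply: (ex_derive_continuous_CR _ _ (- (2 * (zeta * zeta) * x))%C).
  by apply: is_derive_C; rewrite /Re /Im /=; auto_derive => //=; ring.
have := is_RInt_C_bound _ 0 1 (c0 * exp (b / 2) * exp (- (b / 2)) ^ n * Rabs x) _ Rle_0_1 HI.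
rewrite Rminus_0_r Rmult_1_l; apply => s Hs.
rewrite Cmod_mult Cmod_R Rmult_comm; apply: Rmult_le_compat_r; first exact: Rabs_pos.
apply: bound; have -> : k + s * x - k = s * x by ring.
by rewrite Rabs_mult Rabs_pos_eq; have := Rabs_pos x; nra.
Qed.

Lemma gpol_avg_bound (zeta : C) : Rabs (Im zeta) < Re zeta ->
  exists A : R, forall m K : nat, (0 < m)%N ->
    Cmod (zsum (gavg zeta (m * m)) K - zsum (gpol zeta 1) K) <= A / INR m.
Proof.
move=> Hz; have z0 : zeta <> 0 by move=> E; move: Hz; rewrite E /= Rabs_R0; lra.
have [A [r [A0 [r01 H]]]] := gpol_lip zeta Hz.
exists (2 * (A * 2) / (1 - r)) => m K m0.
have m0' : 0 < INR m by apply: lt_0_INR; lia.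
rewrite -zsum_minus.
have -> : 2 * (A * 2) / (1 - r) / INR m = 2 * (A * (2 / INR m)) / (1 - r) by field; lra.
have im : 0 < 2 / INR m by apply: Rdiv_lt_0_compat; lra.
have rn n : 0 <= r ^ n by apply: pow_le; lra.
apply: Cmod_zsum => // [|n].
  by apply: Rmult_le_pos; lra.
have main k : (k = INR n \/ k = - INR n) ->
    Cmod (gavg zeta (m * m) k - gpol zeta 1 k) <= A * (2 / INR m) * r ^ n.
  move=> Hk.
  have -> : A * (2 / INR m) * r ^ n = A * r ^ n * (2 / INR m) by ring.
  have kint : is_int k by exists n.
  have mm : (0 < m * m)%N by rewrite muln_gt0 m0.
  apply: fejer_lip m0 _ _ (is_RInt_gavg zeta (m * m) k z0 mm kint).
    exact: Rmult_le_pos.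
  by move=> x Hx; exact: H.
by split; apply: main; [left | right].
Qed.

Lemma zsum_gavg (zeta : C) J K :
  zsum (gavg zeta J) K =
  (/ INR J * csum J (fun j => csum J (fun i =>
     gprim zeta (1 + 2 * (INR j - INR i))%R (INR K + 1 / 2)%R -
     gprim zeta (1 + 2 * (INR j - INR i))%R (- INR K - 1 / 2)%R)))%C.
Proof.
rewrite /gavg (zsum_mult_l _ (fun k => csum J _)) (zsum_csum J (fun j k => csum J _)).
congr (_ * _)%C; apply: csum_ext => j _.
rewrite (zsum_csum J (fun i k => (gprim zeta _ (k + 1 / 2)%R - _)%C)); apply: csum_ext => i _.
exact: zsum_telescope.
Qed.

Lemma eventually_finite (n : nat) (P : nat -> nat -> Prop) :
  (forall i, (i < n)%N -> exists K0, forall K, (K0 <= K)%N -> P i K) ->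
  exists K0, forall i K, (i < n)%N -> (K0 <= K)%N -> P i K.
Proof.
elim: n => [|n IHn] H; first by exists O => i K; rewrite ltn0.
have [K1 H1] := IHn (fun i Hi => H i (ltnW Hi)).
have [K2 H2] := H n (ltnSn n).
exists (maxn K1 K2) => i K Hi; rewrite geq_max => /andP[k1 k2].
case: (ltnP i n) => h; first exact: H1.
have -> : i = n by lia.
exact: H2.
Qed.

Lemma gprim_lim (zeta : C) nu eps : Rabs (Im zeta) < Re zeta -> 0 < eps ->
  exists K0, forall K, (K0 <= K)%N ->
   Cmod (gprim zeta nu (INR K + 1 / 2) - gprim zeta nu (- INR K - 1 / 2) - gft zeta nu) <= eps.
Proof.
move=> Hz e0; have z0 : zeta <> 0 by move=> E; move: Hz; rewrite E /= Rabs_R0; lra.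
have [A [K0 H]] := is_RInt_gpol_lim zeta nu Hz.
have [n1 h1] := INR_unbounded K0.
have [n2 h2] := INR_unbounded (A / eps).
exists (maxn n1 n2) => K; rewrite geq_max => /andP[k1 k2].
have i1 : INR n1 <= INR K by apply: le_INR; lia.
have i2 : INR n2 <= INR K by apply: le_INR; lia.
have l1 : K0 <= INR K by lra.
have [K1 B] := H _ _ l1 (is_RInt_gprim zeta nu (- INR K - 1 / 2) (INR K + 1 / 2) z0).
apply: Rle_trans B _.
apply: (Rmult_le_reg_r (INR K)) => //.
rewrite /Rdiv Rmult_assoc Rinv_l; last lra.
have l2 : A / eps <= INR K by lra.
have := Rmult_le_compat_r eps _ _ (Rlt_le _ _ e0) l2.
by rewrite /Rdiv Rmult_assoc Rinv_l; lra.
Qed.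

(** * The two leading terms of the dual sum *)

Definition theta_main (zeta : C) : C := (gft zeta 1 + gft zeta (-1)%R)%C.

(** The size of the frequencies [3] and [- 3] relative to [1] and [- 1]: the exponents differ by
    [PI^2 (9 - 1) / 4 = 2 PI^2] times [Re (1 / zeta^2)]. *)
Definition theta_rho (zeta : C) : R := exp (- (2 * PI ^ 2 * Re (/ (zeta * zeta)))).

Lemma Cmod_gft (zeta : C) nu : zeta <> 0 ->
  Cmod (gft zeta nu) = Cmod (sqrt PI / zeta) * exp (- (PI ^ 2 * nu ^ 2 / 4 * Re (/ (zeta * zeta)))).
Proof.
move=> z0; rewrite /gft Cmod_mult Cmod_cexp; congr (_ * exp _).
rewrite /Cdiv re_plus re_opp re_scal_l /Re /=; ring.
Qed.

Lemma Re_inv_sqr_gt0 (zeta : C) : Rabs (Im zeta) < Re zeta -> 0 < Re (/ (zeta * zeta)).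
Proof.
move=> Hz; have i0 := Rabs_pos (Im zeta).
have b0 : 0 < Re (zeta * zeta).
  rewrite re_mult.
  have -> : Im zeta * Im zeta = Rabs (Im zeta) * Rabs (Im zeta) by rewrite -Rabs_mult Rabs_pos_eq //; nra.
  by nra.
move: b0; set w := (zeta * zeta)%C; case: w => a b /=; rewrite /Re /= => a0.
by apply: Rdiv_lt_0_compat => //; have := pow2_ge_0 b; rewrite /=; nra.
Qed.

Lemma theta_rho_lt1 (zeta : C) : Rabs (Im zeta) < Re zeta -> 0 <= theta_rho zeta < 1.
Proof.
move=> Hz; split; first by left; exact: exp_pos.
rewrite -exp_0; apply: exp_increasing.
have := Re_inv_sqr_gt0 zeta Hz; have := PI_RGT_0 => P R0.
have : 0 < PI ^ 2 * Re (/ (zeta * zeta)) by apply: Rmult_lt_0_compat => //; exact: pow_lt.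
lra.
Qed.

Lemma exp_mul_nat (x : R) n : exp x ^ n = exp (INR n * x).
Proof.
elim: n => [|n IHn]; first by rewrite /= Rmult_0_l exp_0.
by rewrite S_INR /= IHn -exp_plus; congr exp; ring.
Qed.

(** By [(2 n + 1)^2 - 1 = 4 n (n + 1) >= 8 n], the Gaussian decay is at least geometric of ratio
    [theta_rho]. *)
Lemma gft_decay (zeta : C) (n : nat) : Rabs (Im zeta) < Re zeta ->
  Cmod (gft zeta (1 + 2 * INR n)) <= Cmod (gft zeta 1) * theta_rho zeta ^ n /\
  Cmod (gft zeta (- 1 - 2 * INR n)) <= Cmod (gft zeta 1) * theta_rho zeta ^ n.
Proof.
move=> Hz; have z0 : zeta <> 0 by move=> E; move: Hz; rewrite E /= Rabs_R0; lra.
have R0 := Re_inv_sqr_gt0 zeta Hz; have P0 := PI_RGT_0.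
rewrite !Cmod_gft // (_ : (- 1 - 2 * INR n) ^ 2 = (1 + 2 * INR n) ^ 2); last ring.
have h : Cmod (sqrt PI / zeta) * exp (- (PI ^ 2 * (1 + 2 * INR n) ^ 2 / 4 * Re (/ (zeta * zeta)))) <=
  Cmod (sqrt PI / zeta) * exp (- (PI ^ 2 * 1 ^ 2 / 4 * Re (/ (zeta * zeta)))) * theta_rho zeta ^ n.
  rewrite Rmult_assoc; apply: Rmult_le_compat_l; first exact: Cmod_ge_0.
  rewrite exp_mul_nat -exp_plus; apply: exp_le_compat.
  have -> : PI ^ 2 * (1 + 2 * INR n) ^ 2 / 4 * Re (/ (zeta * zeta)) =
    PI ^ 2 * 1 ^ 2 / 4 * Re (/ (zeta * zeta)) + PI ^ 2 * Re (/ (zeta * zeta)) * (INR n * (INR n + 1)) by field.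
  have h : 2 * INR n <= INR n * (INR n + 1).
    case: n => [|n]; first by rewrite /=; lra.
    by rewrite S_INR; have := pos_INR n; nra.
  have : 0 < PI ^ 2 * Re (/ (zeta * zeta)) by apply: Rmult_lt_0_compat => //; exact: pow_lt.
  by nra.
by [].
Qed.

Lemma Cmod_csum_geo n (f : nat -> C) (A r : R) : 0 <= A -> 0 <= r < 1 ->
  (forall i, (i < n)%N -> Cmod (f i) <= A * r ^ i.+1) -> Cmod (csum n f) <= A * r / (1 - r).
Proof.
move=> A0 r01 H.
have rn m : 0 <= r ^ m by apply: pow_le; lra.
apply: Rle_trans (_ : A * (r - r ^ n.+1) / (1 - r) <= _); last first.
  apply: Rmult_le_compat_r; first by left; apply: Rinv_0_lt_compat; lra.
  by have := rn n.+1; nra.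
elim: n H => [|n IHn] H.
  by rewrite /= Cmod_0 Rmult_1_r Rminus_diag Rmult_0_r /Rdiv Rmult_0_l; lra.
apply: Rle_trans (Cmod_triangle _ _) _.
apply: Rle_trans (_ : A * (r - r ^ n.+1) / (1 - r) + A * r ^ n.+1 <= _).
  by apply: Rplus_le_compat; [apply: IHn => i Hi; apply: H; lia | exact: H].
by right; rewrite /=; field; lra.
Qed.

Lemma Cmod_csum_geo_rev j n (f : nat -> C) (A r : R) : 0 <= A -> 0 <= r < 1 -> (n <= j)%N ->
  (forall i, (i < n)%N -> Cmod (f i) <= A * r ^ (j - i)) ->
  Cmod (csum n f) <= A * r ^ (j - n) * r / (1 - r).
Proof.
move=> A0 r01.
have rn m : 0 <= r ^ m by apply: pow_le; lra.
elim: n => [|n IHn] nj H.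
  rewrite /= Cmod_0; apply: Rdiv_le_0_compat; last lra.
  by repeat apply: Rmult_le_pos => //; lra.
apply: Rle_trans (Cmod_triangle _ _) _.
have h1 := IHn (ltnW nj) (fun i Hi => H i (ltnW Hi)).
have h2 := H n (ltnSn n).
have E : (j - n = (j - n.+1).+1)%N by lia.
rewrite E /= in h1 h2.
apply: Rle_trans (Rplus_le_compat _ _ _ _ h1 h2) _.
by right; field; lra.
Qed.

(** In row [j], [i = j] gives the frequency [1], [i = j + 1] gives [- 1], and the other [i] form two
    geometric tails. The last row has no [i = j + 1]; the extra term pays for this, and after
    averaging over the rows it only costs [|gft zeta 1| / J]. *)
Lemma gft_row (zeta : C) J j : Rabs (Im zeta) < Re zeta -> (j < J)%N ->
  Cmod (csum J (fun i => gft zeta (1 + 2 * (INR j - INR i))) - theta_main zeta) <=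
  2 * (Cmod (gft zeta 1) * theta_rho zeta / (1 - theta_rho zeta))
  + (if j.+1 == J then Cmod (gft zeta 1) else 0).
Proof.
move=> Hz jJ; set r := theta_rho zeta; set A := Cmod (gft zeta 1).
have r01 : 0 <= r < 1 := theta_rho_lt1 zeta Hz.
have A0 : 0 <= A := Cmod_ge_0 _.
have D n := gft_decay zeta n Hz.
have -> : J = (j + (J - j.+1).+1)%N by lia.
rewrite csum_cat csum_recl addn0 Rminus_diag Rmult_0_r Rplus_0_r.
set S1 := csum j _; set S2 := csum _ _.
have B1 : Cmod S1 <= A * r / (1 - r).
  have := Cmod_csum_geo_rev j j (fun i => gft zeta (1 + 2 * (INR j - INR i))) A r A0 r01 (leqnn j).
  rewrite subnn /= Rmult_1_r; apply => i Hi.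
  rewrite -minus_INR; last by apply/leP; lia.
  by case: (D (j - i)%N).
have E2 : S2 = csum (J - j.+1) (fun i => gft zeta (- 1 - 2 * INR i)).
  apply: csum_ext => i _; congr gft.
  by rewrite plus_INR S_INR; ring.
have gm : Cmod (gft zeta (-1)) <= A.
  by have [_] := D O; rewrite /= Rmult_0_r Rminus_0_r Rmult_1_r.
case: eqP => [E|NE].
  have E3 : S2 = 0 by rewrite E2 (_ : J - j.+1 = 0)%N //; lia.
  rewrite E3.
  have -> : (S1 + (gft zeta 1 + 0) - theta_main zeta = S1 + - gft zeta (-1))%C by rewrite /theta_main; ring.
  apply: Rle_trans (Cmod_triangle _ _) _; rewrite Cmod_opp.
  by have := Cmod_ge_0 S1; lra.
have E3 : S2 = (gft zeta (-1)%R + csum (J - j.+2) (fun i => gft zeta (- 1 - 2 * INR i.+1)%R))%C.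
  rewrite E2 (_ : J - j.+1 = (J - j.+2).+1)%N; last by lia.
  by rewrite csum_recl /= Rmult_0_r Rminus_0_r.
rewrite E3; set S3 := csum _ _.
have B3 : Cmod S3 <= A * r / (1 - r).
  by apply: Cmod_csum_geo => // i _; case: (D i.+1).
have -> : (S1 + (gft zeta 1 + (gft zeta (-1)%R + S3)) - theta_main zeta = S1 + S3)%C by rewrite /theta_main; ring.
by apply: Rle_trans (Cmod_triangle _ _) _; lra.
Qed.

Lemma gft_avg (zeta : C) J : Rabs (Im zeta) < Re zeta -> (0 < J)%N ->
  Cmod (/ INR J * csum J (fun j => csum J (fun i => gft zeta (1 + 2 * (INR j - INR i))%R)) - theta_main zeta)%C <=
  2 * (Cmod (gft zeta 1) * theta_rho zeta / (1 - theta_rho zeta)) + Cmod (gft zeta 1) / INR J.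
Proof.
move=> Hz J0; have J0' : 0 < INR J by apply: lt_0_INR; lia.
have Jn : RtoC (INR J) <> 0 by move/RtoC_inj; lra.
set B := 2 * _; set A := Cmod (gft zeta 1).
have -> : (/ INR J * csum J (fun j => csum J (fun i => gft zeta (1 + 2 * (INR j - INR i))%R)) - theta_main zeta
  = / INR J * csum J (fun j => csum J (fun i => gft zeta (1 + 2 * (INR j - INR i))%R) + - theta_main zeta))%C.
  by rewrite csum_plus csum_const; field.
rewrite Cmod_mult -RtoC_inv; last by lra.
rewrite Cmod_R Rabs_pos_eq; last by left; apply: Rinv_0_lt_compat.
apply: (Rmult_le_reg_l (INR J)) => //.
rewrite -Rmult_assoc Rinv_r ?Rmult_1_l; last lra.
have -> : INR J * (B + A / INR J) = INR J * B + A by field; lra.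
case: J J0 J0' Jn => // n _ _ _ /=.
rewrite -/(INR n.+1) S_INR.
have R j := gft_row zeta n.+1 j Hz.
apply: Rle_trans (Cmod_triangle _ _) _.
have -> : (INR n + 1) * B + A = INR n * B + (B + A) by ring.
apply: Rplus_le_compat.
  apply: Cmod_csum => i Hi; have := R i (ltnW Hi).
  by rewrite (_ : i.+1 == n.+1 = false) ?Rplus_0_r //; lia.
by have := R n (ltnSn n); rewrite eqxx.
Qed.

(** [J = m^2] is fixed before the cutoff [K], so only [J^2] Fourier integrals have to converge. One
    third of [eps] goes to replacing the sum by its Fejer average, one third to replacing the
    truncated integrals by [gft], and one third to the incomplete last row. *)
Theorem theta_approx (zeta : C) eps : Rabs (Im zeta) < Re zeta -> 0 < eps ->
  exists K0, forall K, (K0 <= K)%N ->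
   Cmod (zsum (gpol zeta 1) K - theta_main zeta) <=
   2 * (Cmod (gft zeta 1) * theta_rho zeta / (1 - theta_rho zeta)) + eps.
Proof.
move=> Hz e0.
have [A HA] := gpol_avg_bound zeta Hz.
set m0 := Cmod (gft zeta 1); have m00 : 0 <= m0 := Cmod_ge_0 _.
have [m' hm'] := INR_unbounded (Rmax (3 * A / eps) (3 * m0 / eps)).
pose m := m'.+1.
have hm : INR m' < INR m by apply: lt_INR; lia.
have m_gt0 : (0 < m)%N by [].
have m_gt0' : 0 < INR m by apply: lt_0_INR; lia.
have m1 : 1 <= INR m by rewrite /m S_INR; have := pos_INR m'; lra.
have a1 : A / INR m <= eps / 3.
  have h : 3 * A / eps <= INR m by have := Rmax_l (3 * A / eps) (3 * m0 / eps); lra.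
  have := Rmult_le_compat_r (eps / 3) _ _ ltac:(lra) h.
  have -> : 3 * A / eps * (eps / 3) = A by field; lra.
  move=> h2; apply: (Rmult_le_reg_r (INR m)) => //.
  by rewrite /Rdiv Rmult_assoc Rinv_l; lra.
have a2 : m0 / INR (m * m) <= eps / 3.
  have h : 3 * m0 / eps <= INR m by have := Rmax_r (3 * A / eps) (3 * m0 / eps); lra.
  have := Rmult_le_compat_r (eps / 3) _ _ ltac:(lra) h.
  have -> : 3 * m0 / eps * (eps / 3) = m0 by field; lra.
  move=> h2; rewrite mult_INR; apply: (Rmult_le_reg_r (INR m * INR m)); first nra.
  by rewrite /Rdiv Rmult_assoc Rinv_l; nra.
pose J := (m * m)%N; have J0 : (0 < J)%N by rewrite muln_gt0.
have J0' : 0 < INR J by apply: lt_0_INR; lia.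
have [K0 HK] : exists K0, forall j K, (j < J)%N -> (K0 <= K)%N -> forall i, (i < J)%N ->
  Cmod (gprim zeta (1 + 2 * (INR j - INR i)) (INR K + 1 / 2) - gprim zeta (1 + 2 * (INR j - INR i)) (- INR K - 1 / 2) - gft zeta (1 + 2 * (INR j - INR i))) <= eps / 3 / INR J.
  apply: eventually_finite => j _.
  have [K0 H] : exists K0, forall i K, (i < J)%N -> (K0 <= K)%N ->
    Cmod (gprim zeta (1 + 2 * (INR j - INR i)) (INR K + 1 / 2) - gprim zeta (1 + 2 * (INR j - INR i)) (- INR K - 1 / 2) - gft zeta (1 + 2 * (INR j - INR i))) <= eps / 3 / INR J.
    by apply: eventually_finite => i _; apply: gprim_lim => //; apply: Rdiv_lt_0_compat; lra.
  by exists K0 => K hK i Hi; exact: H.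
exists K0 => K hK.
have b1 := HA m K m_gt0; have b2 := gft_avg zeta J Hz J0.
rewrite zsum_gavg -/J in b1.
set Z := zsum _ _ in b1 *.
set U := (/ INR J * csum J _)%C in b1; set V := (/ INR J * csum J _)%C in b2.
have b3 : Cmod (U - V) <= eps / 3.
  have -> : (U - V = / INR J * csum J (fun j => csum J (fun i =>
     (gprim zeta (1 + 2 * (INR j - INR i))%R (INR K + 1 / 2)%R - gprim zeta (1 + 2 * (INR j - INR i))%R (- INR K - 1 / 2)%R)
    + (- 1) * gft zeta (1 + 2 * (INR j - INR i))%R)))%C.
    have -> : (U - V = / INR J * (csum J (fun j => csum J (fun i =>
     gprim zeta (1 + 2 * (INR j - INR i))%R (INR K + 1 / 2)%R - gprim zeta (1 + 2 * (INR j - INR i))%R (- INR K - 1 / 2)%R))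
     + (- 1) * csum J (fun j => csum J (fun i => gft zeta (1 + 2 * (INR j - INR i))%R))))%C by rewrite /U /V; ring.
    congr (_ * _)%C; rewrite -csum_mult_l -csum_plus; apply: csum_ext => j _.
    by rewrite -csum_mult_l -csum_plus.
  rewrite Cmod_mult -RtoC_inv; last by lra.
  rewrite Cmod_R Rabs_pos_eq; last by left; apply: Rinv_0_lt_compat.
  apply: (Rmult_le_reg_l (INR J)) => //.
  rewrite -Rmult_assoc Rinv_r ?Rmult_1_l; last lra.
  apply: Cmod_csum => j Hj.
  have -> : eps / 3 = INR J * (eps / 3 / INR J) by field; lra.
  apply: Cmod_csum => i Hi; have := HK j K Hj hK i Hi.
  by congr (Cmod _ <= _); ring.
have -> : (Z - theta_main zeta = - (U - Z) + (U - V) + (V - theta_main zeta))%C by ring.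
apply: Rle_trans (Cmod_triangle3 _ _ _) _; rewrite Cmod_opp.
by move: b2; rewrite -/m0 -/J in a2 *; lra.
Qed.

(** * Generating function and the pentagonal number theorem *)

(** The Pochhammer symbol [(q^(k+1); q)_n]. The offset [k] is there for the terms of Shanks'
    identity. *)
Fixpoint qprod (q : C) (k n : nat) : C :=
  match n with O => RtoC 1 | S i => (qprod q k i * (1 - q ^ (k + i).+1))%C end.

Lemma qprodS q k i : qprod q k i.+1 = (qprod q k i * (1 - q ^ (k + i).+1))%C.
Proof. by []. Qed.

Lemma csumS n f : csum n.+1 f = (csum n f + f n)%C.
Proof. by []. Qed.

Lemma csum_geo_le r n : 0 <= r < 1 -> Re (csum n (fun i => RtoC (r ^ i))) <= / (1 - r).
Proof.
move=> r01.
have E : Re (csum n (fun i => RtoC (r ^ i))) * (1 - r) = 1 - r ^ n.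
  elim: n => [|n IHn]; first by rewrite /= Rmult_0_l Rminus_diag.
  by rewrite csumS re_plus Rmult_plus_distr_r IHn /=; ring.
have rn : 0 <= r ^ n by apply: pow_le; lra.
apply: (Rmult_le_reg_r (1 - r)); first lra.
by rewrite E Rinv_l; lra.
Qed.

Lemma pow_le1 r n : 0 <= r <= 1 -> r ^ n <= 1.
Proof.
by move=> [r0 r1]; rewrite -(pow1 n); apply: pow_incr.
Qed.

Lemma pow_antitone r (m n : nat) : 0 <= r <= 1 -> (m <= n)%N -> r ^ n <= r ^ m.
Proof.
move=> r01 mn; rewrite -(subnK mn) addnC -plusE pow_add -{2}[r ^ m]Rmult_1_r.
apply: Rmult_le_compat_l; first by apply: pow_le; lra.
exact: pow_le1.
Qed.

Lemma Cmod_qprod_le q r k n : Cmod q <= r -> r < 1 -> Cmod (qprod q k n) <= exp (/ (1 - r)).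
Proof.
move=> qr r1; have q0 := Cmod_ge_0 q.
apply: Rle_trans (_ : exp (Re (csum n (fun i => RtoC (r ^ i)))) <= _); last first.
  by apply: exp_le_compat; apply: csum_geo_le; lra.
elim: n => [|n IHn]; first by rewrite /= Cmod_1 exp_0; lra.
rewrite qprodS csumS re_plus exp_plus Cmod_mult.
apply: Rmult_le_compat; [exact: Cmod_ge_0 | exact: Cmod_ge_0 | exact: IHn |].
apply: Rle_trans (exp_ge_1x _); rewrite re_RtoC.
apply: Rle_trans (Cmod_triangle _ _) _; rewrite Cmod_1 Cmod_opp Cmod_pow.
apply: Rplus_le_compat_l; apply: Rle_trans (_ : r ^ (k + n).+1 <= _).
  by apply: pow_incr.
by apply: pow_antitone; [lra | lia].
Qed.

(** For [x <= r], [1 / (1 - x) = 1 + x / (1 - x) <= exp (x / (1 - r))] bounds each factor below, and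
    the exponents form a geometric sum. *)
Lemma qprod_real r k n : 0 <= r < 1 ->
  exists c : R, qprod r k n = RtoC c /\ exp (- / (1 - r) ^ 2) <= c.
Proof.
move=> r01.
have [c [E H]] : exists c : R, qprod r k n = RtoC c /\
   exp (- (Re (csum n (fun i => RtoC (r ^ i))) / (1 - r))) <= c.
  elim: n => [|n [c [E H]]].
    by exists 1; split=> //; rewrite /= /Rdiv Rmult_0_l Ropp_0 exp_0; lra.
  exists (c * (1 - r ^ (k + n).+1)); split.
    by rewrite qprodS E -!RtoC_pow RtoC_mult RtoC_minus.
  rewrite csumS re_plus re_RtoC.
  have -> : - ((Re (csum n (fun i => RtoC (r ^ i))) + r ^ n) / (1 - r)) =
     - (Re (csum n (fun i => RtoC (r ^ i))) / (1 - r)) + - (r ^ n / (1 - r)) by field; lra.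
  rewrite exp_plus; apply: Rmult_le_compat; try (by left; exact: exp_pos); first exact: H.
  have x1 : r ^ (k + n).+1 <= r ^ n by apply: pow_antitone; [lra | lia].
  have x2 : r ^ (k + n).+1 <= r.
    by rewrite -{2}[r]pow_1; apply: pow_antitone; [lra | lia].
  have x0 : 0 <= r ^ n by apply: pow_le; lra.
  have h : / (1 - r ^ (k + n).+1) <= exp (r ^ n / (1 - r)).
    apply: Rle_trans (exp_ge_1x _).
    set x := r ^ (k + n).+1 in x1 x2 *.
    have x0' : 0 <= x by apply: pow_le; lra.
    have -> : / (1 - x) = 1 + x * / (1 - x) by field; lra.
    apply: Rplus_le_compat_l; apply: Rmult_le_compat => //.
      by left; apply: Rinv_0_lt_compat; lra.
    by apply: Rinv_le_contravar; lra.
  have p1 : 0 < 1 - r ^ (k + n).+1 by lra.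
  rewrite exp_Ropp -[X in _ <= X]Rinv_inv.
  by apply: Rinv_le_contravar => //; exact: Rinv_0_lt_compat.
exists c; split => //; apply: Rle_trans H; apply: exp_le_compat.
have := csum_geo_le r n r01 => h.
apply: Ropp_le_contravar; rewrite /Rdiv /= Rmult_1_r Rinv_mult.
by apply: Rmult_le_compat_r h; left; apply: Rinv_0_lt_compat; lra.
Qed.

(** The first [L] terms only: the identities below stay finite and carry an explicit truncation
    error. *)
Definition gf (a : nat -> nat) (q : C) (L : nat) : C := csum L (fun n => INR (a n) * q ^ n)%C.

Lemma gf_real a r L : gf a (RtoC r) L = RtoC (Re (gf a (RtoC r) L)).
Proof.
apply: C_ext => //; rewrite im_RtoC.
elim: L => [|L IH]; first by [].
by rewrite /gf csumS -/(gf a _ L) im_plus IH -RtoC_pow -RtoC_mult im_RtoC; ring.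
Qed.

Lemma gf_realS a r L : Re (gf a (RtoC r) L.+1) = Re (gf a (RtoC r) L) + INR (a L) * r ^ L.
Proof. by rewrite /gf csumS -/(gf a _ L) re_plus -RtoC_pow -RtoC_mult re_RtoC. Qed.

Lemma gf_real_mono a r (L L' : nat) : 0 <= r -> (L <= L')%N -> Re (gf a (RtoC r) L) <= Re (gf a (RtoC r) L').
Proof.
move=> r0 h; rewrite -(subnK h) addnC; elim: (L' - L)%N => [|d IH]; first by rewrite addn0; lra.
rewrite addnS gf_realS; have : 0 <= INR (a (L + d)%N) * r ^ (L + d).
  by apply: Rmult_le_pos; [exact: pos_INR | exact: pow_le].
lra.
Qed.

Lemma gf_real_ge0 a r (L : nat) : 0 <= r -> 0 <= Re (gf a (RtoC r) L).
Proof. by move=> r0; have := gf_real_mono a r 0 L r0 (leq0n _). Qed.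

Lemma gf_real_le a b r L : 0 <= r -> (forall n, (n < L)%N -> (a n <= b n)%N) ->
  Re (gf a (RtoC r) L) <= Re (gf b (RtoC r) L).
Proof.
move=> r0; elim: L => [|L IH] H; first by rewrite /=; lra.
rewrite !gf_realS; apply: Rplus_le_compat; first by apply: IH => n Hn; apply: H; lia.
apply: Rmult_le_compat_r; first exact: pow_le.
by apply: le_INR; apply/leP; exact: H.
Qed.

Lemma gf_ext a b q L : (forall n, (n < L)%N -> a n = b n) -> gf a q L = gf b q L.
Proof. by move=> H; apply: csum_ext => i Hi; rewrite H. Qed.

Lemma gf_cntS (m : nat) q (L : nat) : (m.+1 <= L)%N ->
  gf (cnt m.+1) q L = (gf (cnt m) q L + q ^ m.+1 * gf (cnt m.+1) q (L - m.+1))%C.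
Proof.
move=> mL; rewrite /gf -csum_mult_l.
have -> : csum L (fun n => INR (cnt m.+1 n) * q ^ n)%C =
  (csum L (fun n => INR (cnt m n) * q ^ n) +
   csum L (fun n => if (m.+1 <= n)%N then INR (cnt m.+1 (n - m.+1)) * q ^ n else RtoC 0))%C.
  rewrite -csum_plus; apply: csum_ext => n _; rewrite cntS plus_INR RtoC_plus.
  by case: ifP => _ /=; ring.
congr (_ + _)%C.
rewrite -{1}(subnKC mL) csum_cat.
have -> : csum m.+1 (fun n => if (m.+1 <= n)%N then INR (cnt m.+1 (n - m.+1)) * q ^ n else RtoC 0)%C = RtoC 0.
  rewrite (csum_ext _ _ (fun => RtoC 0)); first by rewrite csum_const Cmult_0_r.
  by move=> i Hi; rewrite ltnNge -ltnS Hi.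
rewrite Cplus_0_l; apply: csum_ext => n _.
by rewrite leq_addr addKn -plusE Cpow_add_r; ring.
Qed.

(** For [r >= 0], extending the shifted sum of [gf_cntS] from [L - m - 1] to [L] terms only adds
    nonnegative ones, so the product identity survives truncation as an inequality. *)
Lemma gf_cnt_real_bound m r L : 0 <= r < 1 ->
  Re (qprod r 0 m) * Re (gf (cnt m) (RtoC r) L) <= 1.
Proof.
move=> r01; elim: m => [|m IH].
  rewrite re_RtoC Rmult_1_l; elim: L => [|L IHL]; first by rewrite /=; lra.
  rewrite gf_realS cnt0; case: L IHL => [|L] IHL; first by rewrite /=; lra.
  by rewrite /= Rmult_0_l; move: IHL; rewrite /=; lra.
have [c [E Hc]] := qprod_real r 0 m r01.
have c0 : 0 < c by apply: Rlt_le_trans Hc; exact: exp_pos.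
rewrite E re_RtoC in IH.
have rm : 0 <= r ^ m.+1 by apply: pow_le; lra.
have rm1 : r ^ m.+1 <= 1 by apply: pow_le1; lra.
have step : Re (gf (cnt m.+1) (RtoC r) L) * (1 - r ^ m.+1) <= Re (gf (cnt m) (RtoC r) L).
  case: (leqP m.+1 L) => mL.
    have := gf_cntS m (RtoC r) L mL => /(f_equal Re).
    rewrite re_plus -RtoC_pow re_scal_l => E2.
    have := gf_real_mono (cnt m.+1) r (L - m.+1) L (proj1 r01) (leq_subr _ _).
    nra.
  have : Re (gf (cnt m.+1) (RtoC r) L) = Re (gf (cnt m) (RtoC r) L).
    congr Re; apply: gf_ext => n Hn; rewrite cntS; case: ifP => h; lia.
  have := gf_real_ge0 (cnt m.+1) r L (proj1 r01); nra.
rewrite qprodS E -RtoC_pow -RtoC_minus -RtoC_mult re_RtoC add0n.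
by apply: Rle_trans IH; rewrite Rmult_assoc; apply: Rmult_le_compat_l; lra.
Qed.

Lemma cnt_mono m d n : (cnt m n <= cnt (m + d) n)%N.
Proof.
elim: d => [|d IH]; first by rewrite addn0.
by apply: leq_trans IH _; rewrite addnS cntS leq_addr.
Qed.

Lemma cnt_le_partition_number m n : (cnt m n <= partition_number n)%N.
Proof.
rewrite -(cnt_partition_number (m + n) n (leq_addl _ _)); exact: cnt_mono.
Qed.

Lemma gf_partition_qprod r L : 0 <= r < 1 ->
  Re (qprod r 0 L) * Re (gf partition_number (RtoC r) L) <= 1.
Proof.
move=> r01; have := gf_cnt_real_bound L r L r01.
by rewrite (gf_ext (cnt L) partition_number) // => n Hn; apply: cnt_partition_number; lia.
Qed.

Lemma gf_partition_bound r L : 0 <= r < 1 ->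
  Re (gf partition_number (RtoC r) L) <= exp (/ (1 - r) ^ 2).
Proof.
move=> r01; have := gf_partition_qprod r L r01.
have [c [E Hc]] := qprod_real r 0 L r01.
rewrite E re_RtoC => H.
have g0 := gf_real_ge0 partition_number r L (proj1 r01).
have h : exp (- / (1 - r) ^ 2) * Re (gf partition_number (RtoC r) L) <= 1.
  by apply: Rle_trans H; apply: Rmult_le_compat_r.
apply: (Rmult_le_reg_l (exp (- / (1 - r) ^ 2))); first exact: exp_pos.
by rewrite -exp_plus Rplus_opp_l exp_0.
Qed.

(** The condition [|q| <= rho^2] splits [|q|^n] into two factors [rho^n]: one is at most the small
    [rho^L0], the other keeps the remaining sum bounded. *)
Lemma gf_tail a q rho L0 L : Cmod q <= rho * rho -> 0 <= rho <= 1 -> (L0 <= L)%N ->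
  Cmod (gf a q L - gf a q L0) <= rho ^ L0 * Re (gf a (RtoC rho) L).
Proof.
move=> qr r01 h; rewrite -(subnK h) addnC.
elim: (L - L0)%N => [|d IH].
  rewrite addn0 /Cminus Cplus_opp_r Cmod_0; apply: Rmult_le_pos; first by apply: pow_le; lra.
  by apply: gf_real_ge0; lra.
rewrite addnS gf_realS /gf csumS -/(gf a q (L0 + d)) -/(gf a q L0).
set n := (L0 + d)%N.
have -> : (gf a q n + INR (a n) * q ^ n - gf a q L0 = (gf a q n - gf a q L0) + INR (a n) * q ^ n)%C by ring.
apply: Rle_trans (Cmod_triangle _ _) _.
rewrite Rmult_plus_distr_l; apply: Rplus_le_compat => //.
rewrite Cmod_mult Cmod_R Cmod_pow Rabs_pos_eq; last exact: pos_INR.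
have -> : rho ^ L0 * (INR (a n) * rho ^ n) = INR (a n) * (rho ^ L0 * rho ^ n) by ring.
apply: Rmult_le_compat_l; first exact: pos_INR.
apply: Rle_trans (_ : (rho * rho) ^ n <= _).
  by apply: pow_incr; split => //; exact: Cmod_ge_0.
rewrite Rpow_mult_distr; apply: Rmult_le_compat_r; first by apply: pow_le; lra.
by apply: pow_antitone => //; rewrite /n; lia.
Qed.

Lemma gf_partition_tail q rho L0 L : Cmod q <= rho * rho -> 0 <= rho < 1 -> (L0 <= L)%N ->
  Cmod (gf partition_number q L - gf partition_number q L0) <= rho ^ L0 * exp (/ (1 - rho) ^ 2).
Proof.
move=> qr r01 h; apply: Rle_trans (gf_tail _ _ rho _ _ qr _ h) _; first lra.
by apply: Rmult_le_compat_l; [apply: pow_le; lra | exact: gf_partition_bound].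
Qed.

(** Going from [m] to [m + 1] changes the truncated product by the last [m + 1] terms below [L],
    times [q^(m+1)]. By [gf_tail] this costs a multiple of [rho^L rho^m], summable over [m]. *)
Lemma gf_qprod_inv q rho L : Cmod q <= rho * rho -> 0 <= rho < 1 -> (0 < L)%N ->
  Cmod (qprod q 0 L * gf partition_number q L - 1) <=
  exp (/ (1 - rho)) * exp (/ (1 - rho) ^ 2) * / (1 - rho) * rho ^ L.
Proof.
move=> qr r01 L0.
have qr' : Cmod q <= rho by nra.
have q0 := Cmod_ge_0 q.
set B := exp _ * exp _.
have B0 : 0 <= B by apply: Rmult_le_pos; left; exact: exp_pos.
have rL : 0 <= rho ^ L by apply: pow_le; lra.
have main m : (m <= L)%N -> Cmod (qprod q 0 m * gf (cnt m) q L - 1) <=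
   B * rho ^ L * Re (csum m (fun i => RtoC (rho ^ i))).
  elim: m => [|m IH] mL.
    have -> : gf (cnt 0) q L = 1.
      case: L L0 {rL mL} => // L _; elim: L => [|L IHL]; first by rewrite /gf csumS cnt0 /=; ring.
      by rewrite /gf csumS -/(gf _ q _) IHL cnt0 /=; ring.
    by rewrite [qprod _ _ _]/= Cmult_1_l /Cminus Cplus_opp_r Cmod_0 /= Rmult_0_r; lra.
  rewrite qprodS csumS re_plus re_RtoC add0n Rmult_plus_distr_l.
  have E := gf_cntS m q L mL.
  have -> : (qprod q 0 m * (1 - q ^ m.+1) * gf (cnt m.+1) q L - 1 =
    (qprod q 0 m * gf (cnt m) q L - 1) +
    - (qprod q 0 m * q ^ m.+1 * (gf (cnt m.+1) q L - gf (cnt m.+1) q (L - m.+1))))%C.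
    by rewrite E; ring.
  apply: Rle_trans (Cmod_triangle _ _) _; apply: Rplus_le_compat; first by apply: IH; lia.
  rewrite Cmod_opp !Cmod_mult Cmod_pow.
  have h1 := Cmod_qprod_le q rho 0 m qr' (proj2 r01).
  have h2 := gf_tail (cnt m.+1) q rho (L - m.+1) L qr ltac:(lra) (leq_subr _ _).
  have h3 : Re (gf (cnt m.+1) (RtoC rho) L) <= exp (/ (1 - rho) ^ 2).
    apply: Rle_trans (gf_partition_bound rho L r01).
    by apply: gf_real_le => [|n _]; [lra | exact: cnt_le_partition_number].
  have rm : 0 <= rho ^ (L - m.+1) by apply: pow_le; lra.
  have rm' : 0 <= rho ^ m by apply: pow_le; lra.
  have h4 : Cmod q ^ m.+1 <= rho ^ m.+1 * rho ^ m.
    apply: Rle_trans (_ : (rho * rho) ^ m.+1 <= _); first by apply: pow_incr; lra.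
    rewrite Rpow_mult_distr; apply: Rmult_le_compat_l; first by apply: pow_le; lra.
    by apply: pow_antitone; [lra | lia].
  have h5 : Cmod (gf (cnt m.+1) q L - gf (cnt m.+1) q (L - m.+1)) <= rho ^ (L - m.+1) * exp (/ (1 - rho) ^ 2).
    by apply: Rle_trans h2 _; apply: Rmult_le_compat_l.
  have -> : B * rho ^ L * rho ^ m = exp (/ (1 - rho)) * (rho ^ m.+1 * rho ^ m) * (rho ^ (L - m.+1) * exp (/ (1 - rho) ^ 2)).
    have -> : rho ^ L = rho ^ m.+1 * rho ^ (L - m.+1) by rewrite -pow_add plusE subnKC.
    by rewrite /B; ring.
  apply: Rmult_le_compat => //; try exact: Cmod_ge_0.
    by apply: Rmult_le_pos; [exact: Cmod_ge_0 | exact: (pow_le _ m.+1)].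
  by apply: Rmult_le_compat => //; [exact: Cmod_ge_0 | exact: (pow_le _ m.+1)].
have := main L (leqnn L).
rewrite (gf_ext (cnt L) partition_number); last by move=> n Hn; apply: cnt_partition_number; lia.
move=> H; apply: Rle_trans H _.
have -> : B * / (1 - rho) * rho ^ L = B * rho ^ L * / (1 - rho) by ring.
apply: Rmult_le_compat_l; first exact: Rmult_le_pos.
exact: csum_geo_le.
Qed.

(** * The pentagonal number theorem in finite form *)

Fixpoint tri (n : nat) : nat := match n with O => O | S k => (tri k + k.+1)%N end.

(** As [k^2 + k (k + 1) / 2 = k (3 k + 1) / 2], this is the sum of [(-1)^k q^(k (3 k - 1) / 2)] over
    the integers [|k| <= m]. *)
Fixpoint pent (q : C) (m : nat) : C :=
  match m with
  | O => RtoC 1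
  | S k => (pent q k + (- 1) ^ k.+1 * (q ^ (k.+1 * k.+1 + tri k.+1) + q ^ (k.+1 * k.+1 + tri k)))%C
  end.

Definition shanks_term (q : C) (m k : nat) : C :=
  ((- 1) ^ k * qprod q k (m - k) * q ^ (k * m + tri k))%C.

Lemma qprod_recl q k n : qprod q k n.+1 = ((1 - q ^ k.+1) * qprod q k.+1 n)%C.
Proof.
elim: n => [|n IH]; first by rewrite qprodS addn0 /=; ring.
by rewrite qprodS IH [in RHS]qprodS addSnnS; ring.
Qed.

(* Shanks' finite form of the pentagonal number theorem: going from [m] to [m + 1] the terms telescope. *)
Lemma shanks q m : csum m.+1 (shanks_term q m) = pent q m.
Proof.
elim: m => [|m IH].
  by rewrite /= /shanks_term /=; ring.
pose w k := ((- 1) ^ k.+1 * qprod q k (m - k) * q ^ (k.+1 * m + tri k.+1))%C.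
have step j : (j <= m)%N ->
   csum j.+1 (fun k => shanks_term q m.+1 k + (- 1) * shanks_term q m k)%C = w j.
  have D k : (k <= m)%N -> (shanks_term q m.+1 k + (- 1) * shanks_term q m k =
     - (- 1) ^ k * qprod q k (m - k) * (1 - q ^ k) * q ^ (k * m + tri k) + w k)%C.
    move=> km; rewrite /shanks_term /w (subSn km) qprodS.
    rewrite (_ : (k + (m - k)).+1 = m.+1); last by lia.
    rewrite (_ : (k * m.+1 + tri k = k * m + tri k + k)%N); last by lia.
    rewrite (_ : (k.+1 * m + tri k.+1 = k * m + tri k + k + m.+1)%N); last by rewrite /=; lia.
    rewrite !(Cpow_add_r q (_ + _)) (Cpow_S _ k); ring.
  elim: j => [|j IHj] jm.
    by rewrite csumS D //= Cplus_0_l; rewrite (_ : RtoC 1 - 1 = 0)%C; ring.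
  rewrite csumS IHj ?D //; last by lia.
  rewrite {1}/w (_ : (m - j = (m - j.+1).+1)%N); last by lia.
  rewrite qprod_recl !Cpow_S; ring.
rewrite csumS.
have -> : csum m.+1 (shanks_term q m.+1) = (csum m.+1 (shanks_term q m) +
   csum m.+1 (fun k => shanks_term q m.+1 k + (- 1) * shanks_term q m k))%C.
  by rewrite -csum_plus; apply: csum_ext => i _; ring.
rewrite IH step // /w /shanks_term !subnn.
rewrite (_ : (m.+1 * m + tri m.+1 = m.+1 * m.+1 + tri m)%N); last by rewrite /=; lia.
rewrite (_ : pent q m.+1 = pent q m + (- 1) ^ m.+1 *
  (q ^ (m.+1 * m.+1 + tri m.+1) + q ^ (m.+1 * m.+1 + tri m)))%C //.
by rewrite (_ : qprod q m 0 = 1) // (_ : qprod q m.+1 0 = 1) //; ring.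
Qed.

(** In Shanks' sum the term [k = 0] is the product itself. The terms [k >= 1] carry [q] to a power
    [k m + tri k >= m + k - 1], so together they are of order [r^m]. *)
Lemma pent_qprod q r m : Cmod q <= r -> r < 1 ->
  Cmod (pent q m - qprod q 0 m) <= exp (/ (1 - r)) / (1 - r) * r ^ m.
Proof.
move=> qr r1; have q0 := Cmod_ge_0 q.
have e0 := exp_pos (/ (1 - r)).
have rm : 0 <= r ^ m by apply: pow_le; lra.
rewrite -shanks csum_recl {1}/shanks_term subn0 mul0n add0n.
have -> : ((- 1) ^ 0 * qprod q 0 m * q ^ tri 0 + csum m (fun i => shanks_term q m i.+1) - qprod q 0 m
  = csum m (fun i => shanks_term q m i.+1))%C by rewrite /=; ring.
apply: Rle_trans (_ : exp (/ (1 - r)) * r ^ m * Re (csum m (fun i => RtoC (r ^ i))) <= _); last first.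
  have -> : exp (/ (1 - r)) / (1 - r) * r ^ m = exp (/ (1 - r)) * r ^ m * / (1 - r) by rewrite /Rdiv; ring.
  by apply: Rmult_le_compat_l; [apply: Rmult_le_pos; lra | apply: csum_geo_le; lra].
have main n : (n <= m)%N -> Cmod (csum n (fun i => shanks_term q m i.+1)) <=
   exp (/ (1 - r)) * r ^ m * Re (csum n (fun i => RtoC (r ^ i))).
  elim: n => [|n IH] nm; first by rewrite /= Cmod_0 Rmult_0_r; lra.
  rewrite !csumS re_plus re_RtoC Rmult_plus_distr_l.
  apply: Rle_trans (Cmod_triangle _ _) _; apply: Rplus_le_compat; first by apply: IH; lia.
  rewrite /shanks_term !Cmod_mult !Cmod_pow (_ : Cmod (-1) = 1) ?pow1; last by rewrite Cmod_R Rabs_left; lra.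
  rewrite !Rmult_assoc !Rmult_1_l.
  apply: Rmult_le_compat; [exact: Cmod_ge_0 | apply: pow_le | exact: Cmod_qprod_le |] => //.
  apply: Rle_trans (_ : r ^ (n.+1 * m + tri n.+1) <= _); first by apply: pow_incr.
  rewrite -pow_add plusE; apply: pow_antitone; first by lra.
  by rewrite /=; nia.
exact: main.
Qed.

(** [zeta] stands for a square root of [3 tau / 2], which makes this [exp (- tau)]. *)
Definition nome (zeta : C) : C := cexp (- ((2 / 3)%R * (zeta * zeta)))%C.

(** In terms of [tau] this is [sqrt (tau / (2 PI)) exp (PI^2 / (6 tau) - tau / 24)], the leading
    term given by the transformation law of Dedekind's eta function. *)
Definition pmain (zeta : C) : C :=
  (zeta / sqrt (3 * PI) * cexp ((PI ^ 2 / 4)%R / (zeta * zeta) - (1 / 36)%R * (zeta * zeta)))%C.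

Lemma cexp_PI_nat (n : nat) : cexp (Ci * (PI * INR n)%R) = ((-1) ^ n)%C /\ cexp (Ci * (PI * - INR n)%R) = ((-1) ^ n)%C.
Proof.
have E1 : cexp (Ci * PI) = -1.
  rewrite /cexp (_ : Re (Ci * PI) = 0); last by rewrite /Re /=; ring.
  rewrite (_ : Im (Ci * PI) = PI); last by rewrite /Im /=; ring.
  by rewrite exp_0 cos_PI sin_PI; apply: C_ext => /=; ring.
have E2 : cexp (Ci * (- PI)%R) = -1.
  rewrite RtoC_opp (_ : Ci * - PI = - (Ci * PI))%C; last by ring.
  rewrite cexp_opp E1.
  by apply: C_ext => /=; field.
split.
  by rewrite -E1 -cexp_pow; congr cexp; rewrite RtoC_mult; ring.
rewrite -E2 -cexp_pow; congr cexp; rewrite (_ : PI * - INR n = INR n * - PI); last ring.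
by rewrite RtoC_mult; ring.
Qed.

Lemma tri_double n : INR (tri n) = INR n * (INR n + 1) / 2.
Proof.
elim: n => [|n IH]; first by rewrite /=; field.
by rewrite [tri _]/= plus_INR IH S_INR; field.
Qed.

Lemma zsum_gpol_pent (zeta : C) K :
  zsum (gpol zeta 1) K = (cexp (- ((1 / 36)%R * (zeta * zeta))) * pent (nome zeta) K)%C.
Proof.
have E (x : R) (n e : nat) : (x = INR n \/ x = - INR n) -> INR e = x * (3 * x - 1) / 2 ->
   gpol zeta 1 x = (cexp (- ((1 / 36)%R * (zeta * zeta))) * ((-1) ^ n * nome zeta ^ e))%C.
  move=> Hx He; rewrite /gpol cexp_add.
  have -> : cexp (Ci * (PI * 1 * x)%R) = ((-1) ^ n)%C.
    by have [h1 h2] := cexp_PI_nat n; rewrite Rmult_1_r; case: Hx => ->.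
  rewrite /nome -cexp_pow He.
  have sw (a b c : C) : (a * (c * b) = a * b * c)%C by ring.
  rewrite [RHS]sw -cexp_add; congr (cexp _ * _)%C.
  by apply: C_ext; rewrite /Re /Im /=; field.
elim: K => [|K IH].
  by rewrite [zsum _ _]/= (E 0 O O) /= ?Cmult_1_l ?Cmult_1_r //; [left | field].
rewrite [LHS]/= IH -/(INR K.+1).
rewrite (E (INR K.+1) K.+1 (K.+1 * K.+1 + tri K)%N); [| by left |]; last first.
  by rewrite plus_INR mult_INR tri_double S_INR; field.
rewrite (E (- INR K.+1) K.+1 (K.+1 * K.+1 + tri K.+1)%N); [| by right |]; last first.
  by rewrite plus_INR mult_INR tri_double S_INR; field.
rewrite (_ : pent (nome zeta) K.+1 = pent (nome zeta) K + (- 1) ^ K.+1 *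
  (nome zeta ^ (K.+1 * K.+1 + tri K.+1) + nome zeta ^ (K.+1 * K.+1 + tri K)))%C //.
ring.
Qed.

(** The phases [exp (i PI / 6)] and [exp (- i PI / 6)], due to the shift by [1 / 6], add up to
    [2 cos (PI / 6) = sqrt 3]. *)
Lemma theta_mainE (zeta : C) : theta_main zeta = (sqrt 3 * (sqrt PI / zeta * cexp (- ((PI ^ 2 / 4)%R / (zeta * zeta)))))%C.
Proof.
have E (s : R) : s ^ 2 = 1 -> gft zeta s = (sqrt PI / zeta * cexp (- ((PI ^ 2 / 4)%R / (zeta * zeta))) * cexp (Ci * (PI * s / 6)%R))%C.
  move=> s2; rewrite /gft s2 Rmult_1_r /Cminus cexp_add; ring.
rewrite /theta_main !E; [| ring | ring].
have -> : (cexp (Ci * (PI * 1 / 6)%R) = (cos (PI / 6), sin (PI / 6)))%C.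
  rewrite /cexp (_ : Re (Ci * (PI * 1 / 6)%R) = 0); last by rewrite /Re /=; ring.
  rewrite (_ : Im (Ci * (PI * 1 / 6)%R) = PI / 6); last by rewrite /Im /=; field.
  by rewrite exp_0 !Rmult_1_l.
have -> : (cexp (Ci * (PI * -1 / 6)%R) = (cos (PI / 6), (- sin (PI / 6))%R))%C.
  rewrite /cexp (_ : Re (Ci * (PI * -1 / 6)%R) = 0); last by rewrite /Re /=; ring.
  rewrite (_ : Im (Ci * (PI * -1 / 6)%R) = - (PI / 6)); last by rewrite /Im /=; field.
  by rewrite exp_0 !Rmult_1_l cos_neg sin_neg.
rewrite cos_PI6 -Cmult_plus_distr_l Cmult_comm; congr (_ * _)%C.
by apply: C_ext => /=; field.
Qed.

Lemma pmain_theta_main (zeta : C) : zeta <> 0 ->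
  (pmain zeta * theta_main zeta = cexp (- ((1 / 36)%R * (zeta * zeta))))%C.
Proof.
move=> z0; have P0 := PI_RGT_0.
rewrite theta_mainE /pmain sqrt_mult; [| lra | lra].
have p0 : RtoC (sqrt PI) <> 0 by move/RtoC_inj; have := sqrt_lt_R0 PI P0; lra.
have t0 : RtoC (sqrt 3) <> 0 by move/RtoC_inj; have := sqrt_lt_R0 3 ltac:(lra); lra.
rewrite RtoC_mult.
set a := ((PI ^ 2 / 4)%R / (zeta * zeta))%C; set b := ((1 / 36)%R * (zeta * zeta))%C.
have -> : (zeta / (sqrt 3 * sqrt PI) * cexp (a - b) * (sqrt 3 * (sqrt PI / zeta * cexp (- a))) =
  cexp (a - b) * cexp (- a))%C by field.
by rewrite -cexp_add; congr cexp; ring.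
Qed.

(** The generating function [x] nearly inverts the pentagonal sum. With [pent * x = 1 + d],
    [E * pent = T + e] and [X * T = E], one gets [(x - X) (T + e) = X (T d - e)], so a relative
    error for theta becomes one of the same order for [x]. *)
Lemma gf_approx_limit (zeta : C) eps : Rabs (Im zeta) < Re zeta -> theta_rho zeta <= 1 / 10 -> 0 < eps ->
  exists K0, forall K, (K0 <= K)%N ->
  Cmod (gf partition_number (nome zeta) K - pmain zeta) <= Cmod (pmain zeta) * (3 * theta_rho zeta + eps).
Proof.
move=> Hz rho10 e0.
have z0 : zeta <> 0 by move=> E; move: Hz; rewrite E /= Rabs_R0; lra.
set T := theta_main zeta; set E := cexp (- ((1 / 36)%R * (zeta * zeta))).
set X := pmain zeta; set q := nome zeta.
have XT : (X * T = E)%C := pmain_theta_main zeta z0.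
have E0 : E <> 0 := cexp_neq0 _.
have T0 : T <> 0 by move=> h; apply: E0; rewrite -XT h Cmult_0_r.
have Tp : 0 < Cmod T by apply/Cmod_gt_0.
set r := theta_rho zeta in rho10 *; have [r0 r1] : 0 <= r < 1 := theta_rho_lt1 zeta Hz.
set m0 := Cmod (gft zeta 1).
have Tm : Cmod T = sqrt 3 * m0.
  rewrite /T theta_mainE Cmod_mult Cmod_R Rabs_pos_eq; last exact: sqrt_pos.
  congr (_ * _); rewrite /m0 Cmod_gft // Cmod_mult Cmod_cexp; congr (_ * exp _).
  by rewrite re_opp re_scal_l; field.
have s3 : 1.7 <= sqrt 3.
  by rewrite -(sqrt_Rsqr 1.7); [apply: sqrt_le_1; rewrite /Rsqr; lra | lra].
have m00 : 0 <= m0 := Cmod_ge_0 _.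
have m0T : m0 <= Cmod T * (10 / 17) by rewrite Tm; nra.
(* [2 * (10 / 17) * (10 / 9) < 1.4], using [m0 = |T| / sqrt 3] and [r <= 1 / 10]. *)
have Err : 2 * (m0 * r / (1 - r)) <= Cmod T * (1.4 * r).
  have -> : 2 * (m0 * r / (1 - r)) = 2 * m0 * r * / (1 - r) by field; lra.
  have ir : / (1 - r) <= 10 / 9.
    by rewrite (_ : 10 / 9 = / (9 / 10)); [apply: Rinv_le_contravar; lra | field].
  have ir0 : 0 < / (1 - r) by apply: Rinv_0_lt_compat; lra.
  apply: Rle_trans (_ : 2 * m0 * r * (10 / 9) <= _).
    by apply: Rmult_le_compat_l => //; nra.
  have : m0 * r <= Cmod T * (10 / 17) * r by apply: Rmult_le_compat_r.
  nra.
have qlt : 0 < Re (zeta * zeta).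
  have i0 := Rabs_pos (Im zeta); rewrite re_mult.
  have -> : Im zeta * Im zeta = Rabs (Im zeta) * Rabs (Im zeta) by rewrite -Rabs_mult Rabs_pos_eq //; nra.
  by nra.
pose s := exp (- (1 / 3 * Re (zeta * zeta))).
have s01 : 0 <= s < 1.
  split; first by left; exact: exp_pos.
  by rewrite -exp_0; apply: exp_increasing; lra.
have qs : Cmod q <= s * s.
  rewrite Cmod_cexp /s -exp_plus; right; congr exp.
  by rewrite re_opp re_scal_l; field.
have qs' : Cmod q <= s by nra.
pose e1 := Rmin (1 / 10) (eps / 10).
have e10 : 0 < e1 by apply: Rmin_pos; lra.
have e11 : e1 <= 1 / 10 by exact: Rmin_l.
have e12 : e1 <= eps / 10 by exact: Rmin_r.
have [K1 H1] := theta_approx zeta (e1 * Cmod T) Hz (Rmult_lt_0_compat _ _ e10 Tp).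
pose B := exp (/ (1 - s)) / (1 - s) * exp (/ (1 - s) ^ 2) + exp (/ (1 - s)) * exp (/ (1 - s) ^ 2) * / (1 - s).
have B0 : 0 < B.
  have is0 : 0 < / (1 - s) by apply: Rinv_0_lt_compat; lra.
  have h := exp_pos (/ (1 - s)); have h' := exp_pos (/ (1 - s) ^ 2).
  by apply: Rplus_lt_0_compat; repeat apply: Rmult_lt_0_compat => //.
have [K2 H2] : exists K2, forall n, (K2 <= n)%N -> B * s ^ n <= e1.
  have eB : 0 < e1 / B by apply: Rdiv_lt_0_compat.
  have s1 : Rabs s < 1 by rewrite Rabs_pos_eq; lra.
  have [N HN] := pow_lt_1_zero s s1 (e1 / B) eB.
  exists N => n /leP hn; have := HN n hn; rewrite Rabs_pos_eq; last by apply: pow_le; lra.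
  move=> h; have := Rmult_le_compat_l B _ _ (Rlt_le _ _ B0) (Rlt_le _ _ h).
  by rewrite (_ : B * (e1 / B) = e1) //; field; lra.
exists (maxn 1 (maxn K1 K2)) => K; rewrite !geq_max => /and3P[k0 k1 k2].
have {H1} h1 := H1 K k1; have {H2} h2 := H2 K k2.
rewrite zsum_gpol_pent -/T -/E -/q -/m0 -/r in h1.
set x := gf _ _ _.
have xb : Cmod x <= exp (/ (1 - s) ^ 2).
  have := gf_partition_tail q s 0 K qs s01 (leq0n _).
  by rewrite (_ : gf partition_number q 0 = 0) //= Rmult_1_l /Cminus Copp_0 Cplus_0_r.
have d1 : Cmod (pent q K * x - 1) <= e1.
  have -> : (pent q K * x - 1 = (pent q K - qprod q 0 K) * x + (qprod q 0 K * x - 1))%C by ring.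
  apply: Rle_trans (Cmod_triangle _ _) _; apply: Rle_trans h2.
  rewrite /B Rmult_plus_distr_r; apply: Rplus_le_compat; last exact: gf_qprod_inv.
  rewrite Cmod_mult.
  have -> : exp (/ (1 - s)) / (1 - s) * exp (/ (1 - s) ^ 2) * s ^ K =
     (exp (/ (1 - s)) / (1 - s) * s ^ K) * exp (/ (1 - s) ^ 2) by ring.
  apply: Rmult_le_compat; [exact: Cmod_ge_0 | exact: Cmod_ge_0 | | exact: xb].
  by apply: pent_qprod => //; lra.
set e := (E * pent q K - T)%C in h1; set d := (pent q K * x - 1)%C in d1.
have he : Cmod e <= Cmod T * (1.4 * r + e1) by lra.
have EX : ((x - X) * (T + e) = X * (T * d - e))%C.
  rewrite /e /d (_ : T + (E * pent q K - T) = E * pent q K)%C; last by ring.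
  have -> : ((x - X) * (E * pent q K) = E * (pent q K * x) - X * (E * pent q K))%C by ring.
  by rewrite -XT; ring.
have Te : Cmod T / 1.4 <= Cmod (T + e).
  have := Cmod_triangle (T + e) (- e); rewrite Cmod_opp.
  rewrite (_ : T + e + - e = T)%C; last by ring.
  have : Cmod T * (1.4 * r + e1) <= Cmod T * (24 / 100) by apply: Rmult_le_compat_l; lra.
  lra.
have Xp := Cmod_ge_0 X.
(* After division by [|T| / 1.4] there remains [1.4 (1.4 r + 2 e1) <= 3 r + eps], the source of the
   factor [3]. *)
have U : Cmod (x - X) * (Cmod T / 1.4) <= Cmod X * (Cmod T * (1.4 * r + 2 * e1)).
  apply: Rle_trans (_ : Cmod (x - X) * Cmod (T + e) <= _).
    by apply: Rmult_le_compat_l => //; exact: Cmod_ge_0.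
  rewrite -Cmod_mult EX Cmod_mult; apply: Rmult_le_compat_l => //.
  apply: Rle_trans (Cmod_triangle _ _) _; rewrite Cmod_opp Cmod_mult.
  have : Cmod T * Cmod d <= Cmod T * e1 by apply: Rmult_le_compat_l; lra.
  lra.
apply: (Rmult_le_reg_r (Cmod T / 1.4)); first lra.
apply: Rle_trans U _.
have -> : Cmod X * (3 * r + eps) * (Cmod T / 1.4) = Cmod X * (Cmod T * ((3 * r + eps) / 1.4)) by rewrite /Rdiv; ring.
apply: Rmult_le_compat_l => //; apply: Rmult_le_compat_l; lra.
Qed.

Lemma gf_approx (zeta : C) s M : Rabs (Im zeta) < Re zeta -> theta_rho zeta <= 1 / 10 ->
  0 <= s < 1 -> Cmod (nome zeta) <= s * s ->
  Cmod (gf partition_number (nome zeta) M - pmain zeta) <=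
  Cmod (pmain zeta) * (3 * theta_rho zeta) + s ^ M * exp (/ (1 - s) ^ 2).
Proof.
move=> Hz r10 s01 qs; apply: le_epsilon => eps e0.
have X0 := Cmod_ge_0 (pmain zeta).
have d0 : 0 < eps / (Cmod (pmain zeta) + 1) by apply: Rdiv_lt_0_compat; lra.
have [K0 H] := gf_approx_limit zeta _ Hz r10 d0.
pose K := maxn K0 M.
have h1 := H K (leq_maxl _ _).
have h2 := gf_partition_tail (nome zeta) s M K qs s01 (leq_maxr _ _).
set a := gf _ _ K in h1 h2; set b := gf _ _ M in h2 *.
have -> : (b - pmain zeta = (a - pmain zeta) + - (a - b))%C by ring.
apply: Rle_trans (Cmod_triangle _ _) _; rewrite Cmod_opp.
apply: Rle_trans (Rplus_le_compat _ _ _ _ h1 h2) _.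
have : Cmod (pmain zeta) * (eps / (Cmod (pmain zeta) + 1)) <= eps.
  have -> : eps = (Cmod (pmain zeta) + 1) * (eps / (Cmod (pmain zeta) + 1)) by field; lra.
  have -> : (Cmod (pmain zeta) + 1) * (eps / (Cmod (pmain zeta) + 1)) / (Cmod (pmain zeta) + 1) = eps / (Cmod (pmain zeta) + 1).
    by field; lra.
  by apply: Rmult_le_compat_r; lra.
lra.
Qed.

(** * Minor arc *)

(** With [y = |z| - Re z], exactly [|1 - z|^2 = (1 - |z|)^2 + 2 y]. Squaring the left side gives
    [(1 - |z|)^2 exp (y / 2)], and [exp (y / 2) <= 1 + 3 y / 2] because [y <= 2]. *)
Lemma Cmod_1_minus_ge (z : C) : Cmod z < 1 ->
  (1 - Cmod z) * exp ((Cmod z - Re z) / 4) <= Cmod (1 - z).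
Proof.
move=> z1; have z0 := Cmod_ge_0 z.
have hr : Rabs (Re z) <= Cmod z := re_le_Cmod z.
have hr2 : - Cmod z <= Re z <= Cmod z by apply/Rabs_le_between.
set y := Cmod z - Re z.
apply: Rsqr_incr_0_var; last exact: Cmod_ge_0.
rewrite !Rsqr_pow2 Cmod2_alt.
have -> : Re (1 - z) = 1 - Re z by rewrite re_plus re_opp re_RtoC.
have -> : Im (1 - z) = - Im z by rewrite im_plus im_opp im_RtoC; ring.
have m2 := Cmod2_alt z.
have -> : (1 - Re z) ^ 2 + (- Im z) ^ 2 = (1 - Cmod z) ^ 2 + 2 * y.
  by rewrite /y; have -> : (- Im z) ^ 2 = Cmod z ^ 2 - Re z ^ 2; [rewrite m2; ring | ring].
rewrite Rpow_mult_distr exp_mul_nat (_ : INR 2 * (y / 4) = y / 2); last by rewrite /=; field.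
have u1 : 0 <= y / 2 <= 1 by rewrite /y; lra.
have E : exp (y / 2) <= 1 + 3 * (y / 2).
  have := exp_ge_1x (- (y / 2)) => h.
  have h1 : exp (- (y / 2)) * exp (y / 2) = 1 by rewrite -exp_plus Rplus_opp_l exp_0.
  have h2 : exp (y / 2) <= 3 by apply: Rle_trans exp_le_3; apply: exp_le_compat; lra.
  have := exp_pos (y / 2); nra.
have c0 : 0 <= (1 - Cmod z) ^ 2 <= 1.
  by split; [exact: pow2_ge_0 | nra].
nra.
Qed.

Lemma Cmod_qprod_ge (q : C) M : Cmod q < 1 ->
  Re (qprod (Cmod q) 0 M) * exp (Re (csum M (fun j => RtoC (Cmod q ^ j.+1) - q ^ j.+1))%C / 4) <= Cmod (qprod q 0 M).
Proof.
move=> q1; have q0 := Cmod_ge_0 q.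
elim: M => [|M IH].
  by rewrite /= Cmod_1 /Rdiv Rmult_0_l exp_0; lra.
have [c [E Hc]] := qprod_real (Cmod q) 0 M (conj q0 q1).
have c0 : 0 < c by apply: Rlt_le_trans Hc; exact: exp_pos.
have [c' [E' _]] := qprod_real (Cmod q) 0 M.+1 (conj q0 q1).
rewrite E re_RtoC in IH.
rewrite qprodS E add0n -RtoC_pow -RtoC_minus -RtoC_mult re_RtoC csumS re_plus.
set S := Re (csum M _) in IH *.
have -> : (S + Re (RtoC (Cmod q ^ M.+1)%R - q ^ M.+1)%C) / 4 = S / 4 + (Cmod (q ^ M.+1) - Re (q ^ M.+1)) / 4.
  by rewrite re_plus re_opp re_RtoC Cmod_pow; field.
rewrite exp_plus qprodS add0n Cmod_mult.
have qm : Cmod (q ^ M.+1) < 1.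
  rewrite Cmod_pow; apply: Rle_lt_trans (_ : Cmod q < 1) => //.
  by rewrite -{2}[Cmod q]pow_1; apply: pow_antitone; [lra | lia].
have h := Cmod_1_minus_ge _ qm; rewrite {1}Cmod_pow in h.
have -> : c * (1 - Cmod q ^ M.+1) * (exp (S / 4) * exp ((Cmod (q ^ M.+1) - Re (q ^ M.+1)) / 4)) =
  (c * exp (S / 4)) * ((1 - Cmod q ^ M.+1) * exp ((Cmod (q ^ M.+1) - Re (q ^ M.+1)) / 4)) by ring.
have p1 : 0 <= 1 - Cmod q ^ M.+1 by rewrite -Cmod_pow; lra.
apply: Rmult_le_compat => //.
  by apply: Rmult_le_pos; [lra | left; exact: exp_pos].
by apply: Rmult_le_pos; [lra | left; exact: exp_pos].
Qed.

Lemma csum_geo (q : C) M : q <> 1 -> csum M (fun j => q ^ j.+1)%C = (q / (1 - q) - q ^ M.+1 / (1 - q))%C.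
Proof.
move=> q1; have n1 : (1 - q <> 0)%C.
  by move=> h; apply: q1; rewrite -[q]Cplus_0_r -h; ring.
elim: M => [|M IH]; first by rewrite /=; field.
by rewrite csumS IH !Cpow_S; field.
Qed.

(** For [|q| < 1], the sum of [|q|^j - Re (q^j)] over [j >= 1]: four times the exponent that
    [Cmod_1_minus_ge] collects from all factors of the Euler product. *)
Definition minor_gain (q : C) : R := Cmod q / (1 - Cmod q) - Re (q / (1 - q))%C.

Lemma csum_gain (q : C) M : Cmod q < 1 ->
  minor_gain q - 2 * Cmod q ^ M.+1 / (1 - Cmod q) <=
  Re (csum M (fun j => RtoC (Cmod q ^ j.+1) - q ^ j.+1))%C.
Proof.
move=> q1; have q0 := Cmod_ge_0 q.
have nq : q <> 1 by move=> E; move: q1; rewrite E Cmod_1; lra.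
have nm : RtoC (Cmod q) <> 1 by move=> /RtoC_inj; lra.
have -> : csum M (fun j => RtoC (Cmod q ^ j.+1) - q ^ j.+1)%C =
   (csum M (fun j => RtoC (Cmod q) ^ j.+1) + (-1) * csum M (fun j => q ^ j.+1))%C.
  rewrite -csum_mult_l -csum_plus; apply: csum_ext => i _; rewrite RtoC_pow; ring.
rewrite !csum_geo // -RtoC_pow -RtoC_minus -!RtoC_div; try lra.
rewrite -RtoC_minus re_plus re_RtoC re_scal_l re_plus re_opp /minor_gain.
have n1 : 1 - Cmod q <= Cmod (1 - q).
  have := Cmod_triangle (1 - q) q; rewrite (_ : 1 - q + q = 1)%C; last by ring.
  by rewrite Cmod_1; lra.
have h : Re (q ^ M.+1 / (1 - q)) >= - (Cmod q ^ M.+1 / (1 - Cmod q)).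
  have : Rabs (Re (q ^ M.+1 / (1 - q))) <= Cmod q ^ M.+1 / (1 - Cmod q).
    apply: Rle_trans (re_le_Cmod _) _.
    rewrite Cmod_div; last by move=> e; move: n1; rewrite e Cmod_0; lra.
    rewrite Cmod_pow; apply: Rmult_le_compat_l; first exact: pow_le.
    by apply: Rinv_le_contravar; lra.
  by move/Rabs_le_between => [? _]; lra.
rewrite /Rdiv in h *; lra.
Qed.

Lemma nome_real t : 0 < t -> nome (sqrt (3 * t / 2)) = exp (- t).
Proof.
move=> t0; rewrite /nome -RtoC_mult sqrt_sqrt; last lra.
by rewrite -RtoC_mult -RtoC_opp cexp_RtoC; congr (RtoC (exp _)); field.
Qed.

Lemma Cmod_pmain_real t : 0 < t ->
  Cmod (pmain (sqrt (3 * t / 2))) <= sqrt t * exp (PI ^ 2 / (6 * t)).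
Proof.
move=> t0; have P := PI2_3_2.
have s0 : 0 < sqrt (3 * t / 2) by apply: sqrt_lt_R0; lra.
have s1 : 0 < sqrt (3 * PI) by apply: sqrt_lt_R0; lra.
rewrite /pmain Cmod_mult Cmod_cexp -RtoC_mult sqrt_sqrt; last lra.
apply: Rmult_le_compat; [exact: Cmod_ge_0 | by left; exact: exp_pos | |].
  rewrite -RtoC_div; last lra.
  rewrite Cmod_R Rabs_pos_eq; last by apply: Rdiv_le_0_compat; lra.
  rewrite -sqrt_div; [| lra | lra].
  apply: sqrt_le_1; [apply: Rdiv_le_0_compat; lra | lra |].
  by apply: (Rmult_le_reg_r (3 * PI)); [lra | rewrite /Rdiv Rmult_assoc Rinv_l; nra].
apply: exp_le_compat.
rewrite -RtoC_div; last lra.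
rewrite -RtoC_mult -RtoC_minus re_RtoC.
have -> : PI ^ 2 / 4 / (3 * t / 2) = PI ^ 2 / (6 * t) by field; lra.
lra.
Qed.

Lemma theta_rho_real t : 0 < t <= 1 / 20 -> theta_rho (sqrt (3 * t / 2)) <= 1 / 10.
Proof.
move=> t0; have P := PI2_3_2.
rewrite /theta_rho -RtoC_mult sqrt_sqrt; last lra.
rewrite -RtoC_inv; last lra.
rewrite re_RtoC.
have h : 10 <= 2 * PI ^ 2 * / (3 * t / 2).
  apply: (Rmult_le_reg_r (3 * t / 2)); first lra.
  by rewrite Rmult_assoc Rinv_l; nra.
have h0 : 0 < 2 * PI ^ 2 * / (3 * t / 2) by lra.
have H := exp_opp_le_inv _ h0.
apply: Rle_trans H _; rewrite (_ : 1 / 10 = / 10); last by field.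
by apply: Rinv_le_contravar; lra.
Qed.

(** The values at [q] and at [|q| = exp (- t)] are both nearly inverse to their Euler products,
    whose ratio is controlled by the gain; at the real point the main term estimate applies.
    Truncation errors are kept below [1 / 40], and the factor [2] covers
    [1.4 (41 / 40) / (39 / 40)^2]. *)
Lemma gf_minor_limit (q : C) t : 0 < t <= 1 / 20 -> Cmod q = exp (- t) ->
  exists K0, forall K, (K0 <= K)%N ->
  Cmod (gf partition_number q K) <= 2 * (sqrt t * exp (PI ^ 2 / (6 * t))) * exp (- (minor_gain q / 4)).
Proof.
move=> t0 qt.
set r := exp (- t) in qt.
have r0 : 0 < r by exact: exp_pos.
have r1 : r < 1 by rewrite -exp_0; apply: exp_increasing; lra.
set zeta := sqrt (3 * t / 2).
have zp : 0 < zeta by apply: sqrt_lt_R0; lra.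
have Hz : Rabs (Im zeta) < Re zeta by rewrite im_RtoC re_RtoC Rabs_R0.
have [K1 H1] := gf_approx_limit zeta (1 / 10) Hz (theta_rho_real t t0) ltac:(lra).
have rho := theta_rho_real t t0; rewrite -/zeta in rho.
set X := Cmod (pmain zeta) in H1.
have X0 : 0 <= X := Cmod_ge_0 _.
have XB := Cmod_pmain_real t (proj1 t0); rewrite -/zeta -/X in XB.
set B := sqrt t * _ in XB *.
pose s := exp (- (t / 2)).
have s01 : 0 <= s < 1.
  by split; [left; exact: exp_pos | rewrite -exp_0; apply: exp_increasing; lra].
have ss : s * s = r by rewrite /s -exp_plus /r; congr exp; field.
have qs : Cmod q <= s * s by rewrite ss qt; lra.
have rs : Cmod r <= s * s by rewrite ss Cmod_R Rabs_pos_eq; lra.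
pose A := exp (/ (1 - s)) * exp (/ (1 - s) ^ 2) * / (1 - s) + 1 / (1 - r).
have A0 : 0 < A.
  have is0 : 0 < / (1 - s) by apply: Rinv_0_lt_compat; lra.
  have h := exp_pos (/ (1 - s)); have h' := exp_pos (/ (1 - s) ^ 2).
  apply: Rplus_lt_0_compat; first by repeat apply: Rmult_lt_0_compat => //.
  by apply: Rdiv_lt_0_compat; lra.
have [K2 H2] : exists K2, forall n, (K2 <= n)%N -> A * s ^ n <= 1 / 40.
  have eB : 0 < 1 / 40 / A by apply: Rdiv_lt_0_compat => //; lra.
  have s1 : Rabs s < 1 by rewrite Rabs_pos_eq; lra.
  have [N HN] := pow_lt_1_zero s s1 _ eB.
  exists N => n /leP hn; have := HN n hn; rewrite Rabs_pos_eq; last by apply: pow_le; lra.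
  move=> h; have := Rmult_le_compat_l A _ _ (Rlt_le _ _ A0) (Rlt_le _ _ h).
  by rewrite (_ : A * (1 / 40 / A) = 1 / 40) //; field; lra.
exists (maxn 1 (maxn K1 K2)) => K; rewrite !geq_max => /and3P[k0 k1 k2].
have h1 := H1 K k1; have h2 := H2 K k2.
rewrite nome_real -/r in h1; last lra.
have sK : 0 <= s ^ K by apply: pow_le; lra.
have is0 : 0 < / (1 - s) by apply: Rinv_0_lt_compat; lra.
have ir0 : 0 < / (1 - r) by apply: Rinv_0_lt_compat; lra.
have A1 : exp (/ (1 - s)) * exp (/ (1 - s) ^ 2) * / (1 - s) * s ^ K <= 1 / 40.
  by apply: Rle_trans h2; apply: Rmult_le_compat_r => //; rewrite /A; lra.
have A2 : 1 / (1 - r) * s ^ K <= 1 / 40.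
  apply: Rle_trans h2; apply: Rmult_le_compat_r => //; rewrite /A.
  have h := exp_pos (/ (1 - s)); have h' := exp_pos (/ (1 - s) ^ 2).
  have : 0 <= exp (/ (1 - s)) * exp (/ (1 - s) ^ 2) * / (1 - s) by repeat apply: Rmult_le_pos; lra.
  lra.
have i1 := Rle_trans _ _ _ (gf_qprod_inv q s K qs s01 k0) A1.
have i2 := Rle_trans _ _ _ (gf_qprod_inv r s K rs s01 k0) A1.
have q1 : Cmod q < 1 by rewrite qt.
have P := Cmod_qprod_ge q K q1.
have G := csum_gain q K q1.
rewrite !qt in P G.
set D := minor_gain q in G *.
set S := Re (csum K _) in P G.
have [c [Ec Hc]] := qprod_real r 0 K (conj (Rlt_le _ _ r0) r1).
rewrite Ec re_RtoC in P; rewrite Ec in i2.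
have c0 : 0 < c by apply: Rlt_le_trans Hc; exact: exp_pos.
set g := gf partition_number (RtoC r) K in h1 i2.
have gr : g = RtoC (Re g) by exact: gf_real.
have gB : Re g <= 14 / 10 * X.
  have := re_le_Cmod (g - pmain zeta); move/Rabs_le_between => [_].
  rewrite re_plus re_opp => h3.
  have := re_le_Cmod (pmain zeta); move/Rabs_le_between => [_]; rewrite -/X => h4.
  have : X * (3 * theta_rho zeta + 1 / 10) <= X * (4 / 10) by apply: Rmult_le_compat_l; lra.
  lra.
have cg : 39 / 40 <= c * Re g.
  move: i2; rewrite gr -RtoC_mult -RtoC_minus Cmod_R => /Rabs_le_between[? _]; rewrite re_RtoC; lra.
have Dexp : exp (D / 4) * (39 / 40) <= exp (S / 4).
  have : D / 4 - 1 / 40 <= S / 4.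
    have rk : r ^ K.+1 <= s ^ K.
      rewrite -ss Rpow_mult_distr -[X in _ <= X]Rmult_1_r.
      have a : s ^ K.+1 <= s ^ K by apply: pow_antitone; [lra | lia].
      have b : 0 <= s ^ K.+1 <= 1 by split; [apply: pow_le; lra | apply: pow_le1; lra].
      by apply: Rmult_le_compat; lra.
    have : r ^ K.+1 / (1 - r) <= 1 / 40.
      by apply: Rle_trans A2; rewrite /Rdiv Rmult_1_l Rmult_comm; apply: Rmult_le_compat_l; lra.
    by rewrite /Rdiv in G *; lra.
  move/exp_le_compat; apply: Rle_trans.
  rewrite /Rminus exp_plus; apply: Rmult_le_compat_l; first by left; exact: exp_pos.
  by apply: Rle_trans (exp_ge_1x _); lra.
have fin : Cmod (gf partition_number q K) * (c * exp (D / 4) * (39 / 40)) <= 41 / 40.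
  apply: Rle_trans (_ : Cmod (gf partition_number q K) * Cmod (qprod q 0 K) <= _).
    apply: Rmult_le_compat_l; first exact: Cmod_ge_0.
    apply: Rle_trans P; rewrite Rmult_assoc; apply: Rmult_le_compat_l; lra.
  rewrite -Cmod_mult Cmult_comm.
  have -> : (qprod q 0 K * gf partition_number q K = (qprod q 0 K * gf partition_number q K - 1) + 1)%C by ring.
  by apply: Rle_trans (Cmod_triangle _ _) _; rewrite Cmod_1; lra.
set y := Cmod (gf partition_number q K) in fin *.
have y0 : 0 <= y := Cmod_ge_0 _.
set e := exp (D / 4) in fin.
have e0 : 0 < e by exact: exp_pos.
rewrite exp_Ropp -/e.
apply: (Rmult_le_reg_r e) => //.
rewrite Rmult_assoc Rinv_l; last lra.
rewrite Rmult_1_r.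
have ye : 0 <= y * e by apply: Rmult_le_pos; lra.
have g0 : 0 < Re g by nra.
have f2 : y * e * (39 / 40) * (c * Re g) <= 41 / 40 * Re g by nra.
have f3 : y * e * (39 / 40) * (39 / 40) <= y * e * (39 / 40) * (c * Re g).
  by apply: Rmult_le_compat_l; lra.
lra.
Qed.

Lemma gf_minor (q : C) t M : 0 < t <= 1 / 20 -> Cmod q = exp (- t) ->
  Cmod (gf partition_number q M) <=
  2 * (sqrt t * exp (PI ^ 2 / (6 * t))) * exp (- (minor_gain q / 4))
  + exp (- (t / 2)) ^ M * exp (/ (1 - exp (- (t / 2))) ^ 2).
Proof.
move=> t0 qt.
have [K0 H] := gf_minor_limit q t t0 qt.
set s := exp (- (t / 2)).
have s01 : 0 <= s < 1.
  by split; [left; exact: exp_pos | rewrite -exp_0; apply: exp_increasing; lra].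
have qs : Cmod q <= s * s by rewrite qt /s -exp_plus; right; congr exp; field.
pose K := maxn K0 M.
have h1 := H K (leq_maxl _ _).
have h2 := gf_partition_tail q s M K qs s01 (leq_maxr _ _).
set a := gf _ _ K in h1 h2; set b := gf _ _ M in h2 *.
have -> : (b = a + - (a - b))%C by ring.
by apply: Rle_trans (Cmod_triangle _ _) _; rewrite Cmod_opp; lra.
Qed.

(** * Contour integral *)

Lemma sin_ge_cubic a : 0 <= a <= 1 -> a - a ^ 3 / 6 <= sin a.
Proof.
move=> [a0 a1]; have P := PI2_3_2.
have [H _] := SIN a a0 ltac:(lra).
apply: Rle_trans H.
rewrite /sin_lb /sin_approx /sin_term /=.
have a5 : 0 <= a * a * a * a * a by repeat apply: Rmult_le_pos => //.
have h : (a * a * a * a * a) * (a * a) <= (a * a * a * a * a) * 1 by apply: Rmult_le_compat_l; nra.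
field_simplify.
have -> : a ^ 7 = a * a * a * a * a * (a * a) by ring.
have -> : a ^ 5 = a * a * a * a * a by ring.
lra.
Qed.

(** With [w = r (1 - cos th)] the gain is [(1 + r) w / ((1 - r) |1 - q|^2)], where
    [|1 - q|^2 = (1 - r)^2 + 2 w]. Once [w] is at least a fixed multiple of [t^2 >= (1 - r)^2], what
    remains is of order [1 / (1 - r) >= 1 / t]. *)
Lemma minor_gain_ge t th : 0 < t <= 1 / 20 -> 0.49 * (t ^ 2 / 3) <= 1 - cos th ->
  0.2 / t <= minor_gain (cexp (- (t + Ci * th))).
Proof.
move=> t0 H.
have r1 : exp (- t) < 1 by rewrite -exp_0; apply: exp_increasing; lra.
have rt : 1 - t <= exp (- t) by have := exp_ge_1x (- t); lra.
have rp := exp_pos (- t).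
rewrite /minor_gain Cmod_cexp.
have -> : Re (- (t + Ci * th)) = - t by rewrite /Re /=; ring.
have -> : cexp (- (t + Ci * th)) = (exp (- t) * cos th, - (exp (- t) * sin th)).
  rewrite /cexp (_ : Re (- (t + Ci * th)) = - t); last by rewrite /Re /=; ring.
  rewrite (_ : Im (- (t + Ci * th)) = - th); last by rewrite /Im /=; ring.
  by rewrite cos_neg sin_neg; congr pair; ring.
set r := exp (- t) in r1 rt rp *; set c := cos th in H *; set s := sin th.
have cs : s * s = 1 - c * c by have := sin2_cos2 th; rewrite /Rsqr -/c -/s; lra.
have N : (1 - r * c) * (1 - r * c) + r * s * (r * s) = (1 - r) ^ 2 + 2 * (r * (1 - c)).
  have -> : r * s * (r * s) = r * r * (s * s) by ring.
  by rewrite cs; ring.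
set w := r * (1 - c) in N.
have w0 : 0.155 * t ^ 2 <= w.
  have : (1 - t) * (0.49 * (t ^ 2 / 3)) <= r * (1 - c).
    by apply: Rmult_le_compat => //; [lra | have := pow2_ge_0 t; lra].
  have : 0.95 * (0.49 * (t ^ 2 / 3)) <= (1 - t) * (0.49 * (t ^ 2 / 3)).
    by apply: Rmult_le_compat_r; [have := pow2_ge_0 t; lra | lra].
  by rewrite -/w; have := pow2_ge_0 t; lra.
have w1 : 0 < w by apply: Rlt_le_trans w0; have := pow_lt t 2 (proj1 t0); lra.
have D0 : 0 < (1 - r) ^ 2 + 2 * w by have := pow2_ge_0 (1 - r); lra.
have -> : Re (((r * c)%R, (- (r * s))%R) / (1 - ((r * c)%R, (- (r * s))%R)))%C = (r * c - r * r) / ((1 - r) ^ 2 + 2 * w).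
  rewrite -N /Re /=.
  have n0 : (1 - r * c) * (1 - r * c) + r * s * (r * s) <> 0 by rewrite N; lra.
  rewrite (_ : (1 + - (r * c)) * ((1 + - (r * c)) * 1) + (0 + - - (r * s)) * ((0 + - - (r * s)) * 1) =
     (1 - r * c) * (1 - r * c) + r * s * (r * s)); last by ring.
  field_simplify_eq => //.
  have -> : s ^ 2 = 1 - c * c by rewrite -cs; ring.
  ring.
have -> : r / (1 - r) - (r * c - r * r) / ((1 - r) ^ 2 + 2 * w) =
   (1 + r) * w / ((1 - r) * ((1 - r) ^ 2 + 2 * w)).
  have -> : r * c = r - w by rewrite /w; ring.
  by field; split; lra.
have e1 : 0 < 1 - r by lra.
apply: (Rmult_le_reg_r (t * ((1 - r) * ((1 - r) ^ 2 + 2 * w)))).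
  by repeat apply: Rmult_lt_0_compat => //; lra.
have -> : 0.2 / t * (t * ((1 - r) * ((1 - r) ^ 2 + 2 * w))) = (1 - r) * (0.2 * ((1 - r) ^ 2 + 2 * w)).
  by rewrite /Rdiv -Rmult_assoc (Rmult_assoc _ (/ t)) Rinv_l; [ring | lra].
have -> : (1 + r) * w / ((1 - r) * ((1 - r) ^ 2 + 2 * w)) * (t * ((1 - r) * ((1 - r) ^ 2 + 2 * w))) = t * ((1 + r) * w).
  by field; split; lra.
have q : 0.2 * ((1 - r) ^ 2 + 2 * w) <= (1 + r) * w.
  have : (1 - r) ^ 2 <= t ^ 2 by apply: pow_incr; lra.
  have : 0.95 * w <= r * w by apply: Rmult_le_compat_r; lra.
  lra.
by apply: Rmult_le_compat => //; [lra | have := pow2_ge_0 (1 - r); lra | lra].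
Qed.

(** The arc ends at height [t sin (PI / 6) = t / 2]. There the real part [t0 = t sqrt 3 / 2]
    satisfies [t0^2 / 3 = t^2 / 4], which links this bound to the hypothesis of [minor_gain_ge]. The
    constant [0.49] is the [1 / 2] of [1 - cos a ~ a^2 / 2] with some room. *)
Lemma one_minus_cos_ge t th : 0 < t <= 1 / 20 -> t / 2 <= th <= PI ->
  0.49 * (t ^ 2 / 4) <= 1 - cos th.
Proof.
move=> t0 [h1 h2]; have P := PI2_3_2.
have c1 : cos th <= cos (t / 2) by case: h1 => [h1|<-]; [left; apply: cos_decreasing_1; lra | lra].
have -> : t ^ 2 / 4 = (t / 2) ^ 2 by field.
set a := t / 2 in h1 c1 *.
have a0 : 0 < a <= 1 / 40 by rewrite /a; lra.
have E : cos a = 1 - 2 * sin (a / 2) * sin (a / 2) by rewrite -cos_2a_sin; congr cos; field.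
have S := sin_ge_cubic (a / 2) ltac:(lra).
have S' : 0.995 * (a / 2) <= sin (a / 2).
  have : (a / 2) ^ 3 <= (a / 2) * 0.01.
    rewrite (_ : (a / 2) ^ 3 = (a / 2) * (a / 2) ^ 2); last by ring.
    apply: Rmult_le_compat_l; [lra | nra].
  lra.
nra.
Qed.

Definition arc (t phi : R) : C := (t * cexp (Ci * phi))%C.

Lemma is_derive_cexp_comp (f : R -> C) (x : R) (l : C) :
  is_derive (V := CR) f x l -> is_derive (V := CR) (fun t => cexp (f t)) x (l * cexp (f x))%C.
Proof. by move=> H; apply: is_derive_cexp; [exact: is_derive_Re | exact: is_derive_Im]. Qed.

Lemma is_derive_arc t phi : is_derive (V := CR) (arc t) phi (Ci * arc t phi)%C.
Proof.
have h : is_derive (V := CR) (fun x : R => Ci * x)%C phi Ci.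
  by apply: is_derive_C; rewrite /Re /Im /=; auto_derive => //=; ring.
have := is_derive_Cmult _ _ _ _ _ (is_derive_Cconst t phi) (is_derive_cexp_comp _ _ _ h).
by congr (is_derive (V := CR)); rewrite /arc; Cring.
Qed.

Lemma continuous_arc t phi : continuous (U := CR) (arc t) phi.
Proof. exact: ex_derive_continuous_CR (is_derive_arc t phi). Qed.

(* Termwise, the integral of [exp (m tau)] along the arc followed by the vertical segment up to
   [t cos al + i PI] only sees the end points, where it is real. *)
Lemma contour_term t al (n k : nat) : let m := RtoC (INR n - INR k) in
  exists I1 I2 : C,
  is_RInt (V := CR) (fun phi => Ci * arc t phi * cexp (m * arc t phi))%C 0 al I1 /\
  is_RInt (V := CR) (fun th => Ci * cexp (m * ((t * cos al)%R + Ci * th)))%C (t * sin al) PI I2 /\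
  Im (I1 + I2) = if k == n then PI else 0.
Proof.
move=> m.
have Earc : arc t al = ((t * cos al)%R + Ci * (t * sin al)%R)%C.
  rewrite /arc /cexp (_ : Re (Ci * al) = 0); last by rewrite /Re /=; ring.
  rewrite (_ : Im (Ci * al) = al); last by rewrite /Im /=; ring.
  by rewrite exp_0; apply: C_ext => /=; ring.
have E0 : arc t 0 = t by rewrite /arc Cmult_0_r cexp_0; ring.
have D1 phi : is_derive (V := CR) (fun phi => cexp (m * arc t phi)) phi (m * (Ci * arc t phi * cexp (m * arc t phi)))%C.
  rewrite Cmult_assoc; apply: (is_derive_cexp_comp (fun phi => m * arc t phi)%C).
  have := is_derive_Cmult _ _ _ _ _ (is_derive_Cconst m phi) (is_derive_arc t phi).
  by congr (is_derive (V := CR)); Cring.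
have D2 th : is_derive (V := CR) (fun th : R => cexp (m * ((t * cos al)%R + Ci * th))) th (m * (Ci * cexp (m * ((t * cos al)%R + Ci * th))))%C.
  rewrite Cmult_assoc; apply: (is_derive_cexp_comp (fun th : R => m * ((t * cos al)%R + Ci * th))%C).
  by apply: is_derive_C; rewrite /Re /Im /=; auto_derive => //=; ring.
have C1 phi : continuous (U := CR) (fun phi => Ci * arc t phi * cexp (m * arc t phi))%C phi.
  apply: continuous_Cmult; last exact: ex_derive_continuous_CR (D1 phi).
  by apply: continuous_Cmult; [exact: continuous_const | exact: continuous_arc].
have C2 th : continuous (U := CR) (fun th : R => Ci * cexp (m * ((t * cos al)%R + Ci * th)))%C th.
  by apply: continuous_Cmult; [exact: continuous_const | exact: ex_derive_continuous_CR (D2 th)].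
case: eqP => [kn|kn].
  have m0 : m = 0 by rewrite /m kn Rminus_diag.
  exists (arc t al - arc t 0)%C, (Ci * PI - Ci * (t * sin al)%R)%C; split; last split.
  - apply: (is_RInt_derive (V := CR) (arc t)) => x _; last exact: C1.
    by rewrite m0 Cmult_0_l cexp_0 Cmult_1_r; exact: is_derive_arc.
  - apply: (is_RInt_derive (V := CR) (fun x : R => Ci * x)%C) => x _; last exact: C2.
    rewrite m0 Cmult_0_l cexp_0 Cmult_1_r.
    by apply: is_derive_C; rewrite /Re /Im /=; auto_derive => //=; ring.
  - by rewrite Earc E0 /Im /=; ring.
have m0 : m <> 0 by move=> /RtoC_inj h; apply: kn; apply: INR_eq; lra.
exists (/ m * (cexp (m * arc t al) - cexp (m * arc t 0)))%C,
  (/ m * (cexp (m * ((t * cos al)%R + Ci * PI)) - cexp (m * ((t * cos al)%R + Ci * (t * sin al)%R))))%C; split; last split.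
- have := is_RInt_Cmult_l _ _ _ (/ m)%C _ (is_RInt_derive (V := CR) _ (fun phi => m * (Ci * arc t phi * cexp (m * arc t phi)))%C 0 al
    (fun x _ => D1 x)
    (fun x _ => continuous_Cmult _ _ x (continuous_const (V := CR) m x) (C1 x))).
  by apply: is_RInt_ext => x _; rewrite Cmult_assoc Cinv_l // Cmult_1_l.
- have := is_RInt_Cmult_l _ _ _ (/ m)%C _ (is_RInt_derive (V := CR) _ (fun th : R => m * (Ci * cexp (m * ((t * cos al)%R + Ci * th))))%C (t * sin al) PI
    (fun x _ => D2 x)
    (fun x _ => continuous_Cmult _ _ x (continuous_const (V := CR) m x) (C2 x))).
  by apply: is_RInt_ext => x _; rewrite Cmult_assoc Cinv_l // Cmult_1_l.
rewrite Earc E0.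
set A := cexp (m * ((t * cos al)%R + Ci * (t * sin al)%R)).
have -> : (/ m * (A - cexp (m * t)) + / m * (cexp (m * ((t * cos al)%R + Ci * PI)) - A) =
   / m * (cexp (m * ((t * cos al)%R + Ci * PI)) - cexp (m * t)))%C by ring.
have -> : cexp (m * ((t * cos al)%R + Ci * PI)) = (exp ((INR n - INR k) * (t * cos al)) * ((-1) ^ n * (-1) ^ k))%R.
  rewrite Cmult_plus_distr_l cexp_add /m -RtoC_mult cexp_RtoC RtoC_mult; congr (_ * _)%C.
  have -> : (RtoC (INR n - INR k) * (Ci * PI) = Ci * (PI * INR n)%R + Ci * (PI * - INR k)%R)%C.
    by apply: C_ext; rewrite /Re /Im /=; ring.
  rewrite cexp_add; case: (cexp_PI_nat n) => -> _; case: (cexp_PI_nat k) => _ ->.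
  by rewrite RtoC_mult !RtoC_pow.
rewrite /m -RtoC_mult cexp_RtoC -RtoC_minus -RtoC_inv; last by move=> h; apply: m0; rewrite /m h.
by rewrite -RtoC_mult im_RtoC.
Qed.

(** Only the upper half of the contour is followed. By conjugation the lower half contributes the
    same imaginary part, so half of Cauchy's [2 PI p(n)] appears here. *)
Lemma contour t al (n M : nat) : (n < M)%N ->
  exists I1 I2 : C,
  is_RInt (V := CR) (fun phi => Ci * arc t phi * (gf partition_number (cexp (- arc t phi)) M * cexp (INR n * arc t phi)))%C 0 al I1 /\
  is_RInt (V := CR) (fun th => Ci * (gf partition_number (cexp (- ((t * cos al)%R + Ci * th))) M *
     cexp (INR n * ((t * cos al)%R + Ci * th))))%C (t * sin al) PI I2 /\
  Im (I1 + I2) = PI * INR (partition_number n).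
Proof.
move=> nM.
have E (tau : C) L : (gf partition_number (cexp (- tau)) L * cexp (INR n * tau) =
   csum L (fun k => INR (partition_number k) * cexp (RtoC (INR n - INR k) * tau)))%C.
  rewrite /gf -csum_mult_r; apply: csum_ext => k _.
  rewrite -cexp_pow -Cmult_assoc -cexp_add; congr (_ * cexp _)%C.
  rewrite RtoC_minus; ring.
have [I1 [I2 [H1 [H2 H3]]]] : exists I1 I2 : C,
  is_RInt (V := CR) (fun phi => Ci * arc t phi * csum M (fun k => INR (partition_number k) * cexp (RtoC (INR n - INR k) * arc t phi)))%C 0 al I1 /\
  is_RInt (V := CR) (fun th => Ci * csum M (fun k => INR (partition_number k) * cexp (RtoC (INR n - INR k) * ((t * cos al)%R + Ci * th))))%C (t * sin al) PI I2 /\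
  Im (I1 + I2) = if (n < M)%N then PI * INR (partition_number n) else 0.
  elim: M {nM} => [|M [J1 [J2 [H1 [H2 H3]]]]].
    have Z (a b : R) : is_RInt (V := CR) (fun => RtoC 0) a b (RtoC 0).
      have := is_RInt_const (V := CR) a b (RtoC 0).
      by rewrite scal_R_Cmult Cmult_0_r.
    exists (RtoC 0), (RtoC 0); split; last split.
    - by apply: is_RInt_ext (Z _ _) => x _ /=; rewrite Cmult_0_r.
    - by apply: is_RInt_ext (Z _ _) => x _ /=; rewrite Cmult_0_r.
    - by rewrite Cplus_0_l.
  have [K1 [K2 [G1 [G2 G3]]]] := contour_term t al n M.
  set c := RtoC (INR (partition_number M)).
  exists (J1 + c * K1)%C, (J2 + c * K2)%C; split; last split.
  - have := is_RInt_plus (V := CR) _ _ _ _ _ _ H1 (is_RInt_Cmult_l _ _ _ c _ G1).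
    apply: is_RInt_ext => x _; rewrite csumS -/c.
    set A := csum _ _; set B := cexp _.
    by rewrite -[LHS]/(Ci * arc t x * A + c * (Ci * arc t x * B))%C; Cring.
  - have := is_RInt_plus (V := CR) _ _ _ _ _ _ H2 (is_RInt_Cmult_l _ _ _ c _ G2).
    apply: is_RInt_ext => x _; rewrite csumS -/c.
    set A := csum _ _; set B := cexp _.
    by rewrite -[LHS]/(Ci * A + c * (Ci * B))%C; Cring.
  - have -> : (J1 + c * K1 + (J2 + c * K2) = (J1 + J2) + c * (K1 + K2))%C by ring.
    rewrite im_plus H3 im_scal_l G3.
    case: eqP => [->|ne]; first by rewrite ltnn ltnSn; ring.
    rewrite Rmult_0_r Rplus_0_r (_ : (n < M.+1)%N = (n < M)%N) //.
    by apply/idP/idP => h; lia.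
exists I1, I2; split; last split.
- by apply: is_RInt_ext H1 => x _; rewrite E.
- by apply: is_RInt_ext H2 => x _; rewrite E.
- by rewrite H3 nM.
Qed.

(** * Estimates on the arc and on the vertical part *)

Lemma sqrt3_bounds : 1.732 <= sqrt 3 <= 1.7321.
Proof.
split.
  by rewrite -(sqrt_Rsqr 1.732); [apply: sqrt_le_1; rewrite /Rsqr; lra | lra].
by rewrite -[X in _ <= X](sqrt_Rsqr 1.7321); [apply: sqrt_le_1; rewrite /Rsqr; lra | lra].
Qed.

Lemma Rabs_Im_le_Cmod (z : C) : Rabs (Im z) <= Cmod z.
Proof. by have := Rmax_Cmod z; have := Rmax_r (Rabs z.1) (Rabs z.2); rewrite /Im; lra. Qed.

Lemma cexp_Ci (x : R) : cexp (Ci * x) = (cos x, sin x).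
Proof.
rewrite /cexp (_ : Re (Ci * x) = 0); last by rewrite /Re /=; ring.
rewrite (_ : Im (Ci * x) = x); last by rewrite /Im /=; ring.
by rewrite exp_0 !Rmult_1_l.
Qed.

Lemma cos_arc_ge (phi : R) : 0 <= phi <= PI / 6 -> sqrt 3 / 2 <= cos phi <= 1.
Proof.
move=> [p0 p1]; have P := PI_RGT_0; split; last by case: (COS_bound phi).
by rewrite -cos_PI6; case: p1 => [p1|->]; [left; apply: cos_decreasing_1; lra | lra].
Qed.

Lemma sin_arc_le (phi : R) : 0 <= phi <= PI / 6 -> 0 <= sin phi <= 1 / 2.
Proof.
move=> [p0 p1]; have P := PI_RGT_0; split; first by apply: sin_ge_0; lra.
by rewrite -sin_PI6; case: p1 => [p1|->]; [left; apply: sin_increasing_1; lra | lra].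
Qed.

(** The phase [3 phi / 2] is [phi] from [d tau] plus [phi / 2] from the square root of [tau] in
    [pmain]. *)
Definition arc_main (t lam phi : R) : C :=
  (Ci * (t * (sqrt (3 * t / 2) / sqrt (3 * PI)) * exp (2 * lam * cos phi))%R * cexp (Ci * (3 * phi / 2)%R))%C.

(** The relative error is [3 theta_rho], here with [theta_rho = exp (- 8 lam cos phi) <= exp (-
    lam)], and the main term is at most [exp (2 lam)]; the product is the term [3 exp lam]. *)
Lemma arc_estimate (t lam phi : R) (n M : nat) : 0 < t <= 1 / 20 -> 10 <= lam ->
  t * (INR n - 1 / 24) = lam -> lam * t = PI ^ 2 / 6 -> 0 <= phi <= PI / 6 ->
  Cmod (Ci * arc t phi * (gf partition_number (cexp (- arc t phi)) M * cexp (INR n * arc t phi))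
    - arc_main t lam phi)%C <=
  3 * exp lam + exp (- (t / 4)) ^ M * (exp (/ (1 - exp (- (t / 4))) ^ 2) * exp (INR n * t)).
Proof.
move=> t0 l10 ty lt ph.
have P := PI_RGT_0; have P2 := PI2_3_2; have s3 := sqrt3_bounds.
have ph2 : 0 <= phi / 2 <= PI / 6 by lra.
have C0 := cos_arc_ge phi ph; have C1 := cos_arc_ge _ ph2; have S1 := sin_arc_le _ ph2.
set b := sqrt (3 * t / 2).
have b0 : 0 < b by apply: sqrt_lt_R0; lra.
have bb : b * b = 3 * t / 2 by apply: sqrt_sqrt; lra.
pose zeta := (b * cexp (Ci * (phi / 2)%R))%C.
have Ez : zeta = (b * cos (phi / 2), b * sin (phi / 2)).
  by rewrite /zeta cexp_Ci; apply: C_ext => /=; ring.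
have Hz : Rabs (Im zeta) < Re zeta.
  by rewrite Ez /= Rabs_pos_eq; nra.
set tau := arc t phi.
have zz : (zeta * zeta = (3 / 2)%R * tau)%C.
  rewrite /zeta /tau /arc.
  have -> : cexp (Ci * phi) = (cexp (Ci * (phi / 2)%R) * cexp (Ci * (phi / 2)%R))%C.
    by rewrite -cexp_add; congr cexp; apply: C_ext => /=; field.
  have -> : ((3 / 2)%R * (t * (cexp (Ci * (phi / 2)%R) * cexp (Ci * (phi / 2)%R))) =
    (3 * t / 2)%R * (cexp (Ci * (phi / 2)%R) * cexp (Ci * (phi / 2)%R)))%C.
    by rewrite (_ : 3 * t / 2 = 3 / 2 * t) ?RtoC_mult; [ring | field].
  by rewrite -bb RtoC_mult; ring.
have Nz : nome zeta = cexp (- tau).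
  rewrite /nome zz Cmult_assoc -RtoC_mult (_ : 2 / 3 * (3 / 2) = 1) ?Cmult_1_l //; field.
have tauE : tau = (t * cos phi, t * sin phi).
  by rewrite /tau /arc cexp_Ci; apply: C_ext => /=; ring.
have itau : (/ tau)%C = (cos phi / t, - (sin phi / t)).
  have cs := sin2_cos2 phi; rewrite /Rsqr in cs.
  have h : (tau * ((cos phi / t)%R, (- (sin phi / t))%R))%C = 1.
    rewrite tauE; apply: C_ext => /=; last by field; lra.
    have -> : t * cos phi * (cos phi / t) - t * sin phi * - (sin phi / t) =
      sin phi * sin phi + cos phi * cos phi by field; lra.
    exact: cs.
  have tn : tau <> 0 by move=> e; move: h; rewrite e Cmult_0_l => /RtoC_inj; lra.
  by rewrite -[LHS]Cmult_1_r -h Cmult_assoc Cinv_l // Cmult_1_l.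
have izz : (/ (zeta * zeta) = (2 / 3)%R * / tau)%C.
  rewrite zz.
  have tn : tau <> 0.
    move=> e; have : Re tau = 0 by rewrite e.
    by rewrite tauE /=; nra.
  have q : (RtoC (2 / 3) * RtoC (3 / 2))%C = 1 by rewrite -RtoC_mult; congr RtoC; field.
  have n32 : RtoC (3 / 2) <> 0 by move/RtoC_inj; lra.
  rewrite -[RHS]Cmult_1_l -(Cinv_l _ n32).
  have -> : (/ (3 / 2)%R * (3 / 2)%R * ((2 / 3)%R * / tau) = (RtoC (2 / 3) * RtoC (3 / 2)) * (/ (3 / 2)%R * / tau))%C by ring.
  by rewrite q; field.
have rhoE : theta_rho zeta = exp (- (8 * lam * cos phi)).
  rewrite /theta_rho izz re_scal_l itau /=; congr exp.
  have -> : 2 * PI ^ 2 * (2 / 3 * (cos phi / t)) = 8 * (PI ^ 2 / 6 / t) * cos phi by field; lra.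
  by rewrite -lt; field; lra.
have rho : theta_rho zeta <= exp (- lam) by rewrite rhoE; apply: exp_le_compat; nra.
have rho10 : theta_rho zeta <= 1 / 10.
  apply: Rle_trans rho _; apply: Rle_trans (exp_opp_le_inv lam _) _; first lra.
  by rewrite (_ : 1 / 10 = / 10); [apply: Rinv_le_contravar; lra | field].
set s := exp (- (t / 4)).
have s01 : 0 <= s < 1.
  by split; [left; exact: exp_pos | rewrite -exp_0; apply: exp_increasing; lra].
have qs : Cmod (nome zeta) <= s * s.
  rewrite Nz Cmod_cexp tauE /s -exp_plus; apply: exp_le_compat.
  by rewrite /Re /=; nra.
have G := gf_approx zeta s M Hz rho10 s01 qs.
rewrite Nz in G.
set a := b / sqrt (3 * PI).
have a0 : 0 <= a <= sqrt t.
  have s1 : 0 < sqrt (3 * PI) by apply: sqrt_lt_R0; lra.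
  split; first by apply: Rdiv_le_0_compat; lra.
  rewrite /a /b -sqrt_div; [| lra | lra].
  apply: sqrt_le_1; [apply: Rdiv_le_0_compat; lra | lra |].
  by apply: (Rmult_le_reg_r (3 * PI)); [lra | rewrite /Rdiv Rmult_assoc Rinv_l; nra].
have st1 : sqrt t <= 1 by rewrite -sqrt_1; apply: sqrt_le_1; lra.
have PE : (pmain zeta * cexp (INR n * tau) = (a * exp (2 * lam * cos phi))%R * cexp (Ci * (phi / 2)%R))%C.
  rewrite /pmain -Cmult_assoc -cexp_add.
  (* As [zeta^2 / 36 = tau / 24], the exponent is [y tau + PI^2 / (6 tau)]. The choice
     [y t = PI^2 / (6 t) = lam] makes the two terms complex conjugate. *)
  have -> : ((PI ^ 2 / 4)%R / (zeta * zeta) - (1 / 36)%R * (zeta * zeta) + INR n * tau = (2 * lam * cos phi)%R)%C.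
    rewrite /Cdiv izz itau zz tauE; apply: C_ext => /=.
      have -> : INR n = 1 / 24 + lam / t by rewrite -ty; field; lra.
      have e : PI ^ 2 = 6 * (lam * t) by rewrite lt; field.
      by rewrite -[PI * (PI * 1)]/(PI ^ 2) e; field; lra.
    have -> : INR n = 1 / 24 + lam / t by rewrite -ty; field; lra.
    have e : PI ^ 2 = 6 * (lam * t) by rewrite lt; field.
    by rewrite -[PI * (PI * 1)]/(PI ^ 2) e; field; lra.
  have s1 : 0 < sqrt (3 * PI) by apply: sqrt_lt_R0; lra.
  have sn : RtoC (sqrt (3 * PI)) <> 0 by move/RtoC_inj; lra.
  rewrite cexp_RtoC (RtoC_mult a) /a RtoC_div; last lra.
  by rewrite {1}/zeta; field.
have AM : arc_main t lam phi = (Ci * tau * (pmain zeta * cexp (INR n * tau)))%C.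
  rewrite PE /arc_main -/b -/a /tau /arc.
  have -> : cexp (Ci * (3 * phi / 2)%R) = (cexp (Ci * phi) * cexp (Ci * (phi / 2)%R))%C.
    by rewrite -cexp_add; congr cexp; apply: C_ext => /=; field.
  by rewrite (RtoC_mult (t * a)) (RtoC_mult t a) (RtoC_mult a); ring.
rewrite AM.
set g := gf _ _ _ in G *.
have -> : (Ci * tau * (g * cexp (INR n * tau)) - Ci * tau * (pmain zeta * cexp (INR n * tau)) =
   Ci * tau * ((g - pmain zeta) * cexp (INR n * tau)))%C by ring.
rewrite (Cmod_mult (Ci * tau)) (Cmod_mult Ci) Cmod_Ci Rmult_1_l (Cmod_mult (g - pmain zeta)).
have Tm : Cmod tau = t.
  rewrite /tau /arc Cmod_mult Cmod_R Rabs_pos_eq; last lra.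
  by rewrite Cmod_cexp (_ : Re (Ci * phi) = 0) ?exp_0 ?Rmult_1_r // /Re /=; ring.
have PM : Cmod (pmain zeta) * Cmod (cexp (INR n * tau)) <= exp (2 * lam).
  rewrite -Cmod_mult PE Cmod_mult Cmod_R Cmod_cexp.
  rewrite (_ : Re (Ci * (phi / 2)%R) = 0) ?exp_0 ?Rmult_1_r; last by rewrite /Re /=; ring.
  have e0 := exp_pos (2 * lam * cos phi).
  rewrite Rabs_pos_eq; last by apply: Rmult_le_pos; lra.
  rewrite -[X in _ <= X]Rmult_1_l; apply: Rmult_le_compat; try lra.
  by apply: exp_le_compat; nra.
have EN : Cmod (cexp (INR n * tau)) <= exp (INR n * t).
  rewrite Cmod_cexp re_scal_l tauE; apply: exp_le_compat => /=.
  by have := pos_INR n => h; apply: Rmult_le_compat_l => //; nra.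
have EN0 := Cmod_ge_0 (cexp (INR n * tau)).
rewrite Tm.
have sM : 0 <= s ^ M by apply: pow_le; lra.
have ee := exp_pos (/ (1 - s) ^ 2).
have U1 : Cmod (g - pmain zeta) * Cmod (cexp (INR n * tau)) <=
   3 * exp lam + s ^ M * (exp (/ (1 - s) ^ 2) * exp (INR n * t)).
  apply: Rle_trans (Rmult_le_compat_r _ _ _ EN0 G) _.
  rewrite Rmult_plus_distr_r; apply: Rplus_le_compat.
    have -> : Cmod (pmain zeta) * (3 * theta_rho zeta) * Cmod (cexp (INR n * tau)) =
       3 * (Cmod (pmain zeta) * Cmod (cexp (INR n * tau)) * theta_rho zeta) by ring.
    apply: Rmult_le_compat_l; first lra.
    have -> : exp lam = exp (2 * lam) * exp (- lam) by rewrite -exp_plus; congr exp; ring.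
    apply: Rmult_le_compat => //; last by left; exact: exp_pos.
    by apply: Rmult_le_pos; exact: Cmod_ge_0.
  rewrite Rmult_assoc; apply: Rmult_le_compat_l => //.
  by apply: Rmult_le_compat_l; lra.
apply: Rle_trans (Rmult_le_compat_l t _ _ ltac:(lra) U1) _.
have e1 := exp_pos lam; have e2 := exp_pos (INR n * t).
have : 0 <= s ^ M * (exp (/ (1 - s) ^ 2) * exp (INR n * t)) by repeat apply: Rmult_le_pos; lra.
set Y := s ^ M * _ => Y0.
nra.
Qed.

(** Per unit of [lam] the exponents are [2 / sqrt 3] from the generating function at [|q|] and
    [sqrt 3 / 2] from [exp (n tau)], about [2.0208] in all. The gain from the argument of [q] must
    push this below [2]. *)
Lemma line_estimate (t lam th : R) (n M : nat) : 0 < t <= 1 / 20 -> 10 <= lam ->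
  t * (INR n - 1 / 24) = lam -> lam * t = PI ^ 2 / 6 -> t * (1 / 2) <= th <= PI ->
  let t0 := t * (sqrt 3 / 2) in
  Cmod (Ci * (gf partition_number (cexp (- (t0 + Ci * th))) M * cexp (INR n * (t0 + Ci * th))))%C <=
  6 * exp ((2 - 1 / 2000) * lam)
  + exp (- (t0 / 2)) ^ M * (exp (/ (1 - exp (- (t0 / 2))) ^ 2) * exp (INR n * t0)).
Proof.
move=> tb l10 ty lt hth t0.
have P := PI_RGT_0; have P2 := PI2_3_2; have P4 := PI_4; have s3 := sqrt3_bounds.
have t00 : 0 < t0 <= 1 / 20 by rewrite /t0; nra.
have t0t : t0 ^ 2 / 3 = t ^ 2 / 4.
  have -> : t0 ^ 2 / 3 = t ^ 2 * (sqrt 3 * sqrt 3) / 12 by rewrite /t0; field.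
  by rewrite sqrt_sqrt; [field | lra].
set q := cexp (- (t0 + Ci * th)).
have qm : Cmod q = exp (- t0) by rewrite Cmod_cexp; congr exp; rewrite /Re /=; ring.
have Hc : 0.49 * (t0 ^ 2 / 3) <= 1 - cos th.
  by rewrite t0t; apply: one_minus_cos_ge; lra.
have D := minor_gain_ge t0 th t00 Hc; rewrite -/q in D.
have G := gf_minor q t0 M t00 qm.
rewrite !Cmod_mult Cmod_Ci Rmult_1_l.
have -> : Cmod (cexp (INR n * (t0 + Ci * th))) = exp (INR n * t0).
  by rewrite Cmod_cexp; congr exp; rewrite re_scal_l /Re /=; ring.
have e0 := exp_pos (INR n * t0).
apply: Rle_trans (Rmult_le_compat_r _ _ _ (Rlt_le _ _ e0) G) _.
rewrite Rmult_plus_distr_r (Rmult_assoc (_ ^ M)); apply: Rplus_le_compat_r.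
have st1 : 0 <= sqrt t0 <= 1.
  by split; [exact: sqrt_pos | rewrite -sqrt_1; apply: sqrt_le_1; lra].
have e3 : exp 1 <= 3 by exact: exp_le_3.
apply: Rle_trans (_ : 2 * (exp (PI ^ 2 / (6 * t0)) * exp (- (minor_gain q / 4)) * exp (INR n * t0)) <= _).
  have : 0 <= exp (PI ^ 2 / (6 * t0)) * exp (- (minor_gain q / 4)) * exp (INR n * t0).
    by repeat apply: Rmult_le_pos; left; exact: exp_pos.
  set Y := exp (PI ^ 2 / _) * _ * _ => Y0.
  have -> : 2 * (sqrt t0 * exp (PI ^ 2 / (6 * t0))) * exp (- (minor_gain q / 4)) * exp (INR n * t0) = 2 * (sqrt t0 * Y).
    by rewrite /Y; ring.
  nra.
rewrite -!exp_plus.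
(* The factor [exp 1 <= 3] absorbs the [t0 / 24] left over from [n = y + 1 / 24]. *)
apply: Rle_trans (_ : 2 * (exp 1 * exp ((2 - 1 / 2000) * lam)) <= _); last first.
  by have := exp_pos ((2 - 1 / 2000) * lam); nra.
apply: Rmult_le_compat_l; first lra.
rewrite -exp_plus; apply: exp_le_compat.
have N1 : INR n * t0 = lam * (sqrt 3 / 2) + t0 / 24.
  have -> : INR n = 1 / 24 + lam / t by rewrite -ty; field; lra.
  by rewrite /t0; field; lra.
have N2 : PI ^ 2 / (6 * t0) = lam * (2 / sqrt 3).
  rewrite /t0 (_ : PI ^ 2 = 6 * (lam * t)); [field; lra | rewrite lt; field].
(* [0.05 / t0] equals [0.6 lam / (sqrt 3 PI^2)], and even the crude [PI <= 4] leaves [0.0216 lam];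
   this suffices, since [1.15474 + 0.86605 - 0.0216 < 2 - 1 / 2000]. *)
have N3 : lam * 0.0216 <= minor_gain q / 4.
  have : 0.05 / t0 <= minor_gain q / 4.
    have -> : 0.05 = 0.2 / 4 by lra.
    have -> : 0.2 / 4 / t0 = 0.2 / t0 / 4 by set u := 0.2; rewrite /Rdiv; ring.
    lra.
  apply: Rle_trans.
  apply: (Rmult_le_reg_r t0); first lra.
  have can (u : R) : u / t0 * t0 = u by field; lra.
  rewrite can (_ : lam * 0.0216 * t0 = 0.0216 * (sqrt 3 / 2) * (lam * t)); last by rewrite /t0 /Rdiv; ring.
  rewrite lt; have : PI ^ 2 <= 16 by nra.
  have : 0 <= PI ^ 2 by nra.
  nra.
have N4 : 2 / sqrt 3 <= 1.15474.
  by apply: (Rmult_le_reg_r (sqrt 3)); [lra | rewrite /Rdiv Rmult_assoc Rinv_l; lra].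
have N5 : lam * (2 / sqrt 3) <= lam * 1.15474 by apply: Rmult_le_compat_l; lra.
have N6 : lam * (sqrt 3 / 2) <= lam * 0.86605 by apply: Rmult_le_compat_l; lra.
lra.
Qed.

(** * The main integral on the arc *)

Definition arc_prim (lam phi : R) : R :=
  exp (2 * lam) * ((1 - / (2 * lam)) * (gauss (2 * sqrt lam * sin (phi / 2)) / sqrt lam)
    + sin (phi / 2) / lam * exp (- (4 * lam * sin (phi / 2) ^ 2))).

(** In [v = sin (phi / 2)] the integrand becomes [2 (1 - 4 v^2) exp (2 lam - 4 lam v^2)].
    Integrating the [4 v^2] part by parts yields the factor [1 - 1 / (2 lam)], the later
    [1 - 1 / X], and the boundary term of [arc_prim]. *)
Lemma is_derive_arc_prim (lam phi : R) : 0 < lam ->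
  is_derive (arc_prim lam) phi (cos (3 * phi / 2) * exp (2 * lam * cos phi)).
Proof.
move=> l0; have s0 : 0 < sqrt lam by exact: sqrt_lt_R0.
have ss := sqrt_sqrt lam (Rlt_le _ _ l0).
have D1 : is_derive (fun x => gauss (2 * sqrt lam * sin (x / 2))) phi
   (sqrt lam * cos (phi / 2) * exp (- (4 * lam * sin (phi / 2) ^ 2))).
  have h : is_derive (fun x => 2 * sqrt lam * sin (x / 2)) phi (sqrt lam * cos (phi / 2)).
    by auto_derive => //; rewrite -/(phi / 2); Rfield.
  have := is_derive_comp gauss _ phi _ _ (is_derive_gauss _) h.
  rewrite /scal /= /mult /=; congr is_derive; congr (_ * exp (- _)).
  by rewrite -[in RHS]ss; ring.
have D2 : is_derive (fun x => sin (x / 2) / lam * exp (- (4 * lam * sin (x / 2) ^ 2))) phi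
   (cos (phi / 2) * (1 / (2 * lam) - 4 * sin (phi / 2) ^ 2) * exp (- (4 * lam * sin (phi / 2) ^ 2))).
  auto_derive => //; rewrite -/(phi / 2) /=.
  by Rfield; lra.
have D3 := is_derive_scal _ phi (exp (2 * lam)) _ (is_derive_plus _ _ _ _ _
   (is_derive_scal _ phi ((1 - / (2 * lam)) / sqrt lam) _ D1) D2).
have E : cos (3 * phi / 2) * exp (2 * lam * cos phi) =
   exp (2 * lam) * ((1 - / (2 * lam)) / sqrt lam * (sqrt lam * cos (phi / 2) * exp (- (4 * lam * sin (phi / 2) ^ 2)))
     + cos (phi / 2) * (1 / (2 * lam) - 4 * sin (phi / 2) ^ 2) * exp (- (4 * lam * sin (phi / 2) ^ 2))).
  set c := cos (phi / 2); set s := sin (phi / 2).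
  have cs : c * c = 1 - s * s by have := sin2_cos2 (phi / 2); rewrite /Rsqr -/c -/s; lra.
  have -> : cos phi = 1 - 2 * s ^ 2.
    by rewrite (_ : phi = 2 * (phi / 2)); [rewrite cos_2a_sin -/s; ring | field].
  have -> : cos (3 * phi / 2) = c * (1 - 4 * s ^ 2).
    rewrite (_ : 3 * phi / 2 = 2 * (phi / 2) + phi / 2); last by field.
    rewrite cos_plus cos_2a sin_2a -/c -/s.
    rewrite (_ : (c * c - s * s) * c - 2 * s * c * s = c * (c * c - 3 * s ^ 2)); last ring.
    by rewrite cs; ring.
  have -> : exp (2 * lam * (1 - 2 * s ^ 2)) = exp (2 * lam) * exp (- (4 * lam * s ^ 2)).
    by rewrite -exp_plus; congr exp; ring.
  by field; lra.
rewrite E; apply: is_derive_ext D3 => x.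
rewrite /arc_prim /plus /=; congr (_ * (_ + _)).
by rewrite /Rdiv; ring.
Qed.

Lemma arc_prim_0 (lam : R) : arc_prim lam 0 = 0.
Proof.
by rewrite /arc_prim (_ : 0 / 2 = 0) ?sin_0 ?Rmult_0_r ?gauss_0 /Rdiv; ring.
Qed.

(** At the end of the arc [4 v^2 = 2 - sqrt 3 >= 1 / 4], so completing the Gaussian integral costs
    only a relative [exp (- lam / 4)]. *)
Lemma arc_prim_end (lam : R) : 1 <= lam ->
  Rabs (arc_prim lam (PI / 6) - exp (2 * lam) * ((1 - / (2 * lam)) * (sqrt PI / 2 / sqrt lam))) <=
  3 * exp ((2 - 1 / 4) * lam).
Proof.
move=> l1; have P := PI_RGT_0; have s3 := sqrt3_bounds.
set v := sin (PI / 6 / 2).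
have v0 : 0 <= v <= 1.
  split; first by apply: sin_ge_0; lra.
  by case: (SIN_bound (PI / 6 / 2)).
have v2 : 1 / 4 <= 4 * v ^ 2.
  have : cos (PI / 6) = 1 - 2 * v * v.
    by rewrite (_ : PI / 6 = 2 * (PI / 6 / 2)); [rewrite cos_2a_sin | field].
  by rewrite cos_PI6; lra.
have sl : 1 <= sqrt lam by rewrite -sqrt_1; apply: sqrt_le_1; lra.
have ss := sqrt_sqrt lam ltac:(lra).
have z0 : 0 <= 2 * sqrt lam * v by nra.
have [g0 g1] := gauss_bound _ z0.
have E : 2 * sqrt lam * v * (2 * sqrt lam * v) = 4 * lam * v ^ 2.
  by rewrite -[in RHS]ss; ring.
rewrite E in g1; rewrite /arc_prim -/v.
set e := exp (- (4 * lam * v ^ 2)) in g1 *.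
have e0 : 0 < e by exact: exp_pos.
have e1 : exp (2 * lam) * e <= exp ((2 - 1 / 4) * lam).
  by rewrite -exp_plus; apply: exp_le_compat; nra.
set G := gauss _ in g0 g1 *.
have -> : exp (2 * lam) * ((1 - / (2 * lam)) * (G / sqrt lam) + v / lam * e) -
   exp (2 * lam) * ((1 - / (2 * lam)) * (sqrt PI / 2 / sqrt lam)) =
   exp (2 * lam) * (v / lam * e - (1 - / (2 * lam)) * / sqrt lam * (sqrt PI / 2 - G)) by rewrite /Rdiv; ring.
have ep := exp_pos (2 * lam).
rewrite Rabs_mult (Rabs_pos_eq (exp _)); last lra.
apply: Rle_trans (_ : exp (2 * lam) * (3 * e) <= _); last by lra.
apply: Rmult_le_compat_l; first lra.
have il : 0 < / sqrt lam <= 1.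
  by split; [apply: Rinv_0_lt_compat; lra | rewrite -[X in _ <= X]Rinv_1; apply: Rinv_le_contravar; lra].
have il2 : 0 < / (2 * lam) <= 1.
  by split; [apply: Rinv_0_lt_compat; lra | rewrite -[X in _ <= X]Rinv_1; apply: Rinv_le_contravar; lra].
have vl : 0 <= v / lam <= 1.
  split; first by apply: Rdiv_le_0_compat; lra.
  by apply: (Rmult_le_reg_r lam); [lra | rewrite /Rdiv Rmult_assoc Rinv_l; lra].
have k : 0 <= (1 - / (2 * lam)) * / sqrt lam <= 1 by nra.
have a1 : 0 <= v / lam * e <= e by nra.
have a2 : 0 <= (1 - / (2 * lam)) * / sqrt lam * (sqrt PI / 2 - G) <= 2 * e by nra.
by apply: Rabs_le; lra.
Qed.

(** Removes the truncation order: [p(n)] and its approximation do not involve [M], while the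
    estimates hold for every [M > n]. *)
Lemma pow_tail_le (A B C s : R) (n0 : nat) : 0 <= s < 1 -> 0 <= C ->
  (forall M, (n0 < M)%N -> A <= B + C * s ^ M) -> A <= B.
Proof.
move=> s01 C0 H; apply: le_epsilon => eps e0.
have s1 : Rabs s < 1 by rewrite Rabs_pos_eq; lra.
have d0 : 0 < eps / (C + 1) by apply: Rdiv_lt_0_compat; lra.
have [N HN] := pow_lt_1_zero s s1 _ d0.
have := H (maxn N n0.+1) (leq_maxr _ _).
have := HN (maxn N n0.+1) ltac:(apply/leP; exact: leq_maxl).
rewrite Rabs_pos_eq; last by apply: pow_le; lra.
set u := s ^ _ => h1 h2.
have u0 : 0 <= u by apply: pow_le; lra.
have : C * u <= C * (eps / (C + 1)) by apply: Rmult_le_compat_l; lra.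
have : C * (eps / (C + 1)) <= eps.
  have -> : C * (eps / (C + 1)) = eps - eps / (C + 1) by field; lra.
  lra.
lra.
Qed.

Lemma partition_arc (t lam : R) (n : nat) : 0 < t <= 1 / 20 -> 10 <= lam ->
  t * (INR n - 1 / 24) = lam -> lam * t = PI ^ 2 / 6 ->
  Rabs (PI * INR (partition_number n) - t * (sqrt (3 * t / 2) / sqrt (3 * PI)) * arc_prim lam (PI / 6)) <=
  30 * exp ((2 - 1 / 2000) * lam).
Proof.
move=> tb l10 ty lt.
have P := PI_RGT_0; have P4 := PI_4; have s3 := sqrt3_bounds.
set a := sqrt _ / sqrt _.
set t0 := t * (sqrt 3 / 2).
have t00 : 0 < t0 by rewrite /t0; nra.
pose s := Rmax (exp (- (t / 4))) (exp (- (t0 / 2))).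
have el1 (x : R) : 0 < x -> 0 < exp (- x) < 1.
  by split; [exact: exp_pos | rewrite -exp_0; apply: exp_increasing; lra].
have b1 := el1 (t / 4) ltac:(lra); have b2 := el1 (t0 / 2) ltac:(lra).
have s01 : 0 <= s < 1.
  rewrite /s; split; first by apply: Rle_trans (Rmax_l _ _); lra.
  by apply: Rmax_lub_lt; lra.
pose C1 := exp (/ (1 - exp (- (t / 4))) ^ 2) * exp (INR n * t).
pose C2 := exp (/ (1 - exp (- (t0 / 2))) ^ 2) * exp (INR n * t0).
have C10 : 0 < C1 by apply: Rmult_lt_0_compat; exact: exp_pos.
have C20 : 0 < C2 by apply: Rmult_lt_0_compat; exact: exp_pos.
(* The arc integral runs over an interval of length at most [1] and the vertical one over length at
   most [4]; the same lengths give [3 + 4 * 6 <= 30]. *)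
apply: (pow_tail_le _ _ (C1 + 4 * C2) s n s01); first lra.
move=> M nM.
have [I1 [I2 [H1 [H2 H3]]]] := contour t (PI / 6) n M nM.
rewrite cos_PI6 -/t0 sin_PI6 in H2.
have R1 := is_RInt_fct_extend_snd (U := R_NormedModule) (V := R_NormedModule) _ _ _ _ H1.
have R2 : is_RInt (fun phi => t * a * (cos (3 * phi / 2) * exp (2 * lam * cos phi))) 0 (PI / 6)
   (t * a * (arc_prim lam (PI / 6) - arc_prim lam 0)).
  apply: (is_RInt_scal (fun phi => cos (3 * phi / 2) * exp (2 * lam * cos phi)) 0 (PI / 6) (t * a)).
  apply: (is_RInt_derive (arc_prim lam)) => x _; first by apply: is_derive_arc_prim; lra.
  by apply: ex_derive_continuous; auto_derive.
rewrite arc_prim_0 Rminus_0_r in R2.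
have sM1 : exp (- (t / 4)) ^ M <= s ^ M by apply: pow_incr; split; [lra | exact: Rmax_l].
have sM2 : exp (- (t0 / 2)) ^ M <= s ^ M by apply: pow_incr; split; [lra | exact: Rmax_r].
have sM0 : 0 <= s ^ M by apply: pow_le; lra.
have L1 : Rabs (Im I1 - t * a * arc_prim lam (PI / 6)) <= (PI / 6 - 0) * (3 * exp lam + s ^ M * C1).
  have ab : 0 <= PI / 6 by lra.
  apply: (is_RInt_bound _ _ _ _ _ ab (is_RInt_minus _ _ _ _ _ _ R1 R2)) => phi Hphi.
  have A := arc_estimate t lam phi n M tb l10 ty lt Hphi.
  have EI : Im (arc_main t lam phi) = t * a * (cos (3 * phi / 2) * exp (2 * lam * cos phi)).
    rewrite /arc_main -/a cexp_Ci /Im /=; ring.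
  set z := (Ci * arc t phi * _)%C in A *.
  rewrite -[minus _ _]/(Im z - t * a * (cos (3 * phi / 2) * exp (2 * lam * cos phi))) -EI.
  have -> : Im z - Im (arc_main t lam phi) = Im (z - arc_main t lam phi)%C by rewrite im_plus im_opp.
  apply: Rle_trans (Rabs_Im_le_Cmod _) _; apply: Rle_trans A _.
  by apply: Rplus_le_compat_l; rewrite -/C1; apply: Rmult_le_compat_r; lra.
have L2 : Cmod I2 <= (PI - t * (1 / 2)) * (6 * exp ((2 - 1 / 2000) * lam) + s ^ M * C2).
  have ab : t * (1 / 2) <= PI by have := PI2_3_2; lra.
  apply: (is_RInt_C_bound _ _ _ _ _ ab H2) => th Hth.
  apply: Rle_trans (line_estimate t lam th n M tb l10 ty lt Hth) _.
  by apply: Rplus_le_compat_l; rewrite -/t0 -/C2; apply: Rmult_le_compat_r; lra.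
rewrite -H3 im_plus.
have -> : Im I1 + Im I2 - t * a * arc_prim lam (PI / 6) = (Im I1 - t * a * arc_prim lam (PI / 6)) + Im I2 by ring.
apply: Rle_trans (Rabs_triang _ _) _.
have L3 := Rle_trans _ _ _ (Rabs_Im_le_Cmod I2) L2.
have e1 : exp lam <= exp ((2 - 1 / 2000) * lam) by apply: exp_le_compat; lra.
have e0 := exp_pos lam; have e2 := exp_pos ((2 - 1 / 2000) * lam).
set Y := exp ((2 - 1 / 2000) * lam) in L3 e1 e2 *.
have m1 : 0 <= s ^ M * C1 by apply: Rmult_le_pos; lra.
have m2 : 0 <= s ^ M * C2 by apply: Rmult_le_pos; lra.
have q1 : (PI / 6 - 0) * (3 * exp lam + s ^ M * C1) <= 1 * (3 * exp lam + s ^ M * C1).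
  by apply: Rmult_le_compat_r; lra.
have q2 : (PI - t * (1 / 2)) * (6 * Y + s ^ M * C2) <= 4 * (6 * Y + s ^ M * C2).
  by apply: Rmult_le_compat_r; lra.
have -> : (C1 + 4 * C2) * s ^ M = s ^ M * C1 + 4 * (s ^ M * C2) by ring.
lra.
Qed.

Lemma sqrt_eq (v w : R) : 0 <= v -> v * v = w -> sqrt w = v.
Proof. by move=> v0 <-; exact: sqrt_square. Qed.

(** The closed form is the exponentially growing half of the first term of Rademacher's series. The
    rate [1 - 1 / 4000] is [2 - 1 / 2000] rewritten for [X = 2 lam]. *)
Theorem hardy_ramanujan : exists n0 : nat, forall n, (n0 <= n)%N ->
  let y := INR n - 1 / 24 in let X := PI * sqrt (2 * y / 3) in
  Rabs (INR (partition_number n) - exp X / (4 * sqrt 3 * y) * (1 - / X)) <= 33 * exp ((1 - 1 / 4000) * X).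
Proof.
(* [n >= 1200] ensures [y >= 1100], and then [6 * 1100 >= 80^2] with [PI <= 4] gives
   [t = PI / u <= 1 / 20]. *)
have [n0 Hn0] := INR_unbounded 1200.
exists n0 => n hn y X.
have P := PI_RGT_0; have P4 := PI_4; have P2 := PI2_3_2; have s3 := sqrt3_bounds.
have y1 : 1100 <= y.
  have : INR n0 <= INR n by apply: le_INR; apply/leP.
  by rewrite /y; lra.
set u := sqrt (6 * y).
have uu : u * u = 6 * y by apply: sqrt_sqrt; lra.
have u80 : 80 <= u.
  rewrite -(sqrt_Rsqr 80); last lra.
  by apply: sqrt_le_1; rewrite /Rsqr; lra.
pose t := PI / u; pose lam := PI * u / 6.
have XE : X = 2 * lam.
  rewrite /X /lam (_ : sqrt (2 * y / 3) = u / 3); first by field.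
  apply: sqrt_eq; first lra.
  have -> : u / 3 * (u / 3) = u * u / 9 by field.
  by rewrite uu; field.
have tu : t * u = PI by rewrite /t; field; lra.
have tb : 0 < t <= 1 / 20.
  split; first by apply: Rdiv_lt_0_compat; lra.
  by apply: (Rmult_le_reg_r u); [lra | rewrite tu; lra].
have l10 : 10 <= lam by rewrite /lam; nra.
have yE : y = u * u / 6 by rewrite uu; field.
have ty : t * (INR n - 1 / 24) = lam.
  by rewrite -/y yE /lam /t; field; lra.
have lt : lam * t = PI ^ 2 / 6 by rewrite /lam /t; field; lra.
have M := partition_arc t lam n tb l10 ty lt.
set a := sqrt _ / sqrt _ in M.
have sp0 : 0 < sqrt (3 * PI) by apply: sqrt_lt_R0; lra.
have aE : a = sqrt (t / (2 * PI)).
  rewrite /a -sqrt_div; [| lra | lra].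
  by congr sqrt; field; lra.
have a0 : 0 <= a <= 1.
  rewrite aE; split; first exact: sqrt_pos.
  rewrite -sqrt_1; apply: sqrt_le_1; [apply: Rdiv_le_0_compat; lra | lra |].
  by apply: (Rmult_le_reg_r (2 * PI)); [lra | rewrite /Rdiv Rmult_assoc Rinv_l; lra].
have E := arc_prim_end lam ltac:(lra).
set H := arc_prim _ _ in M E.
set H0 := exp (2 * lam) * _ in E.
have main : t * a * H0 = PI * (exp X / (4 * sqrt 3 * y) * (1 - / X)).
  have sl : 0 < sqrt lam by apply: sqrt_lt_R0; lra.
  have s2 : a * (sqrt PI / 2 / sqrt lam) = sqrt 3 / (2 * u).
    have -> : a * (sqrt PI / 2 / sqrt lam) = sqrt (t / (2 * PI) * PI / lam) / 2.
      rewrite (sqrt_div (t / (2 * PI) * PI)); first last.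
      - lra.
      - by apply: Rmult_le_pos; [apply: Rdiv_le_0_compat; lra | lra].
      rewrite sqrt_mult; [| apply: Rdiv_le_0_compat; lra | lra].
      by rewrite -aE; field; lra.
    have -> : sqrt (t / (2 * PI) * PI / lam) = sqrt 3 / u; last by field; lra.
    apply: sqrt_eq; first by apply: Rdiv_le_0_compat; lra.
    have -> : sqrt 3 / u * (sqrt 3 / u) = (sqrt 3 * sqrt 3) / (u * u) by field; lra.
    rewrite sqrt_sqrt; last lra.
    by rewrite /t /lam; field; lra.
  rewrite /H0 XE.
  have -> : t * a * (exp (2 * lam) * ((1 - / (2 * lam)) * (sqrt PI / 2 / sqrt lam))) =
     t * exp (2 * lam) * (1 - / (2 * lam)) * (a * (sqrt PI / 2 / sqrt lam)) by ring.
  rewrite s2 yE.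
  have -> : sqrt 3 / (2 * u) = 3 / (2 * sqrt 3 * u).
    have := sqrt_sqrt 3 ltac:(lra) => e.
    by rewrite -{2}e; field; lra.
  by rewrite /t; field; lra.
have e1 : (2 - 1 / 2000) * lam = (1 - 1 / 4000) * X by rewrite XE; field.
have e2 : exp ((2 - 1 / 4) * lam) <= exp ((1 - 1 / 4000) * X) by apply: exp_le_compat; rewrite XE; lra.
rewrite e1 in M.
set Y := exp ((1 - 1 / 4000) * X) in M e2 *.
set Q := exp X / _ * _ in main *.
have Y0 : 0 < Y by exact: exp_pos.
have F : Rabs (PI * INR (partition_number n) - PI * Q) <= 33 * Y.
  rewrite -main.
  have -> : PI * INR (partition_number n) - t * a * H0 =
    (PI * INR (partition_number n) - t * a * H) + t * a * (H - H0) by ring.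
  apply: Rle_trans (Rabs_triang _ _) _.
  have : Rabs (t * a * (H - H0)) <= 3 * Y.
    rewrite Rabs_mult (Rabs_pos_eq (t * a)); last by apply: Rmult_le_pos; lra.
    have : t * a <= 1 by nra.
    have := Rabs_pos (H - H0); have : 0 <= t * a by apply: Rmult_le_pos; lra.
    nra.
  lra.
rewrite -Rmult_minus_distr_l Rabs_mult (Rabs_pos_eq PI) in F; last lra.
have := Rabs_pos (INR (partition_number n) - Q); nra.
Qed.

(** * Expansion in powers of the inverse square root *)

(** For [m + 2 k = r + 1], [bcoef m k] is the product of the binomial coefficient and the numerator
    [r + 1 - k] in [omega r]. The series of [acoef m] is [c^m / sqrt (1 - 4 w)] with [c] the Catalan
    series; it is needed because the recurrence for [bcoef] involves it. *)
Definition acoef (m k : nat) : R := INR 'C(m + 2 * k, k).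
Definition bcoef (m k : nat) : R := INR 'C(m + 2 * k, k) * INR (m + k).

Lemma bin_le_expn n k : ('C(n, k) <= 2 ^ n)%N.
Proof.
elim: n k => [|n IH] [|k]; rewrite ?bin0 ?bin0n ?expn_gt0 //.
by rewrite binS expnS mul2n -addnn leq_add.
Qed.

(** Both factors are at most [2^(m + 2 k)], whose square is [4^m 16^k]. This is crude, but for
    [w <= 1 / 96] it leaves the convergent ratio [16 / 96 = 1 / 6]. *)
Lemma bcoef_bound m k : 0 <= acoef m k <= 4 ^ m * 16 ^ k /\ 0 <= bcoef m k <= 4 ^ m * 16 ^ k.
Proof.
have E : INR (2 ^ (m + 2 * k) * 2 ^ (m + 2 * k))%N = 4 ^ m * 16 ^ k.
  have p2 j : INR (2 ^ j)%N = 2 ^ j.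
    elim: j => [|j IH]; first by rewrite expn0.
    by rewrite expnS mult_INR IH.
  rewrite mult_INR !p2 pow_add pow_mult.
  have -> : 4 ^ m = 2 ^ m * 2 ^ m by rewrite -Rpow_mult_distr; congr (_ ^ _); ring.
  have -> : 16 ^ k = (2 ^ 2) ^ k * (2 ^ 2) ^ k by rewrite -Rpow_mult_distr; congr (_ ^ _); ring.
  ring.
have h1 := bin_le_expn (m + 2 * k) k.
have h2 : (m + k <= 2 ^ (m + 2 * k))%N by have := ltn_expl (m + 2 * k) (ltnSn 1); lia.
have h3 : (1 <= 2 ^ (m + 2 * k))%N by rewrite expn_gt0.
rewrite -E /acoef /bcoef -mult_INR; split; (split; first exact: pos_INR); apply: le_INR; apply/leP.
  by rewrite -{1}['C(_, _)]muln1; apply: leq_mul.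
exact: leq_mul.
Qed.

Lemma ex_series_coef (u : nat -> R) m w : 0 <= w <= 1 / 96 ->
  (forall k, 0 <= u k <= 4 ^ m * 16 ^ k) -> ex_series (fun k => u k * w ^ k).
Proof.
move=> w0 Hu.
apply: (ex_series_le (V := R_CompleteNormedModule) _ (fun k => 4 ^ m * (1 / 6) ^ k)) => [k|].
  rewrite /norm /= /abs /= Rabs_pos_eq; last first.
    by apply: Rmult_le_pos; [case: (Hu k) | apply: pow_le; lra].
  apply: Rle_trans (_ : 4 ^ m * 16 ^ k * (1 / 96) ^ k <= _).
    apply: Rmult_le_compat; [by case: (Hu k) | by apply: pow_le; lra | by case: (Hu k) |].
    exact: pow_incr.
  by right; rewrite Rmult_assoc -Rpow_mult_distr; congr (_ * _ ^ _); field.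
apply: ex_series_scal_l; exists (/ (1 - 1 / 6)); apply: is_series_geom.
by rewrite Rabs_pos_eq; lra.
Qed.

Lemma ex_acoef m w : 0 <= w <= 1 / 96 -> ex_series (fun k => acoef m k * w ^ k).
Proof. by move=> w0; apply: (ex_series_coef _ m) => // k; case: (bcoef_bound m k). Qed.

Lemma ex_bcoef m w : 0 <= w <= 1 / 96 -> ex_series (fun k => bcoef m k * w ^ k).
Proof. by move=> w0; apply: (ex_series_coef _ m) => // k; case: (bcoef_bound m k). Qed.

Definition aser (m : nat) (w : R) : R := Series (fun k => acoef m k * w ^ k).
Definition bser (m : nat) (w : R) : R := Series (fun k => bcoef m k * w ^ k).

Lemma acoef_rec m k : acoef m.+1 k.+1 = acoef m k.+1 + acoef m.+2 k.
Proof.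
rewrite /acoef (_ : m.+1 + 2 * k.+1 = (m + 2 * k.+1).+1)%N; last by lia.
by rewrite binS plus_INR (_ : m.+2 + 2 * k = m + 2 * k.+1)%N //; lia.
Qed.

Lemma bcoef_rec m k : bcoef m.+1 k.+1 = bcoef m k.+1 + acoef m k.+1 + bcoef m.+2 k.
Proof.
have := acoef_rec m k; rewrite /bcoef -!/(acoef _ _) => ->.
by rewrite !plus_INR !S_INR; ring.
Qed.

Lemma acoef0 m : acoef m 0 = 1.
Proof. by rewrite /acoef bin0. Qed.

Lemma bcoef0 m : bcoef m 0 = INR m.
Proof. by rewrite /bcoef bin0 addn0 Rmult_1_l. Qed.

Lemma ser_head (u : nat -> R) w : ex_series (fun k => u k * w ^ k) ->
  Series (fun k => u k * w ^ k) = u O + Series (fun k => u k.+1 * w ^ k.+1).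
Proof. by move=> H; rewrite (Series_incr_1 _ H) /= Rmult_1_r. Qed.

Lemma ex_ser_tail (u : nat -> R) w : ex_series (fun k => u k * w ^ k) ->
  ex_series (fun k => u k.+1 * w ^ k.+1).
Proof. by move=> H; apply/(ex_series_incr_1 (fun k => u k * w ^ k)). Qed.

Lemma ser_shift (u : nat -> R) w : Series (fun k => u k * w ^ k.+1) = w * Series (fun k => u k * w ^ k).
Proof. by rewrite -Series_scal_l; apply: Series_ext => k /=; ring. Qed.

Lemma ex_ser_shift (u : nat -> R) w : ex_series (fun k => u k * w ^ k) ->
  ex_series (fun k => u k * w ^ k.+1).
Proof.
move=> H; apply: (ex_series_ext (fun k => w * (u k * w ^ k))); first by move=> k /=; ring.
exact: ex_series_scal_l.
Qed.

Lemma aser_rec m w : 0 <= w <= 1 / 96 -> aser m.+1 w = aser m w + w * aser m.+2 w.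
Proof.
move=> w0; have e1 := ex_acoef m.+1 w w0; have e0 := ex_acoef m w w0; have e2 := ex_acoef m.+2 w w0.
rewrite /aser (ser_head _ _ e1) (ser_head _ _ e0) !acoef0 -ser_shift Rplus_assoc; congr (_ + _).
rewrite -Series_plus; [| exact: ex_ser_tail | exact: ex_ser_shift].
by apply: Series_ext => k; rewrite acoef_rec; ring.
Qed.

Lemma bser_rec m w : 0 <= w <= 1 / 96 -> bser m.+1 w = bser m w + aser m w + w * bser m.+2 w.
Proof.
move=> w0; have e1 := ex_bcoef m.+1 w w0; have e0 := ex_bcoef m w w0.
have e2 := ex_bcoef m.+2 w w0; have e3 := ex_acoef m w w0.
rewrite /aser /bser (ser_head _ _ e1) (ser_head _ _ e0) (ser_head _ _ e3) !bcoef0 acoef0 -ser_shift S_INR.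
have -> : INR m + Series (fun k => bcoef m k.+1 * w ^ k.+1) + (1 + Series (fun k => acoef m k.+1 * w ^ k.+1)) +
  Series (fun k => bcoef m.+2 k * w ^ k.+1) = INR m + 1 + (Series (fun k => bcoef m k.+1 * w ^ k.+1) + Series (fun k => acoef m k.+1 * w ^ k.+1) +
  Series (fun k => bcoef m.+2 k * w ^ k.+1)) by ring.
congr (_ + _).
have t1 := ex_ser_tail _ _ e0; have t2 := ex_ser_tail _ _ e3.
rewrite -(Series_plus _ _ t1 t2) -Series_plus; [| exact: (ex_series_plus (V := R_NormedModule)) | exact: ex_ser_shift].
by apply: Series_ext => k; rewrite bcoef_rec; ring.
Qed.

Lemma bin_middle k : 'C((2 * k).+1, k.+1) = 'C((2 * k).+1, k).
Proof.
have h : (k <= (2 * k).+1)%N by lia.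
by rewrite -[RHS](bin_sub h) (_ : (2 * k).+1 - k = k.+1)%N //; lia.
Qed.

Lemma bin_central k : 'C((2 * k).+2, k.+1) = (2 * 'C((2 * k).+1, k))%N.
Proof.
by rewrite binS bin_middle addnn -mul2n.
Qed.

(** Three-term recurrences need two starting values; doubling of central binomial coefficients links
    the series for [m = 1] to the one for [m = 0]. *)
Lemma acoef_01 k : acoef 0 k.+1 = 2 * acoef 1 k.
Proof.
rewrite /acoef (_ : 0 + 2 * k.+1 = (2 * k).+2)%N; last by lia.
by rewrite bin_central mult_INR (_ : 1 + 2 * k = (2 * k).+1)%N.
Qed.

Lemma bcoef_01 k : bcoef 0 k.+1 = 2 * bcoef 1 k.
Proof.
have := acoef_01 k; rewrite /bcoef -!/(acoef _ _) => ->.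
by rewrite add0n add1n; ring.
Qed.

(** As [bcoef 0 k = k acoef 0 k], this is the differential equation [(1 - 4 w) A' = 2 A] of the
    central binomial series, read on coefficients. *)
Lemma bcoef_00 k : bcoef 0 k.+1 = 4 * bcoef 0 k + 2 * acoef 0 k.
Proof.
have h : (k.+1 * 'C((2 * k).+1, k) = (2 * k).+1 * 'C(2 * k, k))%N.
  by have := mul_bin_diag (2 * k).+1 k; rewrite bin_middle /=; lia.
have h' := f_equal INR h; rewrite !mult_INR !S_INR in h'.
rewrite /bcoef /acoef !add0n (_ : 2 * k.+1 = (2 * k).+2)%N; last by lia.
rewrite bin_central mult_INR !S_INR mult_INR in h' *.
rewrite /= in h' *; lra.
Qed.

(** The differential equation makes [A^2 (1 - 4 w)] constant, and nonnegative coefficients select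
    the positive root. *)
Lemma aser_0 w : 0 < w <= 1 / 96 -> aser 0 w = / sqrt (1 - 4 * w).
Proof.
move=> w0.
have rad (x : R) : 0 <= x <= 1 / 96 -> Rbar_lt (Rabs x) (CV_radius (acoef 0)).
  move=> x0; apply: (Rbar_lt_le_trans _ (1 / 16)); first by rewrite Rabs_pos_eq /=; lra.
  have [H _] := CV_radius_bounded (acoef 0); apply: H.
  exists 1 => n; have [[h1 h2] _] := bcoef_bound 0 n.
  rewrite Rabs_pos_eq; last by apply: Rmult_le_pos => //; apply: pow_le; lra.
  apply: Rle_trans (_ : 16 ^ n * (1 / 16) ^ n <= _).
    by apply: Rmult_le_compat_r; [apply: pow_le; lra | move: h2; rewrite /= Rmult_1_l].
  by rewrite -Rpow_mult_distr (_ : 16 * (1 / 16) = 1) ?pow1; [lra | field].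
have D x : 0 <= x <= 1 / 96 -> is_derive (aser 0) x (PSeries (PS_derive (acoef 0)) x).
  by move=> x0; exact: is_derive_PSeries (rad x x0).
have E x : 0 <= x <= 1 / 96 -> (1 - 4 * x) * PSeries (PS_derive (acoef 0)) x = 2 * aser 0 x.
  move=> x0.
  have e1 := ex_bcoef 0 x x0; have e2 := ex_acoef 0 x x0.
  have dE : PSeries (PS_derive (acoef 0)) x = 4 * bser 0 x + 2 * aser 0 x.
    rewrite /bser /aser -!Series_scal_l -Series_plus; [| exact: ex_series_scal_l | exact: ex_series_scal_l].
    apply: Series_ext => k; rewrite /PS_derive.
    rewrite (_ : INR k.+1 * acoef 0 k.+1 = bcoef 0 k.+1); last by rewrite /bcoef -/(acoef _ _) add0n Rmult_comm.
    by rewrite bcoef_00; ring.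
  have bE : bser 0 x = x * PSeries (PS_derive (acoef 0)) x.
    rewrite /bser (ser_head _ _ e1) bcoef0 /= Rplus_0_l -Series_scal_l; apply: Series_ext => k.
    rewrite /PS_derive (_ : INR k.+1 * acoef 0 k.+1 = bcoef 0 k.+1); last by rewrite /bcoef -/(acoef _ _) add0n Rmult_comm.
    by rewrite /=; ring.
  by rewrite bE in dE; lra.
have a0 : aser 0 0 = 1.
  rewrite /aser (ser_head (acoef 0)); last by apply: ex_acoef; lra.
  rewrite acoef0 (Series_ext _ (fun k => 0 * (acoef 0 k.+1))).
    by rewrite Series_scal_l; ring.
  by move=> k /=; ring.
have sq : aser 0 w ^ 2 * (1 - 4 * w) = 1.
  have H : is_RInt (fun=> 0) 0 w (minus (aser 0 w ^ 2 * (1 - 4 * w)) (aser 0 0 ^ 2 * (1 - 4 * 0))).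
    apply: (is_RInt_derive (fun x => aser 0 x ^ 2 * (1 - 4 * x))) => x; last by move=> _; exact: continuous_const.
    rewrite Rmin_left ?Rmax_right; [| lra | lra] => Hx.
    have x0 : 0 <= x <= 1 / 96 by lra.
    have d1 : is_derive (fun x => 1 - 4 * x) x (- 4) by auto_derive => //; ring.
    have := is_derive_mult _ _ x _ _ (is_derive_pow _ 2 x _ (D x x0)) d1 Rmult_comm.
    congr is_derive; rewrite /plus /mult /=.
    have := E x x0; set d := PSeries _ x; set a := aser 0 x => e.
    have -> : (1 + 1) * d * (a * 1) * (1 - 4 * x) + a * (a * 1) * -4 = 2 * a * ((1 - 4 * x) * d) - 4 * a * a by ring.
    by rewrite e; ring.
  have := is_RInt_unique _ _ _ _ H; rewrite RInt_const a0.
  by rewrite /minus /plus /opp /scal /= /mult /=; lra.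
have ap : 0 <= aser 0 w.
  have h0 : Series (fun=> 0) = 0.
    by rewrite (Series_ext _ (fun k => 0 * 0)) ?Series_scal_l; [ring | move=> _; ring].
  rewrite -h0 /aser; apply: Series_le; last by apply: ex_acoef; lra.
  move=> k; split; first lra.
  by apply: Rmult_le_pos; [case: (bcoef_bound 0 k) => -[] | apply: pow_le; lra].
have s0 : 0 < sqrt (1 - 4 * w) by apply: sqrt_lt_R0; lra.
have ss := sqrt_sqrt (1 - 4 * w) ltac:(lra).
have h : aser 0 w * sqrt (1 - 4 * w) = 1.
  have : (aser 0 w * sqrt (1 - 4 * w)) * (aser 0 w * sqrt (1 - 4 * w)) = 1.
    by rewrite -[RHS]sq -[in RHS]ss; ring.
  have : 0 <= aser 0 w * sqrt (1 - 4 * w) by apply: Rmult_le_pos; lra.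
  nra.
by apply: (Rmult_eq_reg_r (sqrt (1 - 4 * w))); [rewrite h Rinv_l; lra | lra].
Qed.

(* [2 / (1 + s)] is the value [(1 - s) / (2 w)] at [w = (1 - s^2) / 4] of the Catalan generating function. *)
Lemma aser_bser_closed s m : 0 < s < 1 -> (1 - s ^ 2) / 4 <= 1 / 96 ->
  aser m ((1 - s ^ 2) / 4) = (2 / (1 + s)) ^ m / s /\
  bser m ((1 - s ^ 2) / 4) =
    INR m * (2 / (1 + s)) ^ m * (1 + s) / (2 * s ^ 2) + 2 * ((1 - s ^ 2) / 4) * (2 / (1 + s)) ^ m / s ^ 3.
Proof.
move=> s01; set w := (1 - s ^ 2) / 4 => wb; set c := 2 / (1 + s).
have w0 : 0 < w by rewrite /w; nra.
have w01 : 0 <= w <= 1 / 96 by lra.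
have A0 : aser 0 w = / s.
  rewrite aser_0; last lra.
  by rewrite (_ : 1 - 4 * w = s * s) ?sqrt_square; [| lra | rewrite /w; field].
have e0 := ex_acoef 0 w w01; have e1 := ex_acoef 1 w w01.
have f0 := ex_bcoef 0 w w01; have f1 := ex_bcoef 1 w w01.
have A1 : aser 0 w = 1 + 2 * w * aser 1 w.
  rewrite {1}/aser (ser_head _ _ e0) acoef0 /aser; congr (_ + _).
  rewrite Rmult_assoc -ser_shift -Series_scal_l; apply: Series_ext => k.
  by rewrite acoef_01; ring.
have B1 : bser 0 w = 2 * w * bser 1 w.
  rewrite {1}/bser (ser_head _ _ f0) bcoef0 /= Rplus_0_l /bser.
  rewrite Rmult_assoc -ser_shift -Series_scal_l; apply: Series_ext => k.
  by rewrite bcoef_01 /=; ring.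
have B0 : bser 0 w = w * (4 * bser 0 w + 2 * aser 0 w).
  rewrite {1}/bser (ser_head _ _ f0) bcoef0 /= Rplus_0_l /bser /aser.
  rewrite -!Series_scal_l -Series_plus; [| exact: ex_series_scal_l | exact: ex_series_scal_l].
  rewrite -Series_scal_l; apply: Series_ext => k.
  by rewrite bcoef_00 /=; ring.
have sp : 0 < s ^ 2 by apply: pow_lt; lra.
have B0' : bser 0 w = 2 * w / s ^ 3.
  have : bser 0 w * s ^ 2 = 2 * w / s.
    have -> : s ^ 2 = 1 - 4 * w by rewrite /w; field.
    by rewrite A0 in B0; rewrite /Rdiv; lra.
  move=> h; apply: (Rmult_eq_reg_r (s ^ 2)); last lra.
  by rewrite h; field; lra.
have base : (aser 0 w = c ^ 0 / s /\ bser 0 w = INR 0 * c ^ 0 * (1 + s) / (2 * s ^ 2) + 2 * w * c ^ 0 / s ^ 3) /\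
  (aser 1 w = c ^ 1 / s /\ bser 1 w = INR 1 * c ^ 1 * (1 + s) / (2 * s ^ 2) + 2 * w * c ^ 1 / s ^ 3).
  split; split.
  - by rewrite A0 /=; field; lra.
  - by rewrite B0' /=; field; lra.
  - apply: (Rmult_eq_reg_l (2 * w)); last lra.
    have -> : 2 * w * aser 1 w = / s - 1 by lra.
    by rewrite /c /w /=; field; lra.
  - apply: (Rmult_eq_reg_l (2 * w)); last lra.
    rewrite -B1 B0' /c /w /=; field; lra.
have step : forall j, (aser j w = c ^ j / s /\ bser j w = INR j * c ^ j * (1 + s) / (2 * s ^ 2) + 2 * w * c ^ j / s ^ 3) /\
  (aser j.+1 w = c ^ j.+1 / s /\ bser j.+1 w = INR j.+1 * c ^ j.+1 * (1 + s) / (2 * s ^ 2) + 2 * w * c ^ j.+1 / s ^ 3).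
  elim=> [//|j [[a0 b0] [a1 b1]]]; split=> //.
  have ra := aser_rec j w w01; have rb := bser_rec j w w01.
  rewrite a0 a1 in ra; rewrite a0 b0 b1 in rb.
  split; apply: (Rmult_eq_reg_l w); try lra.
    have -> : w * aser j.+2 w = c ^ j.+1 / s - c ^ j / s by lra.
    by rewrite /= /c /w; field; lra.
  have -> : w * bser j.+2 w = INR j.+1 * c ^ j.+1 * (1 + s) / (2 * s ^ 2) + 2 * w * c ^ j.+1 / s ^ 3
     - (INR j * c ^ j * (1 + s) / (2 * s ^ 2) + 2 * w * c ^ j / s ^ 3) - c ^ j / s by lra.
  rewrite !S_INR -!tech_pow_Rmult /c /w; field; lra.
by case: (step m).
Qed.

(** * The double series behind [omega] *)

Definition pzero : R := PI / (24 * sqrt 6).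

(** The coefficient of [z^(m + 2 k)] in [- pzero * z * hfun z]: [m] comes from the exponential
    series and [k] from powers of [w = z^2 / 96]. *)
Definition tcoef (m k : nat) : R := bcoef m k * (1 / 96) ^ k * ((- pzero) ^ m / INR m`!).

Lemma sum_n_single (f : nat -> R) (j M : nat) : (j <= M)%N ->
  sum_n (fun m => if m == j then f m else 0) M = f j.
Proof.
have Z n : (n < j)%N -> sum_n (fun m => if m == j then f m else 0) n = 0.
  elim: n => [|n IH] h; first by rewrite sum_O (_ : 0%N == j = false) //; lia.
  rewrite sum_Sn IH; last by lia.
  have -> : (n.+1 == j) = false by lia.
  exact: Rplus_0_l.
elim: M => [|M IH] h.
  have -> : j = O by lia.
  by rewrite sum_O.
rewrite sum_Sn; case: (ltnP M j) => h'.
  rewrite Z //; have -> : j = M.+1 by lia.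
  by rewrite eqxx; exact: Rplus_0_l.
rewrite IH //; have -> : (M.+1 == j) = false by lia.
exact: Rplus_0_r.
Qed.

Lemma sum_n_trunc (f : nat -> R) (j M : nat) : (j <= M)%N ->
  sum_n (fun m => if (m <= j)%N then f m else 0) M = sum_n f j.
Proof.
elim: M => [|M IH] h.
  by rewrite (_ : j = O) ?sum_O //; lia.
case: (ltnP M j) => h'.
  rewrite (_ : j = M.+1); last by lia.
  by apply: sum_n_ext_loc => n /leP ->.
by rewrite sum_Sn IH // leqNgt ltnS h' /plus /=; ring.
Qed.

Lemma sum_n_zero M : sum_n (fun _ : nat => 0) M = 0.
Proof. by elim: M => [|M IH]; [rewrite sum_O | rewrite sum_Sn IH /plus /=; ring]. Qed.

Lemma factE n : Factorial.fact n = n`!.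
Proof. by elim: n => //= n IH; rewrite factS -IH. Qed.

Lemma INR_fact_gt0 n : 0 < INR n`!.
Proof. by apply: lt_0_INR; apply/leP; exact: fact_gt0. Qed.

Lemma is_exp_series x : is_series (fun m => x ^ m / INR m`!) (exp x).
Proof.
have := is_exp_Reals x; apply: is_series_ext => m.
by rewrite factE pow_n_pow /scal /= /mult /=; rewrite /Rdiv; ring.
Qed.

Lemma is_exp_series1 x : is_series (fun m => INR m * (x ^ m / INR m`!)) (x * exp x).
Proof.
apply: is_series_decr_1.
have -> : plus (x * exp x) (opp (INR 0 * (x ^ 0 / INR 0`!))) = x * exp x.
  by rewrite /plus /opp /=; ring.
have := is_series_scal x _ _ (is_exp_series x).
apply: is_series_ext => m.
rewrite /scal /= /mult /=; rewrite factS mult_INR -/(INR m.+1).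
by Rfield; split; [have := INR_fact_gt0 m; lra | apply: not_0_INR].
Qed.

Lemma tcoef_bound m k : Rabs (tcoef m k) <= (4 * pzero) ^ m / INR m`! * (1 / 6) ^ k.
Proof.
have s6 : 0 < sqrt 6 by apply: sqrt_lt_R0; lra.
have P := PI_RGT_0.
have p0 : 0 < pzero by apply: Rdiv_lt_0_compat; lra.
have f0 := INR_fact_gt0 m.
have [_ [b0 b1]] := bcoef_bound m k.
have w0 : 0 <= (1 / 96) ^ k by apply: pow_le; lra.
rewrite /tcoef; set b := bcoef m k in b0 b1 *.
rewrite (Rabs_mult (b * _)) (Rabs_mult b) /Rdiv (Rabs_mult (_ ^ m)) Rabs_inv -!RPow_abs Rabs_Ropp -!/(Rdiv _ _) !Rabs_pos_eq; try lra.
have -> : (4 * pzero) ^ m / INR m`! * (1 / 6) ^ k = 4 ^ m * 16 ^ k * (1 / 96) ^ k * (pzero ^ m * / INR m`!).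
  rewrite (_ : 1 / 6 = 16 * (1 / 96)); last by field.
  by rewrite !Rpow_mult_distr /Rdiv; ring.
apply: Rmult_le_compat_r; last exact: Rmult_le_compat_r.
by apply: Rmult_le_pos; [apply: pow_le; lra | left; exact: Rinv_0_lt_compat].
Qed.

Lemma tcoef_summable : exists K, forall M L, sum_n (fun m => sum_n (fun k => Rabs (tcoef m k)) L) M <= K.
Proof.
have s6 : 0 < sqrt 6 by apply: sqrt_lt_R0; lra.
have P := PI_RGT_0.
have p0 : 0 < pzero by apply: Rdiv_lt_0_compat; lra.
exists (exp (4 * pzero) * (6 / 5)) => M L.
have u0 m : 0 <= (4 * pzero) ^ m / INR m`!.
  by apply: Rdiv_le_0_compat; [apply: pow_le; lra | exact: INR_fact_gt0].
have hv : sum_n (fun k => (1 / 6) ^ k) L <= 6 / 5.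
  have : sum_n (fun k => (1 / 6) ^ k) L = 6 / 5 - (1 / 6) ^ L / 5.
    elim: L => [|L IH]; first by rewrite sum_O /=; field.
    by rewrite sum_Sn IH /plus /=; field.
  by have : 0 <= (1 / 6) ^ L by [apply: pow_le; lra]; lra.
have hu : sum_n (fun m => (4 * pzero) ^ m / INR m`!) M <= exp (4 * pzero).
  apply: (is_lim_seq_incr_compare (sum_n (fun m => (4 * pzero) ^ m / INR m`!)) (exp (4 * pzero))).
    exact: (is_exp_series (4 * pzero)).
  by move=> n; rewrite sum_Sn /plus /=; have := u0 n.+1; rewrite /=; lra.
apply: Rle_trans (_ : sum_n (fun m => mult ((4 * pzero) ^ m / INR m`!) (sum_n (fun k => (1 / 6) ^ k) L)) M <= _).
  apply: sum_n_m_le => m.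
  rewrite -sum_n_mult_l; apply: sum_n_m_le => k; exact: tcoef_bound.
rewrite sum_n_mult_r; apply: Rmult_le_compat => //.
  by elim: M {hu} => [|M IH]; [rewrite sum_O; exact: u0 | rewrite sum_Sn /plus /=; have := u0 M.+1; rewrite /=; lra].
elim: L {hv} => [|L IH]; first by rewrite sum_O /=; lra.
by rewrite sum_Sn /plus; apply: Rplus_le_le_0_compat => //; apply: pow_le; lra.
Qed.

(** Terms of total degree at most [N] inside the box [m <= M], [k <= L]. Once the box is large
    enough the value no longer depends on it, so regrouping by degree takes place in finite sums. *)
Definition ptrunc (z : R) (N M L : nat) : R :=
  sum_n (fun m => sum_n (fun k => if (m + 2 * k <= N)%N then z ^ (m + 2 * k) * tcoef m k else 0) L) M.

(** The degree is [r + 1] because of the factor [- pzero * z] in front of [hfun]; its [PI / 6] also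
    turns the possibly negative power in [omega] into a nonnegative one. With
    [g = - 1 / (4 sqrt 6)], [g^2 = 1 / 96] and [- pzero = g PI / 6]. *)
Lemma omega_tcoef (r : nat) :
  omega r * (- pzero) = sum_n (fun k => tcoef (r.+1 - 2 * k) k) (r.+1)./2.
Proof.
have s6 : 0 < sqrt 6 by apply: sqrt_lt_R0; lra.
have P := PI_RGT_0; have ss := sqrt_sqrt 6 ltac:(lra).
pose g := - / (4 * sqrt 6).
have pg : - pzero = g * (PI / 6) by rewrite /pzero /g; field; lra.
have gg : g * g = 1 / 96.
  have -> : g * g = / (16 * (sqrt 6 * sqrt 6)) by rewrite /g; field; lra.
  by rewrite ss; field.
have gr : 1 / (- (4 * sqrt 6)) ^ r = g ^ r.
  rewrite /Rdiv Rmult_1_l -pow_inv; congr (_ ^ _); rewrite /g; field; lra.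
rewrite /omega gr -/(sum_n _ _) pg.
set f := (fun k => _ * powerRZ _ _).
have -> : g ^ r * sum_n f (r.+1)./2 * (g * (PI / 6)) = mult (g ^ r.+1 * (PI / 6)) (sum_n f (r.+1)./2).
  by rewrite /mult /=; ring.
rewrite -sum_n_mult_l; apply: sum_n_ext_loc => k /leP hk.
have {}hk : (2 * k <= r.+1)%N by lia.
rewrite /mult /= /f /tcoef /bcoef.
rewrite (_ : r.+1 - 2 * k + 2 * k = r.+1)%N; last by lia.
rewrite (_ : r.+1 - 2 * k + k = r.+1 - k)%N; last by lia.
set m := (r.+1 - 2 * k)%N.
have E1 : powerRZ (PI / 6) (Z.of_nat r - 2 * Z.of_nat k) * (PI / 6) = (PI / 6) ^ m.
  have n0 : PI / 6 <> 0 by lra.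
  rewrite -{2}[PI / 6]powerRZ_1 -powerRZ_add // pow_powerRZ; congr powerRZ; rewrite /m; lia.
have E2 : (1 / 96) ^ k * (- pzero) ^ m = g ^ r.+1 * (PI / 6) ^ m.
  rewrite pg Rpow_mult_distr -gg (_ : r.+1 = (k + k + m)%N); last by rewrite /m; lia.
  by rewrite Rpow_mult_distr -!plusE !pow_add; ring.
have -> : INR 'C(r.+1, k) * INR (r.+1 - k) * (1 / 96) ^ k * ((- pzero) ^ m / INR m`!) =
  INR 'C(r.+1, k) * INR (r.+1 - k) / INR m`! * ((1 / 96) ^ k * (- pzero) ^ m) by rewrite /Rdiv; ring.
rewrite E2 -E1 /= /Rdiv; ring.
Qed.

Lemma ptruncS z N M L : (N.+1 <= M)%N -> (N.+1 <= L)%N ->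
  ptrunc z N.+1 M L = ptrunc z N M L + (- pzero * z) * (omega N * z ^ N).
Proof.
move=> hM hL.
have -> : ptrunc z N.+1 M L = plus (ptrunc z N M L)
   (sum_n (fun m => sum_n (fun k => if (m + 2 * k == N.+1)%N then z ^ (m + 2 * k) * tcoef m k else 0) L) M).
  rewrite /ptrunc -sum_n_plus; apply: sum_n_ext => m.
  rewrite -sum_n_plus; apply: sum_n_ext => k; rewrite leq_eqVlt ltnS.
  case: eqP => [->|_]; first by rewrite ltnn /= /plus /=; Rring.
  by case: ifP => _; rewrite /plus /=; Rring.
apply: (f_equal (Rplus (ptrunc z N M L))); rewrite sum_n_switch.
have -> : - pzero * z * (omega N * z ^ N) = mult (z ^ N.+1) (omega N * - pzero) by rewrite /mult /=; ring.
rewrite omega_tcoef -sum_n_mult_l.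
have hk : ((N.+1)./2 <= L)%N by lia.
rewrite -(sum_n_trunc (fun k => mult (z ^ N.+1) (tcoef (N.+1 - 2 * k) k)) _ _ hk).
apply: sum_n_ext => k.
case: (leqP k (N.+1)./2) => h.
  have hj : (N.+1 - 2 * k <= M)%N by lia.
  rewrite -[RHS](sum_n_single (fun m => z ^ N.+1 * tcoef m k) _ _ hj).
  apply: sum_n_ext => m.
  have -> : (m + 2 * k == N.+1)%N = (m == N.+1 - 2 * k)%N by apply/eqP/eqP; lia.
  case: eqP => // ->.
  by rewrite (_ : N.+1 - 2 * k + 2 * k = N.+1)%N //; lia.
rewrite (sum_n_ext _ (fun => 0)); first exact: sum_n_zero.
by move=> m; rewrite (_ : (m + 2 * k == N.+1)%N = false) //; apply/eqP; lia.
Qed.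

Lemma ptrunc_omega z N M L : (N.+1 <= M)%N -> (N.+1 <= L)%N ->
  ptrunc z N.+1 M L = (- pzero * z) * sum_n (fun r => omega r * z ^ r) N.
Proof.
elim: N => [|N IH] hM hL.
  rewrite ptruncS // sum_O.
  have -> : ptrunc z 0 M L = 0.
    rewrite /ptrunc (sum_n_ext _ (fun => 0)); first exact: sum_n_zero.
    move=> m; rewrite (sum_n_ext _ (fun => 0)); first exact: sum_n_zero.
    move=> k; case: ifP => // h.
    have -> : m = O by lia.
    have -> : k = O by lia.
    by rewrite /tcoef bcoef0 /=; ring.
  by rewrite Rplus_0_l.
rewrite ptruncS // IH; [| lia | lia].
by rewrite sum_Sn /plus /=; ring.
Qed.

Lemma sum_n_abs_le (f g : nat -> R) M : (forall m, Rabs (f m) <= g m) -> Rabs (sum_n f M) <= sum_n g M.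
Proof.
move=> H; elim: M => [|M IH]; first by rewrite !sum_O.
rewrite !sum_Sn /plus /=; apply: Rle_trans (Rabs_triang _ _) _.
exact: Rplus_le_compat.
Qed.

(** Each omitted term has [z^(m + 2 k) <= z^(N + 1)] as [z <= 1], and [tcoef] is absolutely
    summable; so the bound is uniform in the box. *)
Lemma ptrunc_remainder : exists K, forall z N M L, 0 <= z <= 1 ->
  Rabs (sum_n (fun m => sum_n (fun k => z ^ (m + 2 * k) * tcoef m k) L) M - ptrunc z N M L) <= z ^ N.+1 * K.
Proof.
have [K HK] := tcoef_summable; exists K => z N M L z01.
have zN : 0 <= z ^ N.+1 by apply: pow_le; lra.
have -> : sum_n (fun m => sum_n (fun k => z ^ (m + 2 * k) * tcoef m k) L) M - ptrunc z N M L =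
  sum_n (fun m => sum_n (fun k => if (m + 2 * k <= N)%N then 0 else z ^ (m + 2 * k) * tcoef m k) L) M.
  have e : sum_n (fun m => sum_n (fun k => z ^ (m + 2 * k) * tcoef m k) L) M =
    plus (sum_n (fun m => sum_n (fun k => if (m + 2 * k <= N)%N then 0 else z ^ (m + 2 * k) * tcoef m k) L) M) (ptrunc z N M L).
    rewrite /ptrunc -sum_n_plus; apply: sum_n_ext => m; rewrite -sum_n_plus; apply: sum_n_ext => k.
    by rewrite /plus /=; case: ifP => _; ring.
  by rewrite e /plus /=; ring.
apply: Rle_trans (_ : mult (z ^ N.+1) (sum_n (fun m => sum_n (fun k => Rabs (tcoef m k)) L) M) <= _); last first.
  exact: Rmult_le_compat_l.
rewrite -sum_n_mult_l; apply: sum_n_abs_le => m.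
rewrite -sum_n_mult_l; apply: sum_n_abs_le => k.
rewrite /mult /=; case: ltnP => h.
  rewrite Rabs_mult Rabs_pos_eq; last by apply: pow_le; lra.
  apply: Rmult_le_compat_r; first exact: Rabs_pos.
  exact: (pow_antitone _ _ _ z01 h).
by rewrite Rabs_R0; apply: Rmult_le_pos => //; exact: Rabs_pos.
Qed.

Lemma lim_abs_le (u : nat -> R) (l c K : R) (n0 : nat) : is_lim_seq u l ->
  (forall n, (n0 <= n)%N -> Rabs (u n - c) <= K) -> Rabs (l - c) <= K.
Proof.
move=> H HK; apply: Rnot_lt_le => h.
have e0 : 0 < Rabs (l - c) - K by lra.
have := H (ball l (mkposreal _ e0)) (locally_ball _ _).
move=> [N HN].
have := HN (maxn N n0) ltac:(apply/leP; exact: leq_maxl).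
have := HK (maxn N n0) (leq_maxr _ _).
set a := u _ => h1 h2.
have {}h2 : Rabs (a - l) < Rabs (l - c) - K := h2.
have := Rabs_triang (l - a) (a - c).
rewrite (_ : l - a + (a - c) = l - c); last ring.
by rewrite (Rabs_minus_sym l a); lra.
Qed.

Lemma is_lim_seq_sum_n (f : nat -> nat -> R) (l : nat -> R) M :
  (forall m, is_lim_seq (f m) (l m)) -> is_lim_seq (fun L => sum_n (fun m => f m L) M) (sum_n l M).
Proof.
move=> H; elim: M => [|M IH].
  by rewrite sum_O; apply: is_lim_seq_ext (H O) => L; rewrite sum_O.
rewrite sum_Sn; apply: is_lim_seq_ext (is_lim_seq_plus' _ _ _ _ IH (H M.+1)) => L.
by rewrite sum_Sn.
Qed.

(** At [z = n^(-1/2)], where [y = n s^2], this is the closed form divided by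
    [exp (PI sqrt (2 n / 3)) / (4 sqrt 3 n)]. The exponent is exactly [X - PI sqrt (2 n / 3)], and
    the second factor is [(1 - 1 / X) / s^2]. *)
Definition hfun (z : R) : R :=
  let s := sqrt (1 - z ^ 2 / 24) in
  exp (- pzero * z * (2 / (1 + s))) * (/ s ^ 2 + (1 - s ^ 2) / (2 * (- pzero * z) * s ^ 3)).

(** In its closed form [bser m] combines [m c^m] and [c^m]. Summed against [p^m / m!] these give
    [p c exp (p c)] and [exp (p c)], and [c (1 + s) = 2] simplifies the first coefficient to
    [p / s^2]. *)
Lemma is_series_hfun z : 0 < z <= 1 ->
  is_series (fun m => bser m (z ^ 2 / 96) * ((- pzero * z) ^ m / INR m`!)) (- pzero * z * hfun z).
Proof.
move=> z01; rewrite /hfun; set s := sqrt _; set p := - pzero * z.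
have s6 : 0 < sqrt 6 by apply: sqrt_lt_R0; lra.
have P := PI_RGT_0.
have p0 : 0 < pzero by apply: Rdiv_lt_0_compat; lra.
have pn : p <> 0 by rewrite /p; nra.
have z2 : 0 < z ^ 2 <= 1 by split; [apply: pow_lt; lra | apply: pow_le1; lra].
have s0 : 0 < s by apply: sqrt_lt_R0; lra.
have s2 : s ^ 2 = 1 - z ^ 2 / 24 by rewrite /= Rmult_1_r sqrt_sqrt //=; lra.
have s1 : s < 1 by nra.
have wE : z ^ 2 / 96 = (1 - s ^ 2) / 4 by rewrite s2; field.
rewrite wE; set w := (1 - s ^ 2) / 4; set c := 2 / (1 + s).
have w96 : (1 - s ^ 2) / 4 <= 1 / 96 by rewrite -wE; lra.
have cl m := aser_bser_closed s m (conj s0 s1) w96.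
have H1 := is_series_scal ((1 + s) / (2 * s ^ 2)) _ _ (is_exp_series1 (p * c)).
have H2 := is_series_scal (2 * w / s ^ 3) _ _ (is_exp_series (p * c)).
have := is_series_plus _ _ _ _ H1 H2.
have -> : plus (scal ((1 + s) / (2 * s ^ 2)) (p * c * exp (p * c))) (scal (2 * w / s ^ 3) (exp (p * c))) =
  p * (exp (p * c) * (/ s ^ 2 + (1 - s ^ 2) / (2 * p * s ^ 3))).
  rewrite /plus /scal /= /mult /=; set e := exp _.
  by rewrite /c /w; Rfield; split; [lra | split; lra].
apply: is_series_ext => m.
have [_ ->] := cl m; rewrite -/w -/c /plus /scal /= /mult /= Rpow_mult_distr.
have f0 := INR_fact_gt0 m.
by Rfield; split; lra.
Qed.

(** The limits are taken one index at a time, first [L], then [M], in an inequality uniform in both.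
    Dividing by [pzero * z] lowers the remainder from [z^(N + 2)] to [z^(N + 1)]. *)
Lemma omega_expansion (N : nat) : exists K, forall z, 0 < z <= 1 ->
  Rabs (hfun z - sum_n (fun r => omega r * z ^ r) N) <= K * z ^ N.+1.
Proof.
have [K HK] := ptrunc_remainder.
have s6 : 0 < sqrt 6 by apply: sqrt_lt_R0; lra.
have P := PI_RGT_0.
have p0 : 0 < pzero by apply: Rdiv_lt_0_compat; lra.
exists (K / pzero) => z z01.
set S := sum_n _ N; set p := - pzero * z.
have w0 : 0 <= z ^ 2 / 96 <= 1 / 96.
  have : 0 <= z ^ 2 <= 1 by split; [apply: pow_le; lra | apply: pow_le1; lra].
  lra.
have inner m : is_lim_seq (fun L => sum_n (fun k => z ^ (m + 2 * k) * tcoef m k) L)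
   (bser m (z ^ 2 / 96) * (p ^ m / INR m`!)).
  have H := Series_correct _ (ex_bcoef m _ w0).
  have := is_series_scal_r (p ^ m / INR m`!) _ _ H.
  apply: is_series_ext => k.
  rewrite /tcoef /p Rpow_mult_distr.
  have -> : (z ^ 2 / 96) ^ k = z ^ (2 * k) * (1 / 96) ^ k.
    by rewrite pow_mult -Rpow_mult_distr; congr (_ ^ _); field.
  by rewrite -plusE pow_add /Rdiv; Rring.
have outer (M : nat) : (N.+1 <= M)%N -> Rabs (sum_n (fun m => bser m (z ^ 2 / 96) * (p ^ m / INR m`!)) M - p * S) <= z ^ N.+2 * K.
  move=> hM; apply: (lim_abs_le _ _ _ _ N.+1 (is_lim_seq_sum_n _ _ M inner)) => L hL.
  by rewrite -(ptrunc_omega z N M L hM hL); apply: HK; lra.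
have fin : Rabs (p * hfun z - p * S) <= z ^ N.+2 * K.
  exact: (lim_abs_le _ _ _ _ N.+1 (is_series_hfun z z01) outer).
have ap : Rabs p = pzero * z by rewrite /p Rabs_mult Rabs_Ropp !Rabs_pos_eq; lra.
rewrite -Rmult_minus_distr_l Rabs_mult ap in fin.
apply: (Rmult_le_reg_l (pzero * z)); first nra.
apply: Rle_trans fin _; right; rewrite /=; field; lra.
Qed.

Lemma hfun_main (n : nat) : (0 < n)%N ->
  let y := INR n - 1 / 24 in let X := PI * sqrt (2 * y / 3) in
  exp X / (4 * sqrt 3 * y) * (1 - / X) =
  exp (PI * sqrt (2 * INR n / 3)) / (4 * sqrt 3 * INR n) * hfun (/ sqrt (INR n)).
Proof.
move=> n0 y X.
have n1 : 1 <= INR n by apply: (le_INR 1); apply/leP.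
have P := PI_RGT_0; have s3 := sqrt3_bounds.
have s6 : 0 < sqrt 6 by apply: sqrt_lt_R0; lra.
have ss6 := sqrt_sqrt 6 ltac:(lra).
set v := sqrt (INR n).
have v0 : 0 < v by apply: sqrt_lt_R0; lra.
have vv : v * v = INR n by apply: sqrt_sqrt; lra.
have v1 : 1 <= v by rewrite -sqrt_1; apply: sqrt_le_1; lra.
have CE : sqrt (2 * INR n / 3) = v * sqrt 6 / 3.
  apply: sqrt_eq; first by apply: Rdiv_le_0_compat; nra.
  have -> : v * sqrt 6 / 3 * (v * sqrt 6 / 3) = (v * v) * (sqrt 6 * sqrt 6) / 9 by field.
  by rewrite vv ss6; field.
rewrite /hfun; set s := sqrt (1 - _ / 24).
have z2 : (/ v) ^ 2 = / INR n by rewrite -vv; field; lra.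
have in0 : 0 < / INR n <= 1.
  by split; [apply: Rinv_0_lt_compat; lra | rewrite -[X in _ <= X]Rinv_1; apply: Rinv_le_contravar; lra].
have s0 : 0 < s by apply: sqrt_lt_R0; rewrite z2; lra.
have s2 : s * s = 1 - / INR n / 24 by rewrite /s z2 sqrt_sqrt //; lra.
have yE : y = v * v * (s * s) by rewrite s2 vv /y; field; lra.
have XE : sqrt (2 * y / 3) = s * (v * sqrt 6 / 3).
  apply: sqrt_eq.
    by apply: Rmult_le_pos; [lra | apply: Rdiv_le_0_compat; nra].
  rewrite yE.
  have -> : s * (v * sqrt 6 / 3) * (s * (v * sqrt 6 / 3)) = v * v * (s * s) * (sqrt 6 * sqrt 6) / 9 by field.
  by rewrite ss6; field.
have one_s : 1 - s * s = / (24 * (v * v)) by rewrite s2 vv; field; lra.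
have p1 : pzero = PI * sqrt 6 / 144.
  have e : 144 = 24 * (sqrt 6 * sqrt 6) by rewrite ss6; ring.
  by rewrite /pzero e; field; lra.
(* Here [1 - s = (1 - s^2) / (1 + s)] and [1 - s^2 = 1 / (24 n)]. *)
have eE : exp X = exp (PI * (v * sqrt 6 / 3)) * exp (- pzero * / v * (2 / (1 + s))).
  rewrite -exp_plus; congr exp; rewrite /X XE p1.
  have -> : - (PI * sqrt 6 / 144) * / v * (2 / (1 + s)) = - (PI * sqrt 6 * v / 3 * / (24 * (v * v)) / (1 + s)).
    by field; lra.
  rewrite -one_s; field; lra.
rewrite eE CE /X XE yE -vv -[s ^ 2]/(s * (s * 1)) Rmult_1_r one_s p1.
have Y0 : 0 < s * (v * sqrt 6 / 3) by apply: Rmult_lt_0_compat => //; apply: Rdiv_lt_0_compat; nra.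
set E1 := exp _; set E2 := exp _.
have -> : / (s * s) + / (24 * (v * v)) / (2 * (- (PI * sqrt 6 / 144) * / v) * s ^ 3) =
   / (s * s) * (1 - 3 / (PI * sqrt 6 * v * s)) * 1.
  have -> : 3 / (PI * sqrt 6 * v * s) = 3 * sqrt 6 / (PI * (sqrt 6 * sqrt 6) * v * s) by field; lra.
  have -> : / (24 * (v * v)) / (2 * (- (PI * sqrt 6 / 144) * / v) * s ^ 3) =
     - (3 * sqrt 6 / (PI * (sqrt 6 * sqrt 6) * v * s ^ 3)).
    by field; lra.
  by rewrite ss6; field; lra.
by field; lra.
Qed.

(** [u exp (- u) <= 1] at [u = a v / (k + 1)], raised to the power [k + 1]; the [+ 1] in the bound
    is for [v <= 1]. *)
Lemma pow_exp_bounded (k : nat) (a : R) : 0 < a ->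
  exists K, 0 <= K /\ forall v, 0 < v -> v ^ k * exp (- (a * v)) <= K.
Proof.
move=> a0; exists ((INR k.+1 / a) ^ k.+1 + 1).
have k0 : 0 < INR k.+1 by apply: lt_0_INR; lia.
have ka : 0 < INR k.+1 / a by apply: Rdiv_lt_0_compat.
have K0 : 0 <= (INR k.+1 / a) ^ k.+1 by apply: pow_le; lra.
split; first lra.
move=> v v0.
have e0 : exp (- (a * v)) <= 1 by rewrite -exp_0; apply: exp_le_compat; nra.
have ep := exp_pos (- (a * v)).
case: (Rle_dec v 1) => v1.
  have : v ^ k <= 1 by apply: pow_le1; lra.
  have : 0 <= v ^ k by apply: pow_le; lra.
  nra.
have h : v ^ k.+1 * exp (- (a * v)) <= (INR k.+1 / a) ^ k.+1.
  have -> : v = (INR k.+1 / a) * (a * v / INR k.+1) by field; lra.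
  set u := a * v / INR k.+1.
  have u0 : 0 <= u by apply: Rdiv_le_0_compat; nra.
  have -> : a * (INR k.+1 / a * u) = INR k.+1 * u by field; lra.
  have -> : - (INR k.+1 * u) = INR k.+1 * - u by ring.
  rewrite -exp_mul_nat Rpow_mult_distr Rmult_assoc -Rpow_mult_distr.
  rewrite -[X in _ <= X]Rmult_1_r; apply: Rmult_le_compat_l => //.
  have : 0 <= u * exp (- u) <= 1.
    have h1 : exp u * exp (- u) = 1 by rewrite -exp_plus Rplus_opp_r exp_0.
    have := exp_ge_1x u; have := exp_pos (- u); split; nra.
  by move=> h; apply: pow_le1.
have : v ^ k <= v ^ k.+1.
  have : 0 <= v ^ k by apply: pow_le; lra.
  by rewrite /=; nra.
nra.
Qed.

Lemma Rpower_half_pow (n r : nat) : (0 < n)%N -> Rpower (INR n) (INR r / 2) = sqrt (INR n) ^ r.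
Proof.
move=> n0; have n1 : 0 < INR n by apply: lt_0_INR; apply/leP.
rewrite -Rpower_sqrt // -Rpower_pow; last exact: exp_pos.
by rewrite Rpower_mult; congr Rpower; field.
Qed.

Lemma omega_0 : omega 0 = 1.
Proof.
rewrite /omega sum_n_n bin0 -[(1 - 0)%N]/1%N factS fact0 /=; field.
Qed.

Lemma omega_sum (n N : nat) : (0 < n)%N ->
  sum_n (fun r => omega r * (/ sqrt (INR n)) ^ r) N =
  1 + sum_n_m (fun r => omega r / Rpower (INR n) (INR r / 2)) 1 N.
Proof.
move=> n0; rewrite /sum_n sum_Sn_m; last exact: le_0_n.
rewrite omega_0 /= Rmult_1_l /plus /=; congr (_ + _).
by apply: sum_n_m_ext => r; rewrite Rpower_half_pow // pow_inv.
Qed.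

Lemma finite_bound (f : nat -> R) (n1 : nat) : exists K, 0 <= K /\ forall n, (n < n1)%N -> f n <= K.
Proof.
elim: n1 => [|m [K [K0 H]]]; first by exists 0; split; [lra | by []].
exists (Rmax K (f m)); split; first by apply: Rle_trans K0 (Rmax_l _ _).
move=> n; rewrite ltnS leq_eqVlt => /orP[/eqP->|h]; first exact: Rmax_r.
by apply: Rle_trans (H n h) (Rmax_l _ _).
Qed.

Theorem proposition4p4 (N : nat) (N_gt0 : (0 < N)%N) :
  exists K : R, forall n : nat, (0 < n)%N ->
  exists e : R,
    Rabs e <= K * (1 / Rpower (INR n) (INR N / 2)) /\
    INR (partition_number n) =
      exp (PI * sqrt (2 * INR n / 3)) / (4 * sqrt 3 * INR n) *
      (1 + sum_n_m (fun r : nat => omega r / Rpower (INR n) (INR r / 2))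
             1 (N - 1) + e).
Proof.
have [n1 HR] := hardy_ramanujan.
have [K1 HO] := omega_expansion (N - 1).
(* Dividing by the prefactor brings in [n = v^2], hence the power [N + 2]. The rate is [1 / 2000]
   because [X <= PI sqrt (2 n / 3)] and the latter is at least [2 v], so the saving [1 / 4000] of it
   is at least [v / 2000]. *)
have [K2 [K20 HE]] := pow_exp_bounded N.+2 (1 / 2000) ltac:(lra).
pose pref n := exp (PI * sqrt (2 * INR n / 3)) / (4 * sqrt 3 * INR n).
pose S n := 1 + sum_n_m (fun r : nat => omega r / Rpower (INR n) (INR r / 2)) 1 (N - 1).
pose e n := INR (partition_number n) / pref n - S n.
have [K3 [K30 HF]] := finite_bound (fun n => Rabs (e n) * sqrt (INR n) ^ N) n1.
have s3 := sqrt3_bounds; have P := PI_RGT_0; have P2 := PI2_3_2.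
(* [K3] covers the finitely many [n] below the range of [hardy_ramanujan]; [231] exceeds
   [33 * 4 * sqrt 3]. *)
exists (Rmax K3 (K1 + 231 * K2)) => n n0; exists (e n).
have nn : 1 <= INR n by apply: (le_INR 1); apply/leP.
have pref0 : 0 < pref n by apply: Rdiv_lt_0_compat; [exact: exp_pos | nra].
split; last by rewrite -/(pref n) -/(S n) /e; field; lra.
rewrite Rpower_half_pow //; set v := sqrt (INR n).
have v0 : 0 < v by apply: sqrt_lt_R0; lra.
have vN : 0 < v ^ N by apply: pow_lt.
suff main : Rabs (e n) * v ^ N <= Rmax K3 (K1 + 231 * K2).
  apply: (Rmult_le_reg_r (v ^ N)) => //.
  by rewrite Rmult_assoc /Rdiv Rmult_1_l Rinv_l; lra.
case: (ltnP n n1) => h; first by apply: Rle_trans (HF n h) (Rmax_l _ _).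
apply: Rle_trans (Rmax_r _ _).
have H := HR n h; have E := hfun_main n n0; move: H E => /=.
set y := INR n - 1 / 24; set X := PI * sqrt (2 * y / 3) => H E.
rewrite E -/(pref n) -/v in H.
have z01 : 0 < / v <= 1.
  have v1 : 1 <= v by rewrite -sqrt_1; apply: sqrt_le_1; lra.
  by split; [apply: Rinv_0_lt_compat | rewrite -[X in _ <= X]Rinv_1; apply: Rinv_le_contravar; lra].
have O := HO _ z01; rewrite omega_sum // -/(S n) in O.
rewrite (_ : (N - 1).+1 = N) in O; last by lia.
have vv : v * v = INR n by apply: sqrt_sqrt; lra.
have -> : e n = (INR (partition_number n) - pref n * hfun (/ v)) / pref n + (hfun (/ v) - S n).
  by rewrite /e; field; lra.
have A : Rabs ((INR (partition_number n) - pref n * hfun (/ v)) / pref n) * v ^ N <= 231 * K2.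
  rewrite /Rdiv Rabs_mult Rabs_inv (Rabs_pos_eq (pref n)); last lra.
  apply: Rle_trans (_ : 33 * exp ((1 - 1 / 4000) * X) * / pref n * v ^ N <= _).
    apply: Rmult_le_compat_r; first lra.
    by apply: Rmult_le_compat_r; [left; exact: Rinv_0_lt_compat | exact: H].
  set Cn := PI * sqrt (2 * INR n / 3).
  have XC : X <= Cn by apply: Rmult_le_compat_l; [lra | apply: sqrt_le_1; rewrite /y; lra].
  have Cv : 2 * v <= Cn.
    have : v * (2 / 3) <= sqrt (2 * INR n / 3).
      rewrite -(sqrt_Rsqr (v * (2 / 3))); last lra.
      by apply: sqrt_le_1; rewrite /Rsqr; nra.
    by rewrite /Cn; nra.
  have -> : / pref n = 4 * sqrt 3 * (v * v) * exp (- Cn).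
    rewrite vv exp_Ropp /pref -/Cn; field; split; [have := exp_pos Cn; lra | lra].
  have Ex : exp ((1 - 1 / 4000) * X) * exp (- Cn) <= exp (- (1 / 2000 * v)).
    by rewrite -exp_plus; apply: exp_le_compat; lra.
  have V := HE v v0; rewrite -!tech_pow_Rmult in V.
  have -> : 33 * exp ((1 - 1 / 4000) * X) * (4 * sqrt 3 * (v * v) * exp (- Cn)) * v ^ N =
    132 * sqrt 3 * ((v * (v * v ^ N)) * (exp ((1 - 1 / 4000) * X) * exp (- Cn))) by ring.
  have V0 : 0 <= v * (v * v ^ N) by repeat apply: Rmult_le_pos; lra.
  have Q : (v * (v * v ^ N)) * (exp ((1 - 1 / 4000) * X) * exp (- Cn)) <= K2.
    by apply: Rle_trans V; apply: Rmult_le_compat_l.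
  apply: Rle_trans (_ : 132 * sqrt 3 * K2 <= _); last by nra.
  by apply: Rmult_le_compat_l; lra.
have B : Rabs (hfun (/ v) - S n) * v ^ N <= K1.
  apply: Rle_trans (Rmult_le_compat_r _ _ _ (Rlt_le _ _ vN) O) _.
  by rewrite pow_inv Rmult_assoc Rinv_l; lra.
have T := Rabs_triang ((INR (partition_number n) - pref n * hfun (/ v)) / pref n) (hfun (/ v) - S n).
by have := Rmult_le_compat_r _ _ _ (Rlt_le _ _ vN) T; rewrite Rmult_plus_distr_r; lra.
Qed.
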